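(* Let $T$ be an infinite, locally finite tree rooted at $o$, with no leaves except possibly at $o$, with interaction strengths $\{J_v : v\in V(T), v\ne o\}$ satisfying $0<J_{\min}\le J_v\le J_{\max}<\infty$ for all $v\neq o$, and let $\beta>0$. Assign to each edge $e=vw$ with $v$ the parent of $w$ the resistance $$R(e) := R_w := \prod_{o<y\le w}(\tanh(\beta J_y))^{-2}.$$ Then the free boundary Gibbs measure on $\{+1,-1\}^{V(T)}$ at inverse temperature $\beta$ (with interaction strengths $J_v$) is extremal if and only if $\mathrm{cap}_2(T)=0$.
   Context: For vertices, $y\le w$ means $y$ lies on the path from the root $o$ to $w$; $y<w$ means $y\le w$, $y\neq w$. $v\to w$ means $v$ is the parent of $w$ (the neighbor of $w$ closer to $o$). The interaction $J_w$ is attached to the edge from $w$ to its parent. Capacity: $\partial T$ is the set of maximal (here infinite) paths from $o$ directed away from the root. A flow $\mu$ is a nonnegative function on edges with $\mu(vw)=\sum_{y:w\to y}\mu(wy)$ whenever $v\to w$ and $w$ is not a leaf; $|\mu|=\sum_{y:o\to y}\mu(oy)$. For $p>1$, $s=p-1$ and resistances $R(e)$, set $V_\mu(y)=\sum_{e\in y}(\mu(e)R(e))^s$ for $y\in\partial T$, $V(\mu)=\sup_{y\in\partial T}V_\mu(y)$, and $\mathrm{cap}_p(T)=\sup\{|\mu| : \mu \text{ a flow on } T \text{ with } V(\mu)=1\}$ (equal to $0$ if there is no such flow). Gibbs measures: a Gibbs measure at inverse temperature $\beta$ is a probability measure on $\{\pm1\}^{V(T)}$ such that for every finite $\Lambda\subset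 V(T)$, the conditional law of $\eta|_\Lambda$ given $\eta|_{\Lambda^c}$ is proportional to $\exp\big(\beta\sum J_w\eta(v)\eta(w)\big)$, the sum being over edges $v\to w$ with at least one endpoint in $\Lambda$. It is extremal if it is an extreme point of the convex set of Gibbs measures. The free boundary Gibbs measure is the law of the following tree-indexed Markov chain: $\eta(o)=\pm1$ with probability $1/2$ each and, recursively and independently, each vertex $v\ne o$ copies the spin of its parent with probability $(1+\theta_v)/2$ and takes the opposite spin with probability $(1-\theta_v)/2$, where $\theta_v=\tanh(\beta J_v)$. (It is the limit, as $N\to\infty$, of the measures on configurations on $\{v:|v|\le N\}$ with probability proportional to $\prod_{v\to w}\exp(\beta J_w\eta(v)\eta(w))$, where $|v|$ is the distance from $o$ to $v$.) *)

(* Defs.v *)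
From HB Require Import structures.
From mathcomp Require Import all_boot all_order all_algebra finmap.
From mathcomp Require Import all_classical all_reals all_analysis.

Set Implicit Arguments.
Unset Strict Implicit.
Unset Printing Implicit Defensive.

Import Order.TTheory GRing.Theory Num.Theory.
Import numFieldNormedType.Exports.

Local Open Scope classical_set_scope.
Local Open Scope ring_scope.

(** A rooted tree on the vertex set [V] is given by its parent map; that the
    root is its own parent is a convention only. The edges are the pairs
    [{parent w, w}] with [w] distinct from the root, so that a family indexed by
    the edges is a function on [V] evaluated at the child endpoints; its value at
    the root is irrelevant. *)
Record rooted_tree (V : choiceType) := RootedTree {
  tree_root : V;
  parent : V -> V;
  parent_tree_root : parent tree_root = tree_root;
  reach_tree_root : forall v, exists n, iter n parent v = tree_root }.

Section Trees.
Variables (V : choiceType) (T : rooted_tree V).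

Definition children (v : V) : set V :=
  [set w | w != tree_root T /\ parent T w = v].

Definition tree_le (y w : V) : Prop := exists n, iter n (parent T) w = y.

Definition tree_lt (y w : V) : Prop := tree_le y w /\ y <> w.

Definition locally_finite : Prop := forall v, finite_set (children v).

(** A vertex other than the root is a leaf (has degree 1) iff it has no
    child. *)
Definition no_leaves_except_root : Prop :=
  forall v, v != tree_root T -> children v !=set0.

(** The vertex sequences of the infinite paths from the root directed away from
    it. *)
Definition tree_boundary : set (nat -> V) :=
  [set y | y 0%N = tree_root T /\ forall n, children (y n) (y n.+1)].

End Trees.

Section Capacity.
Variables (R : realType) (V : choiceType) (T : rooted_tree V).

Definition is_flow (mu : V -> R) : Prop :=
  (forall w, w != tree_root T -> 0 <= mu w) /\
  (forall w, w != tree_root T -> children T w !=set0 ->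
     mu w = \sum_(y \in children T w) mu y).

Definition flow_strength (mu : V -> R) : R :=
  \sum_(y \in children T (tree_root T)) mu y.

Definition path_potential (p : R) (res mu : V -> R) (y : nat -> V) : \bar R :=
  (\sum_(0 <= n <oo) ((mu (y n.+1) * res (y n.+1)) `^ (p - 1))%:E)%E.

Definition potential (p : R) (res mu : V -> R) : \bar R :=
  ereal_sup [set path_potential p res mu y | y in tree_boundary T].

Definition unit_flow_strengths (p : R) (res : V -> R) : set (\bar R) :=
  [set (flow_strength mu)%:E | mu in
     [set mu | is_flow mu /\ potential p res mu = 1%E]].

Definition capacity (p : R) (res : V -> R) : \bar R :=
  if unit_flow_strengths p res == set0 then 0%E
  else ereal_sup (unit_flow_strengths p res).

End Capacity.

Definition tanh (R : realType) (x : R) : R :=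
  (expR x - expR (- x)) / (expR x + expR (- x)).

(** The spin space [{+1, -1}] is encoded by [bool]. *)
Definition spin (R : realType) (b : bool) : R := if b then 1 else -1.

(** The events [eta v = +1], [v \in D]: they generate the sigma-algebra of the
    spins in [D]. *)
Definition spin_events (V : choiceType) (D : set V) : set (set (V -> bool)) :=
  [set [set eta : V -> bool | eta v] | v in D].

(** Configurations, with the product sigma-algebra. *)
Notation config V := (g_sigma_algebraType (@spin_events V setT)).

Section Probability.
Variables (R : realType) (d : measure_display) (X : measurableType d).

(** [f] is a version of the conditional probability of the event [E] given the
    sigma-algebra generated by [G] (assumed to consist of measurable sets). *)
Definition is_cond_prob (P : probability X R) (G : set (set X)) (E : set X)
    (f : X -> R) : Prop :=
  [/\ measurable_fun setT (f : g_sigma_algebraType G -> R),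
      P.-integrable setT (EFin \o f) &
      forall A, <<s G >> A -> P (E `&` A) = (\int[P]_(x in A) (f x)%:E)%E].

(** Probabilities are compared on measurable sets only, since the values of the
    underlying set functions elsewhere are junk. *)
Definition extreme_point (C : set (probability X R)) (P : probability X R) :
    Prop :=
  C P /\
  forall (P1 P2 : probability X R) (t : R), C P1 -> C P2 -> 0 < t < 1 ->
    (forall A, measurable A -> P A = (t%:E * P1 A + (1 - t)%:E * P2 A)%E) ->
    forall A, measurable A -> P1 A = P A /\ P2 A = P A.

End Probability.

Section Gibbs.
Variables (R : realType) (V : choiceType) (T : rooted_tree V).
Variables (beta : R) (J : V -> R).

Definition edges_meeting (L : {fset V}) : set V :=
  [set w | w != tree_root T /\ (w \in L \/ parent T w \in L)].

Definition gibbs_weight (L : {fset V}) (eta : V -> bool) : R :=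
  expR (beta * \sum_(w \in edges_meeting L)
                 J w * spin R (eta (parent T w)) * spin R (eta w)).

(** The configuration equal to [sigma] on [L] and to [eta] off [L]. *)
Definition splice (L : {fset V}) (sigma : {ffun L -> bool}) (eta : V -> bool) :
    V -> bool :=
  fun v => if insub v is Some u then sigma u else eta v.

Definition gibbs_kernel (L : {fset V}) (sigma : {ffun L -> bool})
    (eta : V -> bool) : R :=
  gibbs_weight L (splice sigma eta) /
  \sum_(tau : {ffun L -> bool}) gibbs_weight L (splice tau eta).

Definition is_gibbs (mu : probability (config V) R) : Prop :=
  forall (L : {fset V}) (sigma : {ffun L -> bool}),
    is_cond_prob mu (spin_events (~` [set` L]))
      [set eta : V -> bool | forall u : L, eta (val u) = sigma u]
      (gibbs_kernel sigma).

Definition extremal_gibbs (mu : probability (config V) R) : Prop :=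
  extreme_point [set nu | is_gibbs nu] mu.

(** The independent choices made by the tree-indexed Markov chain: the root
    takes the value [+1]; a vertex [v] other than the root copies the spin of
    its parent. *)
Definition chain_event (v : V) : set (V -> bool) :=
  [set eta | if v == tree_root T then eta v else eta v == eta (parent T v)].

Definition chain_prob (v : V) : R :=
  if v == tree_root T then 2^-1 else (1 + tanh (beta * J v)) / 2.

(** [mu] is the law of that chain: under [mu] these events are mutually
    independent (product rule over every finite subfamily), with the prescribed
    probabilities. Since they determine the configuration, this characterizes
    [mu]. *)
Definition is_free_boundary_gibbs (mu : probability (config V) R) : Prop :=
  forall S : {fset V},
    mu (\bigcap_(v in [set` S]) chain_event v) =
    (\prod_(v <- S) chain_prob v)%:E.

Definition resistance (w : V) : R :=
  \big[*%R/1]_(y \in [set y | tree_lt T (tree_root T) y /\ tree_le T y w])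
    (tanh (beta * J y)) ^- 2.

End Gibbs.

(* Main.v *)
(** Let [M_v] be the conditional mean of the spin at [v] given the spins in a far
    generation below [v], and [m_v] its second moment. Combining two independent
    branches with means [x] and [b] gives [(x + b) / (1 + x b)], under the density
    [1 + x b], whence [1 - m_v >= \prod_w (1 - theta_w^2 m_w)] over the children
    [w] of [v]. In terms of [2 m / (2 - m)] this says that [m_v] is bounded by an
    effective conductance, whose limit, if positive, yields a flow of bounded
    potential. So if the capacity vanishes then every [m_v] tends to [0], and a
    Gibbs measure dominated by a multiple of the free one must have the same
    Markov property, hence be equal to it.

    Conversely, weighting the spins of a generation by a flow of bounded potential
    gives variables that are bounded in L^2 and correlated with the spin at the
    root. Their truncations, centered and used as densities, tilt the free
    measure in two opposite directions; along an ultrafilter the tilted measures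
    converge to two distinct Gibbs measures (sigma-additivity being inherited from
    the domination by twice the free measure) whose midpoint is the free
    measure. *)

From HB Require Import structures.
Require Import Defs.
From mathcomp Require Import all_boot all_order all_algebra finmap.
From mathcomp Require Import all_classical all_reals all_analysis.
From mathcomp Require Import measurable_realfun.
From mathcomp Require Import ring lra zify.

Set Implicit Arguments.
Unset Strict Implicit.
Unset Printing Implicit Defensive.

Import Order.TTheory GRing.Theory Num.Theory.
Import numFieldNormedType.Exports.

Local Open Scope classical_set_scope.
Local Open Scope ring_scope.

(** * Cylinder functions *)

(** Why 2m / (2 - m): a bound additive in m itself would give no resistance to the edges, since
    crossing an edge just multiplies 1 / m by theta^-2. Subtracting a constant alpha from 1 / m adds
    alpha (theta^-2 - 1) at each edge, while subadditivity over the branches survives for small m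
    only if alpha is at most 1/2; and 1 / m - 1/2 is the reciprocal of 2m / (2 - m). The gain is
    uniform relative to theta^-2 because theta stays away from 1, which is where the upper bound on
    the interactions enters. A Gibbs measure other than the free one has no recursive description,
    only its finite-volume kernels. These are the same functions for all Gibbs measures, so an L^1
    estimate on them under the free measure passes to every Gibbs measure dominated by a multiple of
    it. Once the Gibbs property is expressed by cylinder functions, the law of a far generation can
    be a finite weighted list of configurations, and Bayes' rule an identity between finite sums. *)

Section Expectation.
Context d (X : measurableType d) (R : realType).
Implicit Types (P : probability X R) (F G : X -> R) (A : set X).

(** Only bounded functions are integrated against densities and test functions, so the real-valued
    [Ex] behaves linearly with this as its only side condition. *)
Definition bmfun F := measurable_fun setT F /\ exists C, forall x, `|F x| <= C.

Definition Ex P F : R := \int[P]_x F x.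

Lemma bmfun_integrable P F : bmfun F -> P.-integrable setT (EFin \o F).
Proof.
move=> [mF [C bF]]; apply: measurable_bounded_integrable => //.
  by rewrite -ge0_fin_numE// fin_num_measure.
by exists C; split; [exact: num_real|move=> M CM x _; exact: le_trans (bF x) (ltW CM)].
Qed.

Lemma bmfun_cst (c : R) : bmfun (fun=> c).
Proof. by split; [exact: measurable_cst|exists `|c|]. Qed.

Lemma bmfunD F G : bmfun F -> bmfun G -> bmfun (fun x => F x + G x).
Proof.
move=> [mF [C bF]] [mG [D bG]]; split; first exact: measurable_funD.
by exists (C + D) => x; apply: le_trans (ler_normD _ _) (lerD _ _).
Qed.

Lemma bmfunM F G : bmfun F -> bmfun G -> bmfun (fun x => F x * G x).
Proof.
move=> [mF [C bF]] [mG [D bG]]; split; first exact: measurable_funM.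
by exists (C * D) => x; rewrite normrM ler_pM.
Qed.

Lemma bmfun_indic A : measurable A -> bmfun \1_A.
Proof.
move=> mA; split; first exact: measurable_indic.
by exists 1 => x; rewrite indicE; case: (_ \in _); rewrite ?normr1 ?normr0.
Qed.

Lemma ExD P F G : bmfun F -> bmfun G ->
  Ex P (fun x => F x + G x) = Ex P F + Ex P G.
Proof. by move=> bF bG; apply: RintegralD => //; exact: bmfun_integrable. Qed.

Lemma ExZ P c F : bmfun F -> Ex P (fun x => c * F x) = c * Ex P F.
Proof. by move=> bF; apply: RintegralZl => //; exact: bmfun_integrable. Qed.

Lemma ExB P F G : bmfun F -> bmfun G ->
  Ex P (fun x => F x - G x) = Ex P F - Ex P G.
Proof. by move=> bF bG; apply: RintegralB => //; exact: bmfun_integrable. Qed.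

Lemma Ex_cst P c : Ex P (fun=> c) = c.
Proof.
rewrite /Ex Rintegral_cst// -[RHS]mulr1; congr (_ * _).
exact: (congr1 fine (probability_setT P)).
Qed.

Lemma le_Ex P F G : bmfun F -> bmfun G -> (forall x, F x <= G x) ->
  Ex P F <= Ex P G.
Proof. by move=> bF bG FG; apply: le_Rintegral => //; exact: bmfun_integrable. Qed.

Lemma Ex_ge0 P F : (forall x, 0 <= F x) -> 0 <= Ex P F.
Proof. by move=> F0; apply: Rintegral_ge0. Qed.

Lemma bmfun_norm F : bmfun F -> bmfun (fun x => `|F x|).
Proof.
move=> [mF [C bF]]; split; first exact: measurableT_comp.
by exists C => x; rewrite normr_id.
Qed.

Lemma norm_Ex P F : bmfun F -> `|Ex P F| <= Ex P (fun x => `|F x|).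
Proof. by move=> bF; apply: le_normr_Rintegral => //; exact: bmfun_integrable. Qed.

Lemma eq_Ex P F G : F =1 G -> Ex P F = Ex P G.
Proof. by move=> FG; congr Ex; exact/funext. Qed.

Lemma bmfun_sum I (r : seq I) (F : I -> X -> R) :
  (forall i, bmfun (F i)) -> bmfun (fun x => \sum_(i <- r) F i x).
Proof.
move=> bF; elim: r => [|i r IH].
  by under [X in bmfun X]eq_fun do rewrite big_nil; exact: bmfun_cst.
by under [X in bmfun X]eq_fun do rewrite big_cons; exact: bmfunD.
Qed.

Lemma Ex_sum P I (r : seq I) (F : I -> X -> R) : (forall i, bmfun (F i)) ->
  Ex P (fun x => \sum_(i <- r) F i x) = \sum_(i <- r) Ex P (F i).
Proof.
move=> bF; elim: r => [|i r IH].
  by rewrite big_nil; under eq_Ex do rewrite big_nil; rewrite Ex_cst.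
rewrite big_cons -IH; under eq_Ex do rewrite big_cons.
by rewrite ExD//; exact: bmfun_sum.
Qed.

Lemma Ex_indic P A : measurable A -> Ex P \1_A = fine (P A).
Proof. by move=> mA; rewrite /Ex /Rintegral integral_indic// setIT. Qed.

Lemma Ex_indicE P A F : measurable A -> bmfun F ->
  (\int[P]_(x in A) (F x)%:E)%E = (Ex P (fun x => \1_A x * F x))%:E.
Proof.
move=> mA bF; rewrite /Ex /Rintegral fineK; last first.
  apply: integrable_fin_num => //.
  exact: (bmfun_integrable P (bmfunM (bmfun_indic mA) bF)).
rewrite [LHS]integral_mkcond; apply: eq_integral => x _.
by rewrite patchE indicE; case: (_ \in _); rewrite ?mul1r ?mul0r.
Qed.

End Expectation.

Section Cylinder.
Variables (R : realType) (V : choiceType).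
Implicit Types (D : set V) (F G : (V -> bool) -> R) (eta : V -> bool).

(** With [Y := Prop] this also speaks of events. *)
Definition dep_on (Y : Type) D (F : (V -> bool) -> Y) :=
  forall eta eta', (forall v, D v -> eta v = eta' v) -> F eta = F eta'.

Definition cylfun F := exists D : {fset V}, dep_on [set` D] F.

Definition upd eta (u : V) (b : bool) : V -> bool :=
  fun v => if v == u then b else eta v.

Definition glue D eta eta' : V -> bool :=
  fun v => if `[< D v >] then eta v else eta' v.

Lemma glue_in D eta eta' v : D v -> glue D eta eta' v = eta v.
Proof. by move=> Dv; rewrite /glue asboolT. Qed.

Lemma glue_out D eta eta' v : ~ D v -> glue D eta eta' v = eta' v.
Proof. by move=> Dv; rewrite /glue asboolF. Qed.

Section Dep.
Variable Y : Type.
Implicit Types H : (V -> bool) -> Y.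

Lemma dep_onS D D' H : D `<=` D' -> dep_on D H -> dep_on D' H.
Proof. by move=> DD' dH x y xy; apply: dH => v /DD'; exact: xy. Qed.

(** Two configurations that agree on the intersection are joined through a third one, which agrees
    with the first on [D] and with the second on [D']. *)
Lemma dep_onI D D' H : dep_on D H -> dep_on D' H -> dep_on (D `&` D') H.
Proof.
move=> dH dH' x y xy; have -> : H x = H (glue D x y).
  by apply: dH => v Dv; rewrite glue_in.
apply: dH' => v D'v; have [Dv|nDv] := pselect (D v).
  by rewrite glue_in// xy.
by rewrite glue_out.
Qed.

Lemma dep_on_cst D (c : Y) : dep_on D (fun=> c). Proof. by []. Qed.

Lemma dep_on_comp (Z : Type) (f : Y -> Z) D H :
  dep_on D H -> dep_on D (fun x => f (H x)).
Proof. by move=> dH x y xy; rewrite (dH x y). Qed.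

Lemma dep_on_comp2 (Z W : Type) (f : Y -> Z -> W) D H (K : (V -> bool) -> Z) :
  dep_on D H -> dep_on D K -> dep_on D (fun x => f (H x) (K x)).
Proof. by move=> dH dK x y xy; rewrite (dH x y)// (dK x y). Qed.
End Dep.

Lemma dep_on_spin D v : D v -> dep_on D (fun eta => spin R (eta v)).
Proof. by move=> Dv x y /(_ v Dv) ->. Qed.

Lemma cylfun_spin v : cylfun (fun eta => spin R (eta v)).
Proof. by exists [fset v]%fset => x y xy; rewrite xy//= inE. Qed.

Lemma cylfun_cst (c : R) : cylfun (fun=> c).
Proof. by exists fset0. Qed.

Lemma cylfun_comp2 (f : R -> R -> R) F G :
  cylfun F -> cylfun G -> cylfun (fun x => f (F x) (G x)).
Proof.
move=> [D dF] [D' dG]; exists (D `|` D')%fset.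
by apply: dep_on_comp2; [apply: dep_onS dF|apply: dep_onS dG] => v /= vD;
  rewrite inE vD ?orbT.
Qed.

Lemma cylfunD F G : cylfun F -> cylfun G -> cylfun (fun x => F x + G x).
Proof. exact: cylfun_comp2. Qed.

Lemma cylfunB F G : cylfun F -> cylfun G -> cylfun (fun x => F x - G x).
Proof. exact: (cylfun_comp2 (fun a b => a - b)). Qed.

Lemma cylfunM F G : cylfun F -> cylfun G -> cylfun (fun x => F x * G x).
Proof. exact: cylfun_comp2. Qed.

Lemma cylfun_comp (f : R -> R) F : cylfun F -> cylfun (fun x => f (F x)).
Proof. by move=> [D dF]; exists D; exact: dep_on_comp. Qed.

Lemma cylfun_sum I (r : seq I) (F : I -> (V -> bool) -> R) :
  (forall i, cylfun (F i)) -> cylfun (fun x => \sum_(i <- r) F i x).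
Proof.
move=> bF; elim: r => [|i r IH].
  by under [X in cylfun X]eq_fun do rewrite big_nil; exact: cylfun_cst.
by under [X in cylfun X]eq_fun do rewrite big_cons; exact: cylfunD.
Qed.

Definition cylset (D : {fset V}) (tau : {ffun D -> bool}) : set (V -> bool) :=
  [set eta | forall u : D, eta (val u) = tau u].

Lemma splice_in (D : {fset V}) (tau : {ffun D -> bool}) eta (u : D) :
  splice tau eta (val u) = tau u.
Proof. by rewrite /splice valK. Qed.

Lemma splice_out (D : {fset V}) (tau : {ffun D -> bool}) eta v :
  v \notin D -> splice tau eta v = eta v.
Proof. by move=> vD; rewrite /splice insubN. Qed.

Definition restr (D : {fset V}) eta : {ffun D -> bool} := [ffun u => eta (val u)].

Lemma cylsetE (D : {fset V}) (tau : {ffun D -> bool}) eta :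
  (eta \in cylset tau) = (restr D eta == tau).
Proof.
apply/idP/eqP => [/set_mem h|<-]; first by apply/ffunP => u; rewrite ffunE h.
by apply/mem_set => u; rewrite ffunE.
Qed.

Lemma splice_restr (D : {fset V}) eta eta' v :
  v \in D -> splice (restr D eta) eta' v = eta v.
Proof. by move=> vD; rewrite (splice_in _ _ [` vD]%fset) ffunE. Qed.

Lemma cyl_decomp (D : {fset V}) F eta0 : dep_on [set` D] F ->
  forall eta, F eta =
    \sum_(tau : {ffun D -> bool}) F (splice tau eta0) * \1_(cylset tau) eta.
Proof.
move=> dF eta; rewrite (bigD1 (restr D eta))//= [X in _ + X]big1 ?addr0.
  rewrite indicE cylsetE eqxx mulr1; apply: dF => v /= vD.
  by rewrite splice_restr.
move=> tau tD; rewrite indicE cylsetE eq_sym (negbTE tD) mulr0//.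
Qed.

Lemma cylsetI (D : {fset V}) (tau : {ffun D -> bool}) :
  cylset tau = \bigcap_(v in [set` D])
    [set eta | eta v = splice tau (fun=> true) v].
Proof.
apply/seteqP; split => [x xt v /= vD|x h u].
  by rewrite (splice_in _ _ [` vD]%fset) -xt.
by rewrite (h (val u) (valP u)) splice_in.
Qed.

Lemma measurable_cylset D (D' : {fset V}) (tau : {ffun D' -> bool}) :
  [set` D'] `<=` D -> <<s spin_events D >> (cylset tau).
Proof.
move=> D'D; rewrite cylsetI.
apply: (@fin_bigcap_measurable _ (g_sigma_algebraType (spin_events D))) => //.
move=> v /D'D Dv; have mv : <<s spin_events D >> [set eta : V -> bool | eta v].
  by apply: sub_gen_smallest; exists v.
case: (splice _ _ _); first exact: mv.
have -> : [set eta : V -> bool | eta v = false] = ~` [set eta | eta v].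
  by apply/seteqP; split => x /=; [move->|move/negP/negbTE].
exact: (@measurableC _ (g_sigma_algebraType (spin_events D))).
Qed.

(** The finite support need not lie in [D]; by [dep_onI] it can be cut down to its part inside [D],
    whose cylinder events are measurable for the spins in [D]. *)
Lemma cylfun_bm D F : cylfun F -> dep_on D F ->
  @bmfun _ (g_sigma_algebraType (spin_events D)) R F.
Proof.
move=> [D' dF] dD.
pose E : {fset V} := [fset v in D' | `[< D v >]]%fset.
have dE : dep_on [set` E] F.
  apply: dep_onS (dep_onI dF dD) => v [/= vD' Dv].
  by rewrite !inE vD'; exact/asboolP.
rewrite (funext (cyl_decomp (fun=> true) dE)).
apply: (@bmfun_sum _ (g_sigma_algebraType (spin_events D))) => tau.
apply: (@bmfunM _ (g_sigma_algebraType (spin_events D))).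
  exact: bmfun_cst.
apply: (@bmfun_indic _ (g_sigma_algebraType (spin_events D))).
by apply: measurable_cylset => v /=; rewrite !inE => /andP[_ /asboolP].
Qed.

Lemma cylfun_bmT F : cylfun F -> @bmfun _ (config V) R F.
Proof. by move=> cF; apply: cylfun_bm => //; case: cF => D dF; exact: dep_onS dF. Qed.

Lemma dep_on_indic D (A : set (V -> bool)) : dep_on D A ->
  dep_on D (\1_A : (V -> bool) -> R).
Proof.
by move=> dA x y xy; rewrite !indicE; congr ((_ : bool)%:R); apply/idP/idP;
  rewrite !inE /= (dA x y xy).
Qed.

End Cylinder.

(** * Rooted trees *)

Section TreeOrder.
Variables (V : choiceType) (T : rooted_tree V).
Local Notation o := (tree_root T).
Local Notation p := (parent T).
Implicit Types (u v w : V) (s : seq V).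

Lemma reach_root_bool v : exists n, iter n p v == o.
Proof. by have [n /eqP] := reach_tree_root T v; exists n. Qed.

Definition depth v : nat := ex_minn (reach_root_bool v).

Lemma iter_parent_root n : iter n p o = o.
Proof. by elim: n => //= n ->; exact: parent_tree_root. Qed.

Lemma iter_depth v : iter (depth v) p v = o.
Proof. by rewrite /depth; case: ex_minnP => n /eqP. Qed.

Lemma depth_le v n : iter n p v = o -> (depth v <= n)%N.
Proof. by rewrite /depth; case: ex_minnP => m _ h /eqP/h. Qed.

Lemma depth_root : depth o = 0%N.
Proof. by apply/eqP; rewrite -leqn0; exact: depth_le. Qed.

Lemma depth_parent v : v != o -> depth v = (depth (p v)).+1.
Proof.
move=> vo; apply/eqP; rewrite eqn_leq; apply/andP; split.
  by apply: depth_le; rewrite iterSr iter_depth.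
have := iter_depth v; case: (depth v) => [/= /eqP|n]; first by rewrite (negbTE vo).
by rewrite iterSr => /depth_le.
Qed.

Lemma depth_iter n v : (depth (iter n p v) <= depth v)%N.
Proof.
elim: n => //= n; apply: leq_trans.
have [->|h] := eqVneq (iter n p v) o; first by rewrite parent_tree_root.
by rewrite (depth_parent h).
Qed.

Lemma depth_child v w : children T v w -> depth w = (depth v).+1.
Proof. by move=> [wo <-]; exact: depth_parent. Qed.

Lemma tree_le_refl v : tree_le T v v. Proof. by exists 0%N. Qed.

Lemma tree_le_trans u v w : tree_le T u v -> tree_le T v w -> tree_le T u w.
Proof. by move=> [n <-] [m <-]; exists (n + m)%N; rewrite iterD. Qed.

Lemma tree_le_parent v : tree_le T (p v) v. Proof. by exists 1%N. Qed.

Lemma tree_le_root v : tree_le T o v. Proof. exact: reach_tree_root. Qed.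

Lemma tree_le_depth u v : tree_le T u v -> (depth u <= depth v)%N.
Proof. by move=> [n <-]; exact: depth_iter. Qed.

Lemma tree_leP u v : tree_le T u v -> u = v \/ (v != o /\ tree_le T u (p v)).
Proof.
move=> [[|n] <-]; first by left.
have [->|vo] := eqVneq v o; first by left; rewrite iter_parent_root.
by right; split => //; exists n; rewrite -iterSr.
Qed.

Lemma tree_le_depth_eq u v : tree_le T u v -> depth u = depth v -> u = v.
Proof.
move=> /tree_leP[//|[vo /tree_le_depth]]; rewrite (depth_parent vo); lia.
Qed.

Lemma tree_le_comparable u u' v : tree_le T u v -> tree_le T u' v ->
  tree_le T u u' \/ tree_le T u' u.
Proof.
move=> [n <-] [m <-]; have [nm|/ltnW mn] := leqP n m.
  by right; exists (m - n)%N; rewrite -iterD subnK.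
by left; exists (n - m)%N; rewrite -iterD subnK.
Qed.

Definition subtree v : set V := [set u | tree_le T v u].
Definition strict_subtree v : set V := [set u | tree_lt T v u].

Lemma subtree_refl v : subtree v v. Proof. exact: tree_le_refl. Qed.

Lemma strict_subtree_sub v : strict_subtree v `<=` subtree v.
Proof. by move=> u []. Qed.

Lemma child_strict_subtree v w : children T v w -> subtree w `<=` strict_subtree v.
Proof.
move=> cw u wu; have := depth_child cw; case: cw => wo <- dw; split.
  exact: tree_le_trans (tree_le_parent w) wu.
by move=> eu; move: wu; rewrite -eu /subtree/= => /tree_le_depth; lia.
Qed.

Lemma child_subtree v w : children T v w -> subtree w `<=` subtree v.
Proof. by move=> /child_strict_subtree h u /h/strict_subtree_sub. Qed.

Lemma subtree_siblings v w w' u : children T v w -> children T v w' ->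
  subtree w u -> subtree w' u -> w = w'.
Proof.
move=> cw cw' wu w'u; have dw := depth_child cw; have dw' := depth_child cw'.
have [h|h] := tree_le_comparable wu w'u.
  by apply: tree_le_depth_eq; rewrite // dw.
by apply/esym/tree_le_depth_eq; rewrite // dw.
Qed.

Lemma subtree_child v u : subtree v u -> u != v ->
  exists w, children T v w /\ subtree w u.
Proof.
move=> [n]; elim: n u => [u /= ->|n IH u]; first by rewrite eqxx.
rewrite iterSr => vu uv; have [e|puv] := eqVneq (p u) v.
  exists u; split; last exact: tree_le_refl.
  split=> //; apply/eqP => uo; move: uv; rewrite -e uo parent_tree_root eqxx//.
have [w [cw wu]] := IH _ vu puv; exists w; split => //.
exact: tree_le_trans wu (tree_le_parent u).
Qed.

Lemma not_subtree_parent w u : ~ subtree w u -> ~ subtree w (p u).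
Proof. by move=> h h'; apply: h; exact: tree_le_trans h' (tree_le_parent u). Qed.

Lemma parent_not_subtree w : w != o -> ~ subtree w (p w).
Proof. by move=> wo /tree_le_depth; rewrite (depth_parent wo); lia. Qed.

(* The newest vertex comes first: every vertex stands to the left of its
   parent, and the list is closed under taking parents. *)
Fixpoint tlist s : bool :=
  if s is u :: s' then [&& u \notin s', (u == o) || (p u \in s') & tlist s']
  else true.

Lemma tlist_parent s v : tlist s -> v \in s -> v != o -> p v \in s.
Proof.
elim: s => //= u s IH /and3P[us pu ts]; rewrite !inE => /orP[/eqP ->|vs] vo.
  by move: pu; rewrite (negbTE vo)/= => ->; rewrite orbT.
by rewrite IH// orbT.
Qed.

Lemma tlist_le s u v : tlist s -> v \in s -> tree_le T u v -> u \in s.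
Proof.
move=> ts vs [n <-]; elim: n => //= n; set x := iter n p v => xs.
have [xo|xo] := eqVneq x o; last exact: tlist_parent.
by rewrite xo parent_tree_root -xo.
Qed.

Lemma tlist_root_parent s v : tlist s -> v \in s -> p v \in s.
Proof. by move=> ts vs; exact: tlist_le ts vs (tree_le_parent v). Qed.

Lemma tlist_off s u : tlist (u :: s) -> [set` s] `<=` ~` subtree u.
Proof. by move=> /= /and3P[us _ ts] v /= vs /(tlist_le ts vs); exact/negP. Qed.

Section Cover.
Variable A : set V.
Hypothesis A_parent : forall u, A u -> A (p u).

(** Missing ancestors are listed first, by induction on the depth; closure under parents keeps them
    in [A]. For [A] the complement of a subtree, the root of that subtree can then be put in front
    of the list. *)
Lemma tlist_ext s v : tlist s -> [set` s] `<=` A -> A v ->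
  exists s', [/\ tlist s', [set` s'] `<=` A, v \in s' & {subset s <= s'}].
Proof.
elim: (depth v) {-2}v (erefl (depth v)) s => {v} [|n IH] v dv s ts sA Av.
  have vo : v = o by have := iter_depth v; rewrite dv.
  have [vs|vs] := boolP (v \in s); first by exists s; split.
  exists (v :: s); split => [||| u us]; rewrite /= ?inE ?eqxx ?us ?orbT//.
    by rewrite vs vo eqxx.
  by move=> u /=; rewrite inE => /orP[/eqP ->|/sA].
have [vs|vs] := boolP (v \in s); first by exists s; split.
have vo : v != o by apply/eqP => vo; move: dv; rewrite vo depth_root.
have dpv : depth (p v) = n by move: dv; rewrite depth_parent// => -[].
have [s' [ts' s'A pvs' ss']] := IH _ dpv _ ts sA (A_parent Av).
have [vs'|vs'] := boolP (v \in s'); first by exists s'; split => // u /ss'.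
exists (v :: s'); split => /=; rewrite ?inE ?eqxx//.
- by rewrite vs' pvs' orbT.
- by move=> u /=; rewrite inE => /orP[/eqP ->|/s'A].
- by move=> u /ss' us; rewrite inE us orbT.
Qed.

Lemma tlist_cover (D : seq V) : [set` D] `<=` A ->
  exists s, [/\ tlist s, [set` s] `<=` A & {subset D <= s}].
Proof.
elim: D => [|v D IH] DA; first by exists [::].
have [|s [ts sA Ds]] := IH; first by move=> u /= uD; apply: DA; rewrite /= inE uD orbT.
have [|s' [ts' s'A vs' ss']] := tlist_ext ts sA (v := v).
  by apply: DA; rewrite /= inE eqxx.
exists s'; split => // u; rewrite inE => /orP[/eqP ->//|/Ds/ss'//].
Qed.

End Cover.

Lemma tlist_coverT (D : seq V) : exists s, tlist s /\ {subset D <= s}.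
Proof.
by have [//|//|s [ts _ Ds]] := @tlist_cover setT _ D; exists s.
Qed.

Definition level_set (k : nat) v : set V :=
  [set u | subtree v u /\ depth u = (depth v + k)%N].

Lemma level_set_child k v w : children T v w ->
  level_set k w `<=` level_set k.+1 v.
Proof.
move=> cw u [wu du]; split; first exact: child_subtree wu.
by rewrite du (depth_child cw); lia.
Qed.

Lemma level_set_inv k v u : level_set k.+1 v u ->
  exists w, children T v w /\ level_set k w u.
Proof.
move=> [vu du]; have [|w [cw wu]] := subtree_child vu.
  by apply/eqP => uv; move: du; rewrite uv; lia.
by exists w; split => //; split => //; rewrite du (depth_child cw); lia.
Qed.

Lemma level_set_subtree k v : level_set k v `<=` subtree v.
Proof. by move=> u []. Qed.

Lemma level_set0 v : level_set 0 v = [set v].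
Proof.
apply/seteqP; split => [u [vu du]|u ->].
  by apply/esym/tree_le_depth_eq => //; rewrite du addn0.
by split; [exact: tree_le_refl|rewrite addn0].
Qed.

Hypothesis lf : locally_finite T.

Definition chl v : seq V := fset_set (children T v).

Lemma mem_chl v w : (w \in chl v) = (w \in children T v).
Proof. by rewrite /chl in_fset_set//; exact: lf. Qed.

Lemma chlP v w : reflect (children T v w) (w \in chl v).
Proof. by rewrite mem_chl; apply: (iffP idP) => [/set_mem|/mem_set]. Qed.

Lemma chl_uniq v : uniq (chl v). Proof. exact: fset_uniq. Qed.

Fixpoint ball (k : nat) v : seq V :=
  if k is k'.+1 then v :: flatten [seq ball k' w | w <- chl v] else [::].

Lemma ballP k v u :
  reflect (subtree v u /\ (depth u < depth v + k)%N) (u \in ball k v).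
Proof.
elim: k v => [|k IH] v /=.
  by apply: (iffP idP) => // -[/tree_le_depth]; rewrite addn0; lia.
rewrite inE; apply: (iffP orP) => [[/eqP ->|/flattenP[_ /mapP[w /chlP cw ->]
  /IH[wu du]]]|].
- by split; [exact: tree_le_refl|lia].
- split; first exact: child_subtree wu.
  by move: du; rewrite (depth_child cw); lia.
- move=> [vu du]; have [->|uv] := eqVneq u v; first by left.
  right; apply/flattenP.
  have [w [cw wu]] := subtree_child vu uv.
  exists (ball k w); first by apply/mapP; exists w => //; exact/chlP.
  by apply/IH; split => //; rewrite (depth_child cw); lia.
Qed.

End TreeOrder.

(** * Tree-indexed Markov chains *)

Section Chain.
Variables (R : realType) (V : choiceType) (T : rooted_tree V).
Local Notation o := (tree_root T).
Local Notation p := (parent T).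
Local Notation sp eta v := (spin R (eta v)).
Implicit Types (u v w : V) (s : seq V) (eta : V -> bool).
Implicit Types (F G : (V -> bool) -> R).

Lemma spin_sqr (b : bool) : spin R b * spin R b = 1.
Proof. by case: b; rewrite /spin ?mulr1// mulrNN mulr1. Qed.

Lemma spin_norm (b : bool) : `|spin R b| = 1.
Proof. by case: b; rewrite /spin ?normrN normr1. Qed.

Lemma upd_dep D F u b : dep_on D F -> dep_on (D `\ u) (fun eta => F (upd eta u b)).
Proof.
move=> dF x y xy; apply: dF => v Dv; rewrite /upd.
by case: eqVneq => // /eqP vu; exact: xy.
Qed.

Lemma upd_notin D (Y : Type) (F : (V -> bool) -> Y) u b eta :
  dep_on D F -> ~ D u -> F (upd eta u b) = F eta.
Proof.
by move=> dF Du; apply: dF => v Dv; rewrite /upd; case: eqVneq => // vu;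
  rewrite vu in Dv.
Qed.

Lemma upd_id eta u : upd eta u (eta u) = eta.
Proof. by apply/funext => v; rewrite /upd; case: eqVneq => // ->. Qed.

Lemma fset_cylfun s F : dep_on [set` s] F -> cylfun F.
Proof.
by move=> dF; exists [fset v in s]%fset; apply: dep_onS dF => v; rewrite /= inE.
Qed.

(** The result is still a function of the configuration, which supplies the spins off [s]; this
    avoids choosing default values. By [config_sum_dep] it is constant when [F] depends only on
    [s]. *)
Fixpoint config_sum s F : (V -> bool) -> R :=
  if s is u :: s' then
    config_sum s' (fun eta => F (upd eta u true) + F (upd eta u false))
  else F.

Lemma dep_on_seq_cons u s F (b : bool) : dep_on [set` u :: s] F ->
  dep_on [set` s] (fun eta => F (upd eta u b)).
Proof.
move=> /upd_dep dF; apply: dep_onS (dF u b) => v [/=].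
by rewrite inE => /orP[/eqP ->|].
Qed.

Definition xorc (U eta : V -> bool) : V -> bool := fun v => eta v (+) U v.

(** At each vertex of [s], flipping by [U] either keeps or exchanges the two summands. *)
Lemma config_sum_xor s F U :
  config_sum s (fun eta => F (xorc U eta)) =1 fun eta => config_sum s F (xorc U eta).
Proof.
elim: s F => [|u s IH] F eta //=.
rewrite -(IH (fun eta => F (upd eta u true) + F (upd eta u false))).
congr (config_sum s _ eta); apply/funext => x.
have h b : xorc U (upd x u b) = upd (xorc U x) u (b (+) U u).
  by apply/funext => v; rewrite /xorc /upd; case: eqVneq => // ->.
by rewrite !h; case: (U u); rewrite //= addrC.
Qed.

Lemma config_sum_dep s F : dep_on [set` s] F ->
  forall eta eta', config_sum s F eta = config_sum s F eta'.
Proof.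
elim: s F => [|u s IH] F dF eta eta' /=; first exact: dF.
by apply: IH; apply: dep_on_comp2; exact: dep_on_seq_cons.
Qed.

Variable th : V -> R.
Hypothesis th_root : th o = 0.

Definition step_prob v eta : R := (1 + th v * sp eta v * sp eta (p v)) / 2.

(** The expectation of [F] when the spin at [u] is redrawn according to the spin of its parent;
    since [th] vanishes at the root, the root is redrawn as a fair coin. *)
Definition resample u F : (V -> bool) -> R := fun eta =>
  \sum_(b : bool) (1 + th u * spin R b * sp eta (p u)) / 2 * F (upd eta u b).

Lemma resampleE u F eta : resample u F eta =
  (F (upd eta u true) + F (upd eta u false)) / 2 +
  th u * (sp eta (p u) * ((F (upd eta u true) - F (upd eta u false)) / 2)).
Proof.
rewrite /resample big_bool /=; set x := spin R (eta _).
rewrite /spin; by field.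
Qed.

Lemma root_or_in s u : tlist T (u :: s) -> u = o \/ p u \in s.
Proof. by move=> /= /and3P[_ /orP[/eqP|] ?]; [left|right]. Qed.

Lemma resample_dep u s F : tlist T (u :: s) -> dep_on [set` u :: s] F ->
  dep_on [set` s] (resample u F).
Proof.
move=> ts dF x y xy; rewrite !resampleE.
rewrite (dep_on_seq_cons (true) dF xy) (dep_on_seq_cons (false) dF xy).
by have [->|pu] := root_or_in ts; [rewrite th_root !mul0r|rewrite (xy _ pu)].
Qed.

Definition weight s eta : R := \prod_(v <- s) step_prob v eta.

Lemma weight_dep s : tlist T s -> dep_on [set` s] (weight s).
Proof.
move=> ts x y xy; rewrite /weight !big_seq; apply: eq_bigr => v vs.
by rewrite /step_prob (xy v vs) (xy (p v))//=; exact: tlist_root_parent.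
Qed.

(* The spin at [w], given those off the subtree of [w], has mean [th w] times
   the spin of the parent. *)
Definition markov (P : probability (config V) R) := forall w G, cylfun G ->
  dep_on (~` subtree T w) G ->
  Ex P (fun eta => sp eta w * G eta) = th w * Ex P (fun eta => sp eta (p w) * G eta).

(** A function of spins is affine in the spin at [u], with coefficients [A] and [B] free of that
    spin; [markov] replaces the spin by its conditional mean in the linear term. *)
Lemma markov_resample P u s F : markov P ->
  tlist T (u :: s) -> dep_on [set` u :: s] F -> Ex P F = Ex P (resample u F).
Proof.
move=> mP ts dF.
have d1 := dep_on_seq_cons (true) dF; have d0 := dep_on_seq_cons (false) dF.
have c1 := fset_cylfun d1; have c0 := fset_cylfun d0.
pose A eta := (F (upd eta u true) + F (upd eta u false)) / 2.
pose B eta := (F (upd eta u true) - F (upd eta u false)) / 2.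
have cA : cylfun A by apply: cylfunM; [exact: cylfunD|exact: cylfun_cst].
have cB : cylfun B by apply: cylfunM; [exact: cylfunB|exact: cylfun_cst].
have dB : dep_on (~` subtree T u) B.
  apply: dep_onS; first exact: (tlist_off ts).
  apply: (dep_on_comp (fun z => z / 2)).
  exact: (dep_on_comp2 (fun a b => a - b) d1 d0).
have -> : Ex P F = Ex P (fun eta => A eta + sp eta u * B eta).
  apply: eq_Ex => eta; rewrite /A /B -[in LHS](upd_id eta u).
  by case: (eta u); rewrite /spin; field.
rewrite ExD//; [|exact: cylfun_bmT|apply: cylfun_bmT;
  exact: cylfunM (cylfun_spin _ _) cB].
rewrite mP// -ExZ; last by apply: cylfun_bmT; exact: cylfunM (cylfun_spin _ _) cB.
rewrite -ExD//; [|exact: cylfun_bmT|apply: cylfun_bmT].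
  by apply: eq_Ex => eta; rewrite resampleE.
by apply: cylfunM; [exact: cylfun_cst|]; exact: cylfunM (cylfun_spin _ _) cB.
Qed.

(** Vertices are resampled from the newest to the oldest; the factor of the newest one comes out
    because the weight of the older ones does not involve its spin. The explicit right-hand side
    shows that [markov] determines the measure on cylinder functions. *)
Lemma markov_Ex P s F eta0 : markov P -> tlist T s -> dep_on [set` s] F ->
  Ex P F = config_sum s (fun eta => F eta * weight s eta) eta0.
Proof.
move=> mP; elim: s F => [|u s IH] F ts dF.
  rewrite /= /weight big_nil mulr1 -[RHS](Ex_cst P); apply: eq_Ex => eta.
  by apply: dF => v.
rewrite (markov_resample mP ts dF) IH; last exact: resample_dep.
  2: by case/and3P : ts.
rewrite /=; congr (config_sum s _ eta0); apply/funext => eta.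
have wE b : weight (u :: s) (upd eta u b) =
    (1 + th u * spin R b * sp eta (p u)) / 2 * weight s eta.
  rewrite /weight big_cons -/(weight s _); congr (_ * _).
    rewrite /step_prob {1}/upd eqxx; congr ((1 + _) / 2).
    have [->|pu] := root_or_in ts; first by rewrite th_root !mul0r.
    rewrite /upd; case: eqVneq => // eu; exfalso.
    by case/and3P : ts; rewrite -{1}eu pu.
  rewrite -/(weight s _) (upd_notin _ _ (weight_dep _)) //=;
    case/and3P : ts => // us _ _.
  exact/negP.
by rewrite !wE /resample big_bool /=; ring.
Qed.

Lemma markov_unique P P' F : markov P -> markov P' -> cylfun F ->
  Ex P F = Ex P' F.
Proof.
move=> mP mP' [D dF]; have [s [ts Ds]] := tlist_coverT T D.
have {}dF : dep_on [set` s] F by apply: dep_onS dF => v /Ds.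
by rewrite (markov_Ex (fun=> true) mP ts dF) (markov_Ex (fun=> true) mP' ts dF).
Qed.

End Chain.

(** * The free boundary measure as a Markov chain *)

Section FreeChain.
Variables (R : realType) (V : choiceType) (T : rooted_tree V).
Variables (beta : R) (J : V -> R) (mu : probability (config V) R).
Hypothesis mu_free : is_free_boundary_gibbs T beta J mu.
Local Notation o := (tree_root T).
Local Notation p := (parent T).
Local Notation sp eta v := (spin R (eta v)).
Implicit Types (u v w : V) (s : seq V) (eta : V -> bool).
Implicit Types (F G : (V -> bool) -> R).

(** The value 0 at the root turns it into a fair coin, so that the root obeys the same formulas as
    the other vertices. *)
Definition theta v : R := if v == o then 0 else tanh (beta * J v).

Lemma theta_root : theta o = 0. Proof. by rewrite /theta eqxx. Qed.

Lemma chain_probE v : chain_prob T beta J v = (1 + theta v) / 2.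
Proof. by rewrite /chain_prob /theta; case: ifP => // _; rewrite addr0 mul1r. Qed.

Definition chain_events (S : {fset V}) : set (V -> bool) :=
  \bigcap_(v in [set` S]) chain_event T v.

Definition copy_spin u eta : bool := if u == o then true else eta (p u).

Lemma chain_eventE u eta : chain_event T u eta = (eta u = copy_spin u eta) :> Prop.
Proof.
by rewrite /chain_event /copy_spin /=; case: ifP => _; apply/propext; split => // /eqP.
Qed.

Lemma dep_chain_events S :
  dep_on [set v | v \in S \/ exists2 u, u \in S & v = p u] (chain_events S).
Proof.
move=> x y xy; apply/propext; rewrite /chain_events.
have h u : u \in S -> chain_event T u x = chain_event T u y.
  move=> uS; rewrite !chain_eventE /copy_spin (xy u); last by left.
  by case: ifP => // _; rewrite (xy (p u))//; right; exists u.
by split => H u /= uS; [rewrite -h//|rewrite h//]; exact: H.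
Qed.

Lemma cylfun_chain_events S : cylfun (\1_(chain_events S) : _ -> R).
Proof.
exists (S `|` [fset p u | u in S])%fset; apply: dep_on_indic.
apply: dep_onS (@dep_chain_events S) => v /= [vS|[u uS ->]]; rewrite !inE.
  by rewrite vS.
by apply/orP; right; apply/imfsetP; exists u.
Qed.

Lemma indic_chain_events1 u S eta : u \notin S ->
  \1_(chain_events (u |` S)%fset) eta =
  (eta u == copy_spin u eta)%:R * \1_(chain_events S) eta :> R.
Proof.
move=> uS; rewrite !indicE -natrM mulnb; congr (_%:R); congr (nat_of_bool _).
apply/idP/andP => [/set_mem H|[/eqP H1 /set_mem H2]].
  split; first by have := H u; rewrite /= !inE eqxx chain_eventE => /(_ isT) ->.
  by apply/mem_set => v /= vS; apply: H; rewrite /= !inE vS orbT.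
apply/mem_set => v /=; rewrite !inE => /orP[/eqP ->|]; last exact: H2.
by rewrite chain_eventE.
Qed.

(** The hypothesis on [mu] only concerns chain events, so the induction carries an arbitrary family
    [S] of them: peeling [u] off the list turns the dependence on its spin into the event at [u],
    which joins [S]. The second conclusion is the one that gives the Markov property. *)
Lemma free_chain_indep s (S : {fset V}) G : tlist T s -> dep_on [set` s] G ->
  (forall v, v \in s -> v \notin S) ->
  Ex mu (fun eta => \1_(chain_events S) eta * G eta) =
  (\prod_(v <- S) chain_prob T beta J v) * Ex mu G /\
  forall u s', s = u :: s' -> Ex mu G = Ex mu (resample T theta u G).
Proof.
elim: s S G => [|u s IH] S G ts dG sS.
  split => //; pose c := G (fun=> true).
  have Gc eta : G eta = c by apply: dG.
  rewrite (eq_Ex mu (G := fun eta => c * \1_(chain_events S) eta)); last first.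
    by move=> x; rewrite Gc mulrC.
  have mC : @measurable _ (config V) (chain_events S).
    by have [+ _] := cylfun_bmT (cylfun_chain_events S) => /measurable_indicP.
  rewrite ExZ; last exact: cylfun_bmT (cylfun_chain_events S).
  rewrite Ex_indic// mulrC; congr (_ * _).
    by have := mu_free S; rewrite -/(chain_events S) => ->.
  by rewrite (eq_Ex mu (G := fun=> c))// Ex_cst.
pose G1 eta := G (upd eta u (copy_spin u eta)).
pose G0 eta := G (upd eta u (~~ copy_spin u eta)).
have ts' : tlist T s by case/and3P : ts.
have us : u \notin s by case/and3P : ts.
have dc : dep_on [set` s] (copy_spin u).
  move=> x y xy; rewrite /copy_spin; case: eqVneq => // uo; apply: xy => /=.
  by have [uo'|//] := root_or_in ts; rewrite uo' eqxx in uo.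
have dG1 : dep_on [set` s] G1.
  move=> x y xy; rewrite /G1 (dc x y xy).
  exact: (dep_on_seq_cons (copy_spin u y) dG).
have dG0 : dep_on [set` s] G0.
  move=> x y xy; rewrite /G0 (dc x y xy).
  exact: (dep_on_seq_cons (~~ copy_spin u y) dG).
have key (S' : {fset V}) : (forall v, v \in u :: s -> v \notin S') ->
    Ex mu (fun eta => \1_(chain_events S') eta * G eta) =
    (\prod_(v <- S') chain_prob T beta J v) *
    (chain_prob T beta J u * Ex mu G1 + (1 - chain_prob T beta J u) * Ex mu G0).
  move=> sS'; have uS' : u \notin S' by apply: sS'; rewrite inE eqxx.
  have sS1 v : v \in s -> v \notin S' by move=> vs; apply: sS'; rewrite inE vs orbT.
  have sS2 v : v \in s -> v \notin (u |` S')%fset.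
    by move=> vs; rewrite !inE negb_or sS1// andbT; apply: contraNneq us => <-.
  (* On the event at [u] the spin equals [copy_spin u], off it the opposite; the indicator of the
     complement is written as a difference so that only families of chain events occur. *)
  rewrite (eq_Ex mu (G := fun eta =>
      \1_(chain_events (u |` S')%fset) eta * G1 eta +
      (\1_(chain_events S') eta * G0 eta -
       \1_(chain_events (u |` S')%fset) eta * G0 eta))); last first.
    move=> eta; rewrite indic_chain_events1// /G1 /G0.
    have [<-|ne] := eqVneq (eta u) (copy_spin u eta).
      by rewrite upd_id mul1r; ring.
    have -> : ~~ copy_spin u eta = eta u by case: (eta u) (copy_spin u eta) ne => -[].
    by rewrite upd_id mul0r; ring.
  have bm S'' (H : (V -> bool) -> R) : dep_on [set` s] H -> bmfun (fun eta :
    config V => \1_(chain_events S'') eta * H eta).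

    by move=> dH; exact: (cylfun_bmT (cylfunM (cylfun_chain_events _)
      (fset_cylfun dH))).
  rewrite ExD ?ExB; [|by apply: bm..| by apply: bm|].
    have [-> _] := IH _ _ ts' dG1 sS2; have [-> _] := IH _ _ ts' dG0 sS2.
    have [-> _] := IH _ _ ts' dG0 sS1.
    rewrite big_fsetU1//=; ring.
  have c S'' : cylfun (fun eta => \1_(chain_events S'') eta * G0 eta).
    exact: (cylfunM (cylfun_chain_events _) (fset_cylfun dG0)).
  exact: (cylfun_bmT (cylfunB (c _) (c _))).
have E0 : Ex mu G = chain_prob T beta J u * Ex mu G1 + (1 - chain_prob T beta J
  u) * Ex mu G0.
  have := key fset0 (fun v _ => isT); rewrite big_seq_fset0 mul1r => <-.
  apply: eq_Ex => eta; have : chain_events fset0 eta by move=> v.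
  by rewrite indicE => /mem_set ->; rewrite mul1r.
split; first by rewrite key// E0.
move=> u' s' [<- _]; rewrite E0 chain_probE.
rewrite -!ExZ; [|exact: cylfun_bmT (fset_cylfun dG0)|exact: cylfun_bmT
  (fset_cylfun dG1)].
rewrite -ExD; first last.
- exact: (cylfun_bmT (cylfunM (cylfun_cst _ _) (fset_cylfun dG0))).
- exact: (cylfun_bmT (cylfunM (cylfun_cst _ _) (fset_cylfun dG1))).
apply: eq_Ex => eta; rewrite /resample big_bool /= /G1 /G0 /copy_spin.
case: ifPn => [/eqP ->|uo]; first by rewrite theta_root /=; field.
by case: (eta (p u)); rewrite /spin /=; field.
Qed.

Lemma free_markov : markov T theta mu.
Proof.
move=> w G [D dD] dG.
(* The parent of [w] is included so that, when [w] is not the root, it may stand in front of the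
   list covering [E]. *)
have [E memE] : exists E : seq V, forall v,
    (v \in E) = ((v == p w) || (v \in D)) && `[< ~ subtree T w v >].
  exists [seq v <- p w :: enum_fset D | `[< ~ subtree T w v >]] => v.
  by rewrite mem_filter inE andbC.
have [||s [ts sA Es]] := @tlist_cover _ T (~` subtree T w) _ E.
- by move=> u; exact: not_subtree_parent.
- by move=> u /=; rewrite memE => /andP[_ /asboolP].
have tws : tlist T (w :: s).
  rewrite /= ts andbT; apply/andP; split.
    by apply/negP => /sA; apply; exact: subtree_refl.
  have [//|wo /=] := eqVneq w o; apply: Es; rewrite memE eqxx.
  by apply/asboolP; exact: parent_not_subtree.
have dGs : dep_on [set` s] G.
  apply: dep_onS (dep_onI dD dG) => v [/= vD nv]; apply: Es.
  by rewrite memE vD orbT; exact/asboolP.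
have dF : dep_on [set` w :: s] (fun eta => sp eta w * G eta).
  apply: dep_on_comp2; first by apply: dep_on_spin; rewrite /= inE eqxx.
  by apply: dep_onS dGs => v /= vs; rewrite inE vs orbT.
have [_ /(_ _ _ erefl) ->] := free_chain_indep (S := fset0) tws dF (fun v _ => isT).
have cG : cylfun G by exists D.
rewrite -ExZ; last by apply: cylfun_bmT; exact: cylfunM (cylfun_spin _ _) cG.
apply: eq_Ex => eta; rewrite resampleE !(upd_notin _ _ dG); last 2 first.
- by move/(_ (subtree_refl _ _)).
- by move/(_ (subtree_refl _ _)).
by rewrite /upd eqxx /spin; field.
Qed.

End FreeChain.

(** * Gibbs measures *)

Section SpinEvents.
Variables (R : realType) (V : choiceType).
Implicit Types (D : set V) (F G : (V -> bool) -> R) (P : probability (config V) R).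

Lemma spin_sigmaS D D' : D `<=` D' ->
  <<s spin_events D >> `<=` <<s spin_events D' >>.
Proof.
by move=> DD'; apply: sub_sigma_algebra2 => A [v Dv <-]; exists v => //; exact: DD'.
Qed.

Lemma spin_sigma_measurable D A : <<s spin_events D >> A ->
  @measurable _ (config V) A.
Proof. exact: spin_sigmaS. Qed.

Lemma cylfun_Ex P (D : {fset V}) F eta0 : dep_on [set` D] F ->
  Ex P F = \sum_(tau : {ffun D -> bool})
    F (splice tau eta0) * fine (P (cylset tau)).
Proof.
move=> dF.
have mt (tau : {ffun D -> bool}) : @measurable _ (config V) (cylset tau).
  exact: (measurable_cylset tau (@subsetT _ _)).
rewrite (eq_Ex P (cyl_decomp eta0 dF)) Ex_sum; last first.
  by move=> tau; apply: bmfunM; [exact: bmfun_cst|exact: bmfun_indic].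
by apply: eq_bigr => tau _; rewrite ExZ ?Ex_indic//; exact: bmfun_indic.
Qed.

Definition all_plus (E : {fset V}) : set (V -> bool) :=
  [set eta | forall v, v \in E -> eta v].

Lemma all_plus_cylset E : all_plus E = cylset [ffun _ : E => true].
Proof.
apply/seteqP; split => x h; first by move=> u; rewrite ffunE; apply: h; exact: valP.
by move=> v vE; have := h [` vE]%fset; rewrite ffunE.
Qed.

(** The events [all_plus E] are stable under intersection and generate the sigma-algebra, so the
    pi-lambda theorem applies to them. *)
Lemma dynkin_spin_events D (Q : set (set (V -> bool))) : dynkin Q ->
  (forall E : {fset V}, [set` E] `<=` D -> Q (all_plus E)) ->
  <<s spin_events D >> `<=` Q.
Proof.
move=> dQ hQ; pose H : set (set (V -> bool)) :=
  [set A | exists E : {fset V}, [set` E] `<=` D /\ A = all_plus E].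
have HI : setI_closed H.
  move=> _ _ [E [ED ->]] [E' [E'D ->]]; exists (E `|` E')%fset; split.
    by move=> v /=; rewrite inE => /orP[/ED|/E'D].
  apply/seteqP; split => [x [h h'] v|x h]; first by rewrite inE => /orP[/h|/h'].
  by split => v vE; apply: h; rewrite inE vE ?orbT.
apply: (@subset_trans _ <<s H >>).
  apply: sub_sigma_algebra2 => _ [v Dv <-]; exists [fset v]%fset; split.
    by move=> u /=; rewrite inE => /eqP ->.
  apply/seteqP; split => [x xv u|x h]; first by rewrite inE => /eqP ->.
  by apply: h; rewrite inE.
rewrite -(setI_closed_g_dynkin_g_sigma_algebra HI).
by apply: smallest_sub => // _ [E [ED ->]]; exact: hQ.
Qed.

Lemma probability_spin_eq P P' :
  (forall F, cylfun F -> Ex P F = Ex P' F) ->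
  forall A, @measurable _ (config V) A -> P A = P' A.
Proof.
move=> PP' A mA.
have mE E : @measurable _ (config V) (all_plus E).
  by rewrite all_plus_cylset; exact: measurable_cylset.
suff [] : @measurable _ (config V) A /\ P A = P' A by [].
move: A mA; apply: (@dynkin_spin_events setT [set A | @measurable _ (config V)
  A /\ P A = P' A]).
  split => /=.
  - by split; [exact: measurableT|rewrite !probability_setT].
  - move=> A [mA e]; split; first exact: measurableC.
    by rewrite !probability_setC// e.
  - move=> F tF mF; have mF' i : @measurable _ (config V) (F i) by case: (mF i).
    split; first exact: (@bigcupT_measurable _ (config V)).
    rewrite !measure_bigcup//; apply: eq_eseriesr => i _.
    by case: (mF i).
move=> E _; split => //.
have cE : cylfun (\1_(all_plus E) : _ -> R).
  exists E; apply: dep_on_indic => x y xy; apply/propext.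
  by split => h v vE; [rewrite -xy//|rewrite xy//]; exact: h.
have := PP' _ cE; rewrite !Ex_indic// => e.
by rewrite -(fineK (fin_num_measure P _ (mE E))) e fineK// fin_num_measure.
Qed.

(** This turns the Gibbs property into identities between expectations of cylinder functions. One
    direction decomposes the test function into cylinder events; the other starts from the events
    [all_plus] and extends by [dynkin_spin_events]. *)
Lemma cond_prob_cylfun P D A f : @measurable _ (config V) A -> cylfun f ->
  dep_on D f ->
  (is_cond_prob P (spin_events D) A f <->
   forall G, cylfun G -> dep_on D G ->
     Ex P (fun eta => \1_A eta * G eta) = Ex P (fun eta => f eta * G eta)).
Proof.
move=> mA cf df; split => [[_ _ H] G [D' dG] dG'|H].
  pose E : {fset V} := [fset v in D' | `[< D v >]]%fset.
  have ED : [set` E] `<=` D by move=> v /=; rewrite !inE => /andP[_ /asboolP].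
  have dE : dep_on [set` E] G.
    apply: dep_onS (dep_onI dG dG') => v [/= vD' Dv].
    by rewrite !inE vD'; exact/asboolP.
  have mt (tau : {ffun E -> bool}) := measurable_cylset tau ED.
  have mt' (tau : {ffun E -> bool}) := spin_sigma_measurable (mt tau).
  pose c (tau : {ffun E -> bool}) := G (splice tau (fun=> true)).
  have GE eta : G eta = \sum_tau c tau * \1_(cylset tau) eta.
    exact: cyl_decomp dE eta.
  have e (h : config V -> R) : bmfun h -> Ex P (fun eta => h eta * G eta) =
      \sum_tau c tau * Ex P (fun eta => \1_(cylset tau) eta * h eta).
    move=> bh; have bt (tau : {ffun E -> bool}) : bmfun (fun eta : config V =>
      \1_(cylset tau) eta * h eta).
      exact: (bmfunM (bmfun_indic R (mt' tau)) bh).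
    under [RHS]eq_bigr do rewrite -ExZ//.
    rewrite -Ex_sum; last by move=> tau; exact: (bmfunM (bmfun_cst _ _) (bt tau)).
    apply: eq_Ex => eta; rewrite GE mulr_sumr; apply: eq_bigr => tau _.
    by rewrite mulrCA (mulrC (h eta)).
  rewrite (e f (cylfun_bmT cf)) (e _ (bmfun_indic R mA)).
  apply: eq_bigr => tau _; congr (_ * _); apply: EFin_inj.
  rewrite -(Ex_indicE _ (mt' tau) (cylfun_bmT cf)) -(Ex_indicE _ (mt' tau)
    (bmfun_indic R mA)).
  by rewrite -H// integral_indic// setIC.
have iT (B : set (config V)) : measurable B ->
    P (A `&` B) = (\int[P]_(x in B) (\1_A x)%:E)%E.
  by move=> mB; rewrite integral_indic.
split; first exact: (cylfun_bm cf df).1.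
  by apply: bmfun_integrable; exact: cylfun_bmT.
pose Q : set (set (V -> bool)) := [set B | @measurable _ (config V) B /\
  P (A `&` B) = (\int[P]_(x in B) (f x)%:E)%E].
suff : <<s spin_events D >> `<=` Q by move=> h B /h[].
have bf : bmfun (f : config V -> R) by exact: cylfun_bmT.
have base G (B : set (config V)) : measurable B -> G = \1_B ->
    Ex P (fun eta => \1_A eta * G eta) = Ex P (fun eta => f eta * G eta) <->
    P (A `&` B) = (\int[P]_(x in B) (f x)%:E)%E.
  move=> mB ->; rewrite iT// !Ex_indicE//; last exact: bmfun_indic.
  rewrite (eq_Ex P (G := fun x => \1_B x * \1_A x)); last by move=> x; rewrite mulrC.
  rewrite (eq_Ex P (F := fun x => f x * _) (G := fun x => \1_B x * f x));
    last by move=> x; rewrite mulrC.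
  by split => [->//|[]].
apply: dynkin_spin_events.
  split.
  - split; first exact: measurableT.
    apply/(base (\1_setT)) => //; apply: H; last by move=> x y _; rewrite !indicT.
    by rewrite indicT; exact: cylfun_cst.
  - move=> B [mB] /(base _ _ mB erefl) e; split; first exact: measurableC.
    apply/(base (fun x => 1 - \1_B x)); first exact: measurableC.
      by apply/funext => x; rewrite !indicE in_setC; case: (_ \in _);
        rewrite ?subrr ?subr0.
    have b1 : bmfun (\1_A : config V -> R) by exact: bmfun_indic.
    have b2 := bmfun_indic R mB.
    rewrite (eq_Ex P (G := fun x => \1_A x - \1_A x * \1_B x)); last by move=> x;
      rewrite mulrBr mulr1.
    rewrite (eq_Ex P (F := fun x => f x * _) (G := fun x => f x - f x * \1_B x));
      last by move=> x; rewrite mulrBr mulr1.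
    rewrite !ExB// ?e; [|exact: bmfunM|exact: bmfunM].
    congr (_ - _); have := H (fun=> 1) (cylfun_cst _ _) (@dep_on_cst _ _ _ _).
    by rewrite (eq_Ex P (G := \1_A)) ?(eq_Ex P (F := fun x => f x * 1) (G :=
      f))// => x; rewrite mulr1.
  - move=> F tF QF; have mF i : @measurable _ (config V) (F i) by case: (QF i).
    split; first exact: (@bigcupT_measurable _ (config V)).
    have mAF i : @measurable _ (config V) (A `&` F i) by exact: measurableI.
    rewrite setI_bigcupr measure_semi_bigcup//; last 2 first.
    + by apply: trivIset_setIl; exact: tF.
    + exact: (@bigcupT_measurable _ (config V)).
    rewrite integral_bigcup//; last first.
      by apply: integrableS (bmfun_integrable P bf) => //; exact: bigcupT_measurable.
    by apply: eq_eseriesr => i _; case: (QF i).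
move=> E ED; have mE : <<s spin_events D >> (all_plus E).
  by rewrite all_plus_cylset; exact: measurable_cylset.
split; first exact: spin_sigma_measurable mE.
apply/(base \1_(all_plus E)) => //; first exact: spin_sigma_measurable mE.
have dE : dep_on [set` E] (all_plus E).
  move=> x y xy; apply/propext.
  by split => h v vE; [rewrite -xy//|rewrite xy//]; exact: h.
apply: H; first by exists E; exact: dep_on_indic.
exact: (dep_onS ED (dep_on_indic R dE)).
Qed.

End SpinEvents.

(** * Markov chains satisfy the finite-volume Gibbs conditions *)

Section GibbsWeight.
Variables (R : realType) (V : choiceType) (T : rooted_tree V).
Variables (beta : R) (J : V -> R).
Hypothesis lf : locally_finite T.
Local Notation o := (tree_root T).
Local Notation p := (parent T).
Local Notation sp eta v := (spin R (eta v)).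
Local Notation th := (theta T beta J).
Local Notation gw := (gibbs_weight T beta J).
Implicit Types (L : {fset V}) (eta : V -> bool).

Lemma finite_edges_meeting L : finite_set (edges_meeting T L).
Proof.
apply: (@sub_finite_set _ _ ([set` L] `|` \bigcup_(v in [set` L]) children T v)).
  move=> w [wo [wL|pwL]]; first by left.
  by right; exists (p w).
by rewrite finite_setU; split => //; apply: bigcup_finite => // v _; exact: lf.
Qed.

Definition edges L : seq V := fset_set (edges_meeting T L).

Lemma mem_edges L w :
  w \in edges L = (w != o) && ((w \in L) || (p w \in L)).
Proof.
rewrite /edges in_fset_set; last exact: finite_edges_meeting.
apply/idP/andP => [/set_mem[-> []->]|[wo wL]]; rewrite ?orbT//.
by apply/mem_set; split => //; move/orP : wL.
Qed.

Lemma gibbs_weightE L eta : gw L eta =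
  \prod_(w <- edges L) expR (beta * J w * sp eta w * sp eta (p w)).
Proof.
rewrite /gibbs_weight fsbig_finite; last exact: finite_edges_meeting.
rewrite mulr_sumr expR_sum; apply: eq_bigr => w _.
by congr expR; ring.
Qed.

Lemma gibbs_weight_gt0 L eta : 0 < gw L eta. Proof. exact: expR_gt0. Qed.

Lemma gibbs_weight_dep L :
  dep_on [set v | exists2 w, w \in edges L & v = w \/ v = p w] (gw L).
Proof.
move=> x y xy; rewrite !gibbs_weightE !big_seq; apply: eq_bigr => w wE.
rewrite (xy w) 1?(xy (p w))//; first by exists w => //; right.
by exists w => //; left.
Qed.

(** For s = 1 or s = -1, (1 + s tanh x) / 2 = exp (s x) / (exp x + exp (- x)): a transition
    probability of the chain is a Boltzmann factor up to a constant. *)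
Lemma step_probE w eta : w != o -> step_prob T th w eta =
  (expR (beta * J w) + expR (- (beta * J w)))^-1 *
  expR (beta * J w * sp eta w * sp eta (p w)).
Proof.
move=> wo; rewrite /step_prob /theta (negbTE wo) /tanh.
set x := beta * J w.
have h : expR x + expR (- x) != 0 by rewrite gt_eqF// addr_gt0// expR_gt0.
by case: (eta w) (eta (p w)) => -[]; rewrite /spin ?mulr1 ?mulrN1 ?opprK;
  field.
Qed.

(** Off [edges L] a factor of the weight either belongs to the root, where it is constant, or
    involves no spin of [L], so it is the same for both configurations. *)
Lemma weight_gibbs s L eta eta' : tlist T s -> {subset edges L <= s} ->
  (forall v, v \notin L -> eta v = eta' v) ->
  weight T th s eta * gw L eta' = weight T th s eta' * gw L eta.
Proof.
move=> ts Es ee.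
have us : uniq s by elim: (s) ts => //= u s' IH /and3P[-> _ /IH].
have wE x : weight T th s x =
    (\prod_(w <- edges L) (expR (beta * J w) + expR (- (beta * J w)))^-1) *
    gw L x * \prod_(v <- s | v \notin edges L) step_prob T th v x.
  rewrite /weight (bigID (fun v => v \in edges L)) /=; congr (_ * _).
  rewrite -big_filter (perm_big (edges L)); last first.
    apply: uniq_perm => [||v]; [exact: filter_uniq|exact: fset_uniq|].
    by rewrite mem_filter andb_idr// => /Es.
  rewrite gibbs_weightE -big_split /= !big_seq; apply: eq_bigr => w.
  by rewrite mem_edges => /andP[wo _]; exact: step_probE.
rewrite !wE; have -> : \prod_(v <- s | v \notin edges L) step_prob T th v eta =
    \prod_(v <- s | v \notin edges L) step_prob T th v eta'.
  apply: eq_bigr => v; rewrite mem_edges negb_and negbK => /orP[/eqP ->|].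
    by rewrite /step_prob theta_root !mul0r.
  by rewrite negb_or => /andP[/ee vL /ee pvL]; rewrite /step_prob vL pvL.
by ring.
Qed.

Lemma splice_agree L (tau : {ffun L -> bool}) x y :
  (forall v, (~` [set` L]) v -> x v = y v) -> splice tau x = splice tau y.
Proof.
move=> xy; apply/funext => v; rewrite /splice; case: insubP => // vL.
by apply: xy; exact/negP.
Qed.

Lemma gibbs_kernel_dep L (sigma : {ffun L -> bool}) :
  dep_on ((~` [set` L]) `&` [set v | exists2 w, w \in edges L & v = w \/ v = p w])
    (gibbs_kernel T beta J sigma).
Proof.
apply: dep_onI => x y xy; rewrite /gibbs_kernel.
  by under eq_bigr do rewrite (splice_agree _ xy); rewrite (splice_agree _ xy).
have h (tau : {ffun L -> bool}) : gw L (splice tau x) = gw L (splice tau y).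
  apply: gibbs_weight_dep => v vE; have [vL|vL] := boolP (v \in L).
    by rewrite !(splice_in _ _ [` vL]%fset).
  by rewrite !splice_out//; exact: xy.
by rewrite h; congr (_ / _); apply: eq_bigr => tau _; exact: h.
Qed.

Lemma cylfun_gibbs_kernel L (sigma : {ffun L -> bool}) :
  cylfun (gibbs_kernel T beta J sigma).
Proof.
apply: (fset_cylfun (s := edges L ++ map p (edges L))).
apply: dep_onS (@gibbs_kernel_dep L sigma) => v [_ [w wE]] /= vw.
by rewrite mem_cat; case: vw => ->; [rewrite wE|rewrite map_f ?orbT].
Qed.

(* Flipping the spins at which [sigma] and [tau] differ exchanges the two events
   and changes the weight by the ratio of the two Gibbs weights. *)
Lemma markov_gibbs_swap P L (sigma tau : {ffun L -> bool}) H :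
  markov T th P -> cylfun H -> dep_on (~` [set` L]) H ->
  Ex P (fun eta => \1_(cylset tau) eta * (H eta * gw L (splice sigma eta))) =
  Ex P (fun eta => \1_(cylset sigma) eta * (H eta * gw L (splice tau eta))).
Proof.
move=> mP [D dH] dHL.
have [s [ts Ds]] := tlist_coverT T (D ++ enum_fset L ++ edges L).
have Es : {subset edges L <= s} by move=> v vE; apply: Ds; rewrite !mem_cat vE !orbT.
have Ls : [set` L] `<=` [set` s] by move=> v /= vE; apply: Ds;
  rewrite !mem_cat vE !orbT.
have dHs : dep_on [set` s] H by apply: dep_onS dH => v /= vE; apply: Ds;
  rewrite !mem_cat vE.
have dg (t : {ffun L -> bool}) : dep_on [set` s] (fun x => gw L (splice t x)).
  move=> x y xy; apply: gibbs_weight_dep => v [w wE vw].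
  have vs : v \in s.
    by case: vw => ->; [exact: Es|apply: tlist_root_parent => //; exact: Es].
  have [vL|vL] := boolP (v \in L); last by rewrite !splice_out//; exact: xy.
  by rewrite !(splice_in _ _ [` vL]%fset).
have dc (t : {ffun L -> bool}) : dep_on [set` s] (\1_(cylset t) : _ -> R).
  apply: dep_on_indic => x y xy; apply/propext; split => h u.
    by rewrite -xy; [exact: h|apply: Ls; exact: valP].
  by rewrite xy; [exact: h|apply: Ls; exact: valP].
have dF (t t' : {ffun L -> bool}) : dep_on [set` s]
    (fun eta => \1_(cylset t) eta * (H eta * gw L (splice t' eta))).
  by move=> x y xy; rewrite (dc t x y xy) (dHs x y xy) (dg t' x y xy).
rewrite !(markov_Ex (theta_root T beta J) (fun=> true) mP ts (dF _ _)).
pose K eta := H eta * (weight T th s (splice sigma eta) * gw L (splice tau eta)).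
have dK : dep_on (~` [set` L]) K.
  by move=> x y xy; rewrite /K (dHL x y xy) !(splice_agree _ xy).
have spl (t : {ffun L -> bool}) eta : cylset t eta -> splice t eta = eta.
  move=> te; apply/funext => v; have [vL|vL] := boolP (v \in L).
    by rewrite (splice_in _ _ [` vL]%fset) -te.
  by rewrite splice_out.
have swapw eta : weight T th s (splice tau eta) * gw L (splice sigma eta) =
    weight T th s (splice sigma eta) * gw L (splice tau eta).
  by apply: weight_gibbs => // v vL; rewrite !splice_out.
pose U v := splice sigma (fun=> true) v (+) splice tau (fun=> true) v.
have -> : (fun eta => \1_(cylset tau) eta * (H eta * gw L (splice sigma eta)) *
    weight T th s eta) = (fun eta => \1_(cylset sigma) (xorc U eta) * K (xorc U eta)).
  apply/funext => eta.
  have -> : K (xorc U eta) = K eta.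
    apply: dK => v vL; rewrite /xorc /U !splice_out//; first by rewrite addbb addbF.
    - exact/negP.
    - exact/negP.
  have -> : \1_(cylset sigma) (xorc U eta) = \1_(cylset tau) eta :> R.
    rewrite !indicE; congr ((_ : bool)%:R); apply/idP/idP => /set_mem h;
      apply/mem_set => u.
      have := h u; rewrite /xorc /U !splice_in.
      by case: (eta _) (sigma u) (tau u) => -[] [].
    by rewrite /xorc /U !splice_in h; case: (sigma u) (tau u) => -[].
  rewrite indicE; case: (boolP (eta \in _)) => [/set_mem te|_]; last by rewrite !mul0r.
  by rewrite /K !mul1r -swapw (spl _ _ te); ring.
rewrite (config_sum_xor s (fun eta => \1_(cylset sigma) eta * K eta)).
have -> : (fun eta => \1_(cylset sigma) eta * (H eta * gw L (splice tau eta)) *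
    weight T th s eta) = (fun eta => \1_(cylset sigma) eta * K eta).
  apply/funext => eta; rewrite indicE.
  case: (boolP (eta \in _)) => [/set_mem te|_]; last by rewrite !mul0r.
  by rewrite /K !mul1r (spl _ _ te); ring.
apply: config_sum_dep => x y xy; rewrite /K (dc sigma x y xy) (dHs x y xy).
rewrite (dg tau x y xy); congr (_ * (_ * (_ * _))).
apply: (weight_dep th ts) => v /= vs.
have [vL|vL] := boolP (v \in L); last by rewrite !splice_out//; exact: xy.
by rewrite !(splice_in _ _ [` vL]%fset).
Qed.

Lemma gibbs_kernel_Ex P : is_gibbs T beta J P -> forall L (sigma : {ffun L -> bool}) G,
  cylfun G -> dep_on (~` [set` L]) G ->
  Ex P (fun eta => \1_(cylset sigma) eta * G eta) =
  Ex P (fun eta => gibbs_kernel T beta J sigma eta * G eta).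
Proof.
move=> gP L sigma G cG dG; have := gP L sigma.
rewrite (@cond_prob_cylfun _ _ P _ (cylset sigma)); first by apply.
- exact: (measurable_cylset sigma (@subsetT _ _)).
- exact: cylfun_gibbs_kernel.
- by apply: dep_onS (@gibbs_kernel_dep L sigma) => v [].
Qed.

Lemma is_gibbs_cylfun (P : probability (config V) R) :
  (forall L (sigma : {ffun L -> bool}) G, cylfun G -> dep_on (~` [set` L]) G ->
    Ex P (fun eta => \1_(cylset sigma) eta * G eta) =
    Ex P (fun eta => gibbs_kernel T beta J sigma eta * G eta)) ->
  is_gibbs T beta J P.
Proof.
move=> h L sigma.
apply/(@cond_prob_cylfun _ _ P _ (cylset sigma)); last by move=> G cG dG; exact: h.
- exact: (measurable_cylset sigma (@subsetT _ _)).
- exact: cylfun_gibbs_kernel.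
- by apply: dep_onS (@gibbs_kernel_dep L sigma) => v [].
Qed.

Lemma cylfun_cylset L (tau : {ffun L -> bool}) : cylfun (\1_(cylset tau) : _ -> R).
Proof.
exists L; apply: dep_on_indic => x y xy; apply/propext.
by split => h u; [rewrite -xy|rewrite xy]; rewrite ?h//; exact: valP.
Qed.

(** The partition function [Z] depends only on the spins off [L], so it can be moved into the test
    function; what remains is [markov_gibbs_swap] summed over [tau]. *)
Lemma markov_is_gibbs P : markov T th P -> is_gibbs T beta J P.
Proof.
move=> mP; apply: is_gibbs_cylfun => L sigma G cG dG.
pose Z eta := \sum_(tau : {ffun L -> bool}) gw L (splice tau eta).
have Z0 eta : Z eta != 0.
  rewrite gt_eqF// /Z (bigD1 [ffun=> true])//= ltr_pwDl//;
    first exact: gibbs_weight_gt0.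
  by apply: sumr_ge0 => tau _; exact/ltW/gibbs_weight_gt0.
pose H eta := G eta / Z eta.
have cgw (tau : {ffun L -> bool}) : cylfun (fun eta => gw L (splice tau eta)).
  apply: (fset_cylfun (s := edges L ++ map p (edges L))) => x y xy.
  apply: gibbs_weight_dep => v [w wE vw]; have [vL|vL] := boolP (v \in L).
    by rewrite !(splice_in _ _ [` vL]%fset).
  rewrite !splice_out//; apply: xy; rewrite /= mem_cat.
  by case: vw => ->; [rewrite wE|rewrite map_f ?orbT].
have cH : cylfun H.
  by apply: (cylfun_comp2 (fun a b => a / b)) => //; exact: cylfun_sum.
have dH : dep_on (~` [set` L]) H.
  move=> x y xy; rewrite /H (dG x y xy) /Z.
  by congr (_ / _); apply: eq_bigr => tau _; rewrite (splice_agree _ xy).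
have sum1 eta : \sum_(tau : {ffun L -> bool}) \1_(cylset tau) eta = 1 :> R.
  rewrite (bigD1 (restr L eta))//= indicE cylsetE eqxx big1 ?addr0// => tau.
  by rewrite indicE cylsetE eq_sym => /negbTE ->.
transitivity (\sum_(tau : {ffun L -> bool})
    Ex P (fun eta => \1_(cylset sigma) eta * (H eta * gw L (splice tau eta)))).
  rewrite -Ex_sum; last first.
    move=> tau; apply: cylfun_bmT; apply: cylfunM; first exact: cylfun_cylset.
    exact: cylfunM.
  apply: eq_Ex => eta; rewrite -mulr_sumr -mulr_sumr -/(Z eta) /H.
  by rewrite divfK.
under eq_bigr do rewrite -(markov_gibbs_swap _ _ mP cH dH).
rewrite -Ex_sum; last first.
  move=> tau; apply: cylfun_bmT; apply: cylfunM; first exact: cylfun_cylset.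
  exact: cylfunM.
apply: eq_Ex => eta; rewrite -mulr_suml sum1 mul1r /H /gibbs_kernel -/(Z eta).
by ring.
Qed.

End GibbsWeight.

(** * Second moments of magnetizations *)

Section FiniteLaws.
Variable R : realType.
Implicit Types (d : seq (R * R)) (f : R -> R) (a b x m : R).

(** The addition formula of tanh: it gives the mean of a fair spin after two conditionally
    independent observations, whose log-odds add up. *)
Definition mcomb a b : R := (a + b) / (1 + a * b).

Lemma mcomb_denom a b : `|a| < 1 -> `|b| <= 1 -> 0 < 1 + a * b.
Proof.
move=> a1 b1; have : `|a * b| < 1 by rewrite normrM; apply: le_lt_trans a1;
  rewrite ler_piMr.
by rewrite ltr_norml => /andP[h _]; rewrite -ltrBlDl sub0r.
Qed.

Lemma sqr_le1_norm a : `|a| <= 1 -> a * a <= 1.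
Proof. by move=> a1; rewrite -[a * a]ger0_norm -?expr2 ?sqr_ge0// expr2 normrM
  mulr_ile1. Qed.

Lemma mcomb_sqr_le a b : `|a| < 1 -> `|b| <= 1 -> (a + b) ^+ 2 <= (1 + a * b) ^+ 2.
Proof.
move=> a1 b1; have := sqr_le1_norm (ltW a1); have := sqr_le1_norm b1.
by move=> hb ha; rewrite -subr_ge0;
  have -> : (1 + a * b) ^+ 2 - (a + b) ^+ 2 = (1 - a * a) * (1 - b * b) by
  [ring]; apply: mulr_ge0; rewrite subr_ge0.
Qed.

Lemma mcomb_norm a b : `|a| < 1 -> `|b| <= 1 -> `|mcomb a b| <= 1.
Proof.
move=> a1 b1; have h := mcomb_denom a1 b1.
rewrite /mcomb normrM normfV (gtr0_norm h) ler_pdivrMr// mul1r.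
rewrite -(gtr0_norm h) -ler_sqr ?nnegrE// !real_normK ?num_real//.
exact: mcomb_sqr_le.
Qed.

Lemma mcombN a b : mcomb (- a) (- b) = - mcomb a b.
Proof. by rewrite /mcomb mulrNN -opprD mulNr. Qed.

Definition law_sum d f : R := \sum_(e <- d) e.1 * f e.2.

(** Symmetry expresses the invariance under a global spin flip, and makes the odd moments vanish. *)
Definition symmetric_law d := [/\ forall e, e \in d -> 0 <= e.1 /\ `|e.2| <= 1,
  law_sum d (fun=> 1) = 1 & forall f, law_sum d f = law_sum d (fun x => f (- x))].

Lemma law_sum_odd d f : symmetric_law d -> (forall x, f (- x) = - f x) ->
  law_sum d f = 0.
Proof.
move=> [_ _ sd] fN; have : law_sum d f = - law_sum d f.
  rewrite {1}sd /law_sum -sumrN; apply: eq_bigr => e _; rewrite fN; ring.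
lra.
Qed.

Lemma ler_law_sum d f g : symmetric_law d ->
  (forall x, `|x| <= 1 -> f x <= g x) -> law_sum d f <= law_sum d g.
Proof.
move=> [d0 _ _] fg; rewrite /law_sum big_seq [leRHS]big_seq; apply: ler_sum => e ed.
by have [e0 e1] := d0 _ ed; apply: ler_wpM2l => //; exact: fg.
Qed.

Lemma law_sumD d f g : law_sum d (fun x => f x + g x) = law_sum d f + law_sum d g.
Proof. by rewrite /law_sum -big_split; apply: eq_bigr => e _; rewrite mulrDr. Qed.

Lemma law_sumZ d c f : law_sum d (fun x => c * f x) = c * law_sum d f.
Proof. by rewrite /law_sum mulr_sumr; apply: eq_bigr => e _; rewrite mulrCA. Qed.

Lemma law_sumZr d c f : law_sum d (fun x => f x * c) = law_sum d f * c.
Proof. by rewrite /law_sum mulr_suml; apply: eq_bigr => e _; rewrite mulrA. Qed.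

Lemma law_sum_cst d c : symmetric_law d -> law_sum d (fun=> c) = c.
Proof. by move=> [_ d1 _]; rewrite -[in RHS](mulr1 c) -d1 -law_sumZ;
  congr law_sum; apply/funext => x; rewrite mulr1. Qed.

Lemma eq_law_sum d f g : f =1 g -> law_sum d f = law_sum d g.
Proof. by move=> fg; rewrite /law_sum; apply: eq_bigr => e _; rewrite fg. Qed.

(** A conditional mean [e.2] at a child is seen from the parent as [t * e.2]. The factor
    [1 + t * e.2 * e'.2] is the joint density of the two branches against the product of their laws,
    obtained by averaging over the common spin. *)
Definition comb_law (t : R) d d' : seq (R * R) :=
  [seq (e.1 * e'.1 * (1 + t * e.2 * e'.2), mcomb (t * e.2) e'.2) | e <- d, e' <- d'].

Lemma law_sum_comb t d d' f : law_sum (comb_law t d d') f =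
  law_sum d (fun a => law_sum d' (fun b => (1 + t * a * b) * f (mcomb (t * a) b))).
Proof.
rewrite /law_sum /comb_law big_allpairs_dep; apply: eq_bigr => e _ /=.
by rewrite mulr_sumr; apply: eq_bigr => e' _ /=; ring.
Qed.

Section Comb.
Variables (t : R) (d d' : seq (R * R)).
Hypotheses (t0 : 0 <= t) (t1 : t < 1) (sd : symmetric_law d) (sd' : symmetric_law d').

Let tnorm a : `|a| <= 1 -> `|t * a| < 1.
Proof. by move=> a1; rewrite normrM ger0_norm//; apply: le_lt_trans t1;
  rewrite ler_piMr. Qed.

Lemma symmetric_comb_law : symmetric_law (comb_law t d d').
Proof.
have [d0 d1 ds] := sd; have [d'0 d'1 ds'] := sd'.
split.
- move=> _ /allpairsP[[e e'] /= [ed ed' ->]] /=.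
  have [e0 e1] := d0 _ ed; have [e'0 e'1] := d'0 _ ed'.
  have te := tnorm e1; split; last exact: mcomb_norm.
  by rewrite !mulr_ge0// ltW// mcomb_denom.
- rewrite law_sum_comb -[RHS]d1; apply: eq_bigr => e _; congr (_ * _).
  rewrite (eq_law_sum _ (g := fun b => 1 + t * e.2 * b)); last by move=> b;
    rewrite mulr1.
  rewrite law_sumD law_sumZ d'1 (law_sum_odd (f := id)) ?mulr0 ?addr0//.
- move=> f; rewrite !law_sum_comb ds; apply: eq_law_sum => a.
  rewrite ds'; apply: eq_law_sum => b.
  have -> : t * - a * - b = t * a * b by ring.
  by rewrite [t * - a]mulrN mcombN.
Qed.

Definition second_moment d := law_sum d (fun x => x ^+ 2).

(* The density factor [1 + xb] turns the second moment of [mcomb x b] into that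
   of [(x + b)^2 / (1 + xb)], which is expanded up to a remainder bounded by
   [(xb)^2 (1 + xb)]; the odd moments vanish by symmetry. *)
Lemma second_moment_comb : second_moment (comb_law t d d') <=
  t ^+ 2 * second_moment d + second_moment d' -
  t ^+ 2 * second_moment d * second_moment d'.
Proof.
rewrite /second_moment law_sum_comb.
pose f a b := (t * a) ^+ 2 + b ^+ 2 - (t * a) ^+ 2 * b ^+ 2 +
  (t * a) * (2 * b - b ^+ 3) + (t * a) ^+ 3 * (b ^+ 3 - b).
apply: (@le_trans _ _ (law_sum d (fun a => law_sum d' (f a)))).
  apply: (ler_law_sum sd) => a a1; apply: (ler_law_sum sd') => b b1.
  have ta := tnorm a1; have h := mcomb_denom ta b1; have := mcomb_sqr_le ta b1.
  rewrite /f /mcomb; set x := t * a in h *; move=> le.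
  have -> : (1 + x * b) * ((x + b) / (1 + x * b)) ^+ 2 =
    (x + b) ^+ 2 * (1 - x * b) + (x * b) ^+ 2 * ((x + b) ^+ 2 / (1 + x * b)).
    by field; rewrite gt_eqF.
  have {}le : (x + b) ^+ 2 / (1 + x * b) <= 1 + x * b.
    by rewrite ler_pdivrMr// -expr2.
  have := ler_wpM2l (sqr_ge0 (x * b)) le.
  by move=> {}le; apply: (le_trans (lerD (lexx _) le)); rewrite le_eqVlt;
    apply/orP; left; apply/eqP; ring.
rewrite le_eqVlt; apply/orP; left; apply/eqP.
have E1 a : law_sum d' (f a) = (t * a) ^+ 2 + law_sum d' (fun x => x ^+ 2) -
    (t * a) ^+ 2 * law_sum d' (fun x => x ^+ 2).
  have -> : law_sum d' (f a) = law_sum d' (fun b => (t * a) ^+ 2 + ((1 - (t *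
    a) ^+ 2) * b ^+ 2 +
     (t * a * (2 * b - b ^+ 3) + (t * a) ^+ 3 * (b ^+ 3 - b)))).
    by apply: eq_law_sum => b; rewrite /f; ring.
  rewrite !law_sumD (law_sum_cst _ sd') !law_sumZ.
  rewrite (law_sum_odd (f := fun b => 2 * b - b ^+ 3) sd'); last by move=> b; ring.
  by rewrite (law_sum_odd (f := fun b => b ^+ 3 - b) sd'); [ring|move=> b; ring].
rewrite (eq_law_sum _ (g := fun a => law_sum d' (fun x => x ^+ 2) +
  (t ^+ 2 * (1 - law_sum d' (fun x => x ^+ 2))) * a ^+ 2)); last first.
  by move=> a; rewrite E1; ring.
by rewrite law_sumD (law_sum_cst _ sd) law_sumZ; ring.
Qed.

End Comb.

Lemma second_moment_ge0 d : symmetric_law d -> 0 <= second_moment d.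
Proof.
by move=> sd; rewrite -[X in X <= _](law_sum_cst 0 sd);
  apply: ler_law_sum => // x _; exact: sqr_ge0.
Qed.

Lemma second_moment_le1 d : symmetric_law d -> second_moment d <= 1.
Proof.
move=> sd; rewrite -[X in _ <= X](law_sum_cst 1 sd); apply: ler_law_sum => // x x1.
by rewrite expr2; exact: sqr_le1_norm.
Qed.

(** A substitute for the Cauchy-Schwarz inequality: a second moment at most [e ^+ 2] bounds the
    first absolute moment by [2 * e]. *)
Lemma law_abs_le d (e : R) : symmetric_law d -> 0 < e ->
  law_sum d (fun x => `|x|) <= e + second_moment d / e.
Proof.
move=> sd e0; rewrite -[X in X + _](law_sum_cst e sd) /second_moment -law_sumZr
  -law_sumD.
apply: ler_law_sum => // x _.
have -> : e + x ^+ 2 / e = `|x| + ((e - `|x|) ^+ 2 + e * `|x|) / e.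
  rewrite -[x ^+ 2]real_normK ?num_real//; by field; rewrite gt_eqF.
by rewrite lerDl; apply: divr_ge0; [apply: addr_ge0;
  [exact: sqr_ge0|apply: mulr_ge0 => //; exact: ltW]|exact: ltW].
Qed.

(* Conductance attached to a second moment: [gcond] is subadditive under the
   combination of branches, and an edge acts on [1 / gcond] as a resistance in
   series followed by a rescaling. *)
Definition gcond m : R := 2 * m / (2 - m).

Definition hcond (c t x : R) : R := t ^+ 2 * x / (1 + c * x).

Lemma gcond_ge0 m : 0 <= m <= 1 -> 0 <= gcond m.
Proof. by move=> /andP[m0 m1]; rewrite /gcond divr_ge0 ?mulr_ge0//; lra. Qed.

Lemma gcond_le m m' : m <= m' -> m' <= 1 -> gcond m <= gcond m'.
Proof.
move=> mm' m1; rewrite /gcond.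
have h1 : 0 < 2 - m by lra.
have h2 : 0 < 2 - m' by lra.
by rewrite ler_pdivrMr// mulrAC ler_pdivlMr//; lra.
Qed.

(** After clearing denominators the difference is of third order in [a] and [b]: the second-order
    terms cancel, which is what the 2 in [gcond] is chosen for. *)
Lemma gcond_comb a b : 0 <= a <= 1 -> 0 <= b <= 1 ->
  gcond (a + b - a * b) <= gcond a + gcond b.
Proof.
move=> /andP[a0 a1] /andP[b0 b1]; rewrite /gcond.
have h1 : 0 < 2 - a by lra.
have h2 : 0 < 2 - b by lra.
have ab : 0 <= (1 - a) * (1 - b) by apply: mulr_ge0; lra.
have ab0 : 0 <= a * b by exact: mulr_ge0.
have ab1 : a * b <= a by exact: ler_piMr.
have h3 : 0 < 2 - (a + b - a * b) by lra.
rewrite addf_div ?gt_eqF// ler_pdivrMr// mulrAC ler_pdivlMr ?mulr_gt0//.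
rewrite -subr_ge0.
have -> : (2 * a * (2 - b) + 2 * b * (2 - a)) * (2 - (a + b - a * b)) -
   2 * (a + b - a * b) * ((2 - a) * (2 - b)) = 2 * (a * b) * (a + b - a * b) by ring.
by apply: mulr_ge0; lra.
Qed.

(** For nonzero [m] and [t], 1 / gcond m = 1 / m - 1/2, hence 1 / gcond (t^2 m) = t^-2 (1 / gcond m
    + (1 - t^2) / 2), and [c] is a lower bound for the last term. *)
Lemma gcond_edge (c t m : R) : 0 <= t -> 0 <= c -> 2 * c <= 1 - t ^+ 2 ->
  0 <= m <= 1 -> gcond (t ^+ 2 * m) <= hcond c t (gcond m).
Proof.
move=> t0 c0 ct /andP[m0 m1]; rewrite /gcond /hcond.
have h1 : 0 < 2 - m by lra.
have tt : 0 <= t ^+ 2 by exact: sqr_ge0.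
have cm0 : 0 <= c * m by exact: mulr_ge0.
have ctm : 0 <= (1 - t ^+ 2 - 2 * c) * m by apply: mulr_ge0; lra.
have h2 : 0 < 2 - m + c * (2 * m) by lra.
have -> : t ^+ 2 * (2 * m / (2 - m)) / (1 + c * (2 * m / (2 - m))) =
   2 * (t ^+ 2 * m) / (2 - m + c * (2 * m)).
  by field; rewrite !gt_eqF.
apply: ler_wpM2l; first by rewrite !mulr_ge0.
by rewrite lef_pV2 ?posrE//; lra.
Qed.

End FiniteLaws.

(** * Conditional means of spins given a far generation *)

Section Magnetization.
Variables (R : realType) (V : choiceType) (T : rooted_tree V).
Hypothesis lf : locally_finite T.
Variable th : V -> R.
Hypothesis th_root : th (tree_root T) = 0.
Hypothesis th_range : forall v, 0 <= th v < 1.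
Local Notation o := (tree_root T).
Local Notation p := (parent T).
Local Notation sp eta v := (spin R (eta v)).
Local Notation config := (V -> bool).
Implicit Types (u v w : V) (ws : seq V) (eta zeta : V -> bool) (k : nat).

Definition magn_list (mg : V -> config -> R) ws eta : R :=
  foldr (fun w a => mcomb (th w * mg w eta) a) 0 ws.

(* [magn k v] is the expectation of the spin at [v] given the spins of the
   descendants of [v] in generation [k]. *)
Fixpoint magn k v : config -> R :=
  if k is k'.+1 then magn_list (magn k') (chl T v) else fun eta => sp eta v.

Fixpoint law_list (lw : V -> seq (R * config)) (mg : V -> config -> R) ws :
    seq (R * config) :=
  if ws is w :: ws' then
    [seq (e.1 * e'.1 * (1 + th w * mg w e.2 * magn_list mg ws' e'.2),
          glue (subtree T w) e.2 e'.2) | e <- lw w, e' <- law_list lw mg ws']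
  else [:: (1, fun=> true)].

(* Weighted configurations representing the law of the spins of the
   descendants of [v] in generation [k]; the other spins are arbitrary. *)
Fixpoint law k v : seq (R * config) :=
  if k is k'.+1 then law_list (law k') (magn k') (chl T v)
  else [:: (2^-1, fun=> true); (2^-1, fun=> false)].

Definition siblings v ws := uniq ws /\ forall w, w \in ws -> children T v w.

Definition levels k ws : set V := [set u | exists2 w, w \in ws & level_set T k w u].

Lemma siblings_cons v w ws : siblings v (w :: ws) ->
  [/\ w \notin ws, children T v w & siblings v ws].
Proof.
move=> [/= /andP[wn us] h]; split => //; first by apply: h; rewrite inE eqxx.
by split => // u uws; apply: h; rewrite inE uws orbT.
Qed.

Lemma siblings_chl v : siblings v (chl T v).
Proof. by split; [exact: chl_uniq|move=> w /(chlP lf)]. Qed.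

Lemma levels_chl k v : levels k (chl T v) = level_set T k.+1 v.
Proof.
apply/seteqP; split => [u [w /(chlP lf) cw]|u /level_set_inv[w [cw wu]]].
  exact: level_set_child.
by exists w => //; exact/chlP.
Qed.

Lemma magn_list_dep k ws : (forall w, dep_on (level_set T k w) (magn k w)) ->
  dep_on (levels k ws) (magn_list (magn k) ws).
Proof.
move=> dm; elim: ws => // w ws IH x y xy; rewrite /= (dm w x y); last first.
  by move=> u wu; apply: xy; exists w => //; rewrite inE eqxx.
congr mcomb; apply: IH => u [w' ww' w'u]; apply: xy; exists w' => //.
by rewrite inE ww' orbT.
Qed.

Lemma magn_dep k v : dep_on (level_set T k v) (magn k v).
Proof.
elim: k v => [|k IH] v; first by rewrite level_set0; exact: dep_on_spin.
by rewrite -levels_chl; exact: magn_list_dep.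
Qed.

Lemma glue_level_in k w y z :
  magn k w (glue (subtree T w) y z) = magn k w y.
Proof. by apply: magn_dep => u /level_set_subtree wu; rewrite glue_in. Qed.

Lemma siblings_levels k v w ws u : siblings v (w :: ws) -> levels k ws u ->
  ~ subtree T w u.
Proof.
move=> /siblings_cons[wn cw [_ h]] [w' ww' /level_set_subtree w'u] wu.
by move: wn; rewrite (subtree_siblings cw (h _ ww') wu w'u) ww'.
Qed.

Lemma glue_level_out k v w ws y z : siblings v (w :: ws) ->
  magn_list (magn k) ws (glue (subtree T w) y z) = magn_list (magn k) ws z.
Proof.
move=> sw; apply: magn_list_dep => [w'|u lu]; first exact: magn_dep.
by rewrite glue_out//; exact: (siblings_levels sw lu).
Qed.

(** The moment estimates see only the law of the conditional mean, whereas [law_identity] needs the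
    whole configurations recorded in [law]. *)
Definition magn_law k v : seq (R * R) := [seq (e.1, magn k v e.2) | e <- law k v].

Definition magn_law_list k ws : seq (R * R) :=
  [seq (e.1, magn_list (magn k) ws e.2) | e <- law_list (law k) (magn k) ws].

Lemma magn_law_list_cons k v w ws : siblings v (w :: ws) ->
  magn_law_list k (w :: ws) = comb_law (th w) (magn_law k w) (magn_law_list k ws).
Proof.
move=> sw; rewrite /magn_law_list /= map_allpairs /comb_law.
rewrite allpairs_mapl allpairs_mapr; congr (flatten _).
apply: eq_map => e; apply: eq_map => e' /=.
by rewrite glue_level_in (glue_level_out _ _ _ sw).
Qed.

Lemma symmetric_magn_law_list k v ws : (forall w, symmetric_law (magn_law k w)) ->
  siblings v ws -> symmetric_law (magn_law_list k ws).
Proof.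
move=> sk; elim: ws => [|w ws IH] sw.
  split => [e|| f]; rewrite /magn_law_list /law_sum /= ?big_seq1 ?oppr0 ?mulr1//.
  by rewrite inE => /eqP -> /=; rewrite normr0; split; exact: ler01.
rewrite (magn_law_list_cons _ sw); have [_ _ sws] := siblings_cons sw.
have /andP[t0 t1] := th_range w.
by apply: symmetric_comb_law => //; exact: IH.
Qed.

Lemma symmetric_magn_law k v : symmetric_law (magn_law k v).
Proof.
elim: k v => [|k IH] v; last exact: (symmetric_magn_law_list IH (siblings_chl v)).
split => [e|| f]; rewrite /magn_law /law_sum /=.
- by rewrite !inE => /orP[]/eqP -> /=; rewrite ?normrN1 ?normr1 invr_ge0.
- by rewrite !big_cons big_nil /=; field.
- by rewrite !big_cons !big_nil /= !addr0 /spin opprK addrC.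
Qed.

Definition magn_moment k v : R := second_moment (magn_law k v).

Section Bound.
Variable c : R.
Hypotheses (c0 : 0 <= c) (ct : forall v, v != o -> 2 * c <= 1 - th v ^+ 2).

Lemma gcond_magn_list k v ws : siblings v ws ->
  gcond (second_moment (magn_law_list k ws)) <=
  \sum_(w <- ws) hcond c (th w) (gcond (magn_moment k w)).
Proof.
elim: ws => [|w ws IH] sw.
  have -> : second_moment (magn_law_list k [::]) = 0.
    by rewrite /second_moment /law_sum big_seq1 /= expr0n mulr0.
  by rewrite big_nil /gcond mulr0 mul0r.
have [_ cw sws] := siblings_cons sw; have /andP[t0 t1] := th_range w.
have sm := symmetric_magn_law k w.
have sl := symmetric_magn_law_list (symmetric_magn_law k) sws.
have m01 : 0 <= magn_moment k w <= 1.
  by rewrite second_moment_ge0//= second_moment_le1.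
have l0 := second_moment_ge0 sl; have l1 := second_moment_le1 sl.
have x0 : 0 <= th w ^+ 2 * magn_moment k w.
  by rewrite mulr_ge0 ?sqr_ge0//; case/andP : m01.
have x1 : th w ^+ 2 * magn_moment k w <= 1.
  by case/andP: m01 => ? ?; rewrite mulr_ile1 ?sqr_ge0// expr_le1// ltW.
rewrite big_cons (magn_law_list_cons _ sw).
apply: (@le_trans _ _ (gcond (th w ^+ 2 * magn_moment k w +
    second_moment (magn_law_list k ws) -
    th w ^+ 2 * magn_moment k w * second_moment (magn_law_list k ws)))).
  apply: gcond_le; first exact: second_moment_comb.
  set X := th w ^+ 2 * _ in x0 x1 *; set Y := second_moment _ in l0 l1 *.
  have : 0 <= (1 - X) * (1 - Y) by apply: mulr_ge0; lra.
  by rewrite mulrBl !mulrBr; lra.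
apply: (le_trans (gcond_comb _ _)); rewrite ?x0 ?l0//.
apply: lerD; last exact: IH.
by apply: gcond_edge => //; apply: ct; case: cw.
Qed.

Lemma gcond_magn_moment k v : gcond (magn_moment k.+1 v) <=
  \sum_(w <- chl T v) hcond c (th w) (gcond (magn_moment k w)).
Proof. exact: (gcond_magn_list _ (siblings_chl v)). Qed.

End Bound.

Variable P : probability (g_sigma_algebraType (@spin_events V setT)) R.
Hypothesis mP : markov T th P.

Lemma Ex_spin v : Ex P (fun eta => sp eta v) = 0.
Proof.
have h u : Ex P (fun eta => sp eta u) = th u * Ex P (fun eta => sp eta (p u)).
  have := mP (w := u) (cylfun_cst V (1 : R)) (@dep_on_cst _ _ _ _).
  by rewrite (eq_Ex P (G := fun eta => sp eta u)) ?(eq_Ex P (F := fun x => _ *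
    1) (G := fun eta => sp eta (p u)))//
    => eta; rewrite mulr1.
elim: (depth T v) {-2}v (erefl (depth T v)) => {v} [|n IH] v dv.
  by have -> : v = o; [have := iter_depth T v; rewrite dv|rewrite h th_root mul0r].
have [->|vo] := eqVneq v o; first by rewrite h th_root mul0r.
by rewrite h IH ?mulr0//; move: dv; rewrite depth_parent// => -[].
Qed.

Lemma ball_cover k v : level_set T k v `<=` [set` ball T k.+1 v].
Proof. by move=> u [vu du]; apply/(ballP lf); split => //; rewrite du; lia. Qed.

(* Bayes' rule: given generation [k] below [v], the law of the spins off the
   strict descendants of [v] has density [1 + eta v * magn k v]. *)
Definition law_identity k v := forall (E : seq V) (Phi : config -> config -> R),
  (forall z, dep_on (level_set T k v) (Phi^~ z)) ->
  (forall y, dep_on [set` E] (Phi y)) ->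
  (forall y, dep_on (~` strict_subtree T v) (Phi y)) ->
  Ex P (fun eta => Phi eta eta) = \sum_(e <- law k v) e.1 *
    Ex P (fun zeta => Phi e.2 zeta * (1 + sp zeta v * magn k v e.2)).

Lemma bm_linear_spin (F : config -> R) v (a : R) : cylfun F ->
  bmfun (fun zeta : g_sigma_algebraType (@spin_events V setT) => F zeta * (1 +
    sp zeta v * a)).
Proof.
move=> cF; apply: cylfun_bmT; apply: cylfunM => //; apply: cylfunD;
  first exact: cylfun_cst.
by apply: cylfunM; [exact: cylfun_spin|exact: cylfun_cst].
Qed.

(** Seen from the parent, a conditional mean at [w] is multiplied by [th w]. *)
Lemma markov_linear w (F : config -> R) (a : R) : cylfun F ->
  dep_on (~` subtree T w) F ->
  Ex P (fun zeta => F zeta * (1 + sp zeta w * a)) =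
  Ex P (fun zeta => F zeta * (1 + sp zeta (p w) * (th w * a))).
Proof.
move=> cF dF.
have cs u : cylfun (fun zeta => sp zeta u * F zeta) by apply: cylfunM => //;
  exact: cylfun_spin.
have E u b : Ex P (fun zeta => F zeta * (1 + sp zeta u * b)) =
    Ex P F + b * Ex P (fun zeta => sp zeta u * F zeta).
  rewrite -ExZ; last exact: cylfun_bmT.
  rewrite -ExD; [|exact: cylfun_bmT|].
    by apply: eq_Ex => z; ring.
  by apply: cylfun_bmT; apply: cylfunM => //; exact: cylfun_cst.
by rewrite !E mP//; ring.
Qed.

(** The branches are integrated out one by one. For the first branch, [Phi1] frees only the spins
    below [w]; its Bayes factor 1 + s x, with s the spin at [v], is then absorbed into [Phi2], to
    which the induction hypothesis applies. As s^2 = 1, the product (1 + s x)(1 + s b) equals (1 + x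
    b)(1 + s [mcomb x b]), which produces both the density in [law_list] and the new mean. *)
Lemma law_identity_list k v ws : (forall w, law_identity k w) -> siblings v ws ->
  forall (E : seq V) (Phi : config -> config -> R),
  (forall z, dep_on (levels k ws) (Phi^~ z)) ->
  (forall y, dep_on [set` E] (Phi y)) ->
  (forall y w, w \in ws -> dep_on (~` subtree T w) (Phi y)) ->
  Ex P (fun eta => Phi eta eta) =
  \sum_(e <- law_list (law k) (magn k) ws) e.1 *
    Ex P (fun zeta => Phi e.2 zeta * (1 + sp zeta v * magn_list (magn k) ws e.2)).
Proof.
move=> IHk; elim: ws => [|w ws IH] sw E Phi d1 dE d2.
  rewrite big_seq1 /= mul1r; apply: eq_Ex => z; rewrite mulr0 addr0 mulr1.
  by apply: d1 => u [].
have [wn cw sws] := siblings_cons sw; have pw : p w = v by case: cw.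
pose g y z := glue (subtree T w) y z.
(* [Phi1] also reads the generations below the remaining branches from its second argument, whence
   the larger list. *)
pose E' := E ++ flatten [seq ball T k.+1 w' | w' <- ws].
have lE' u : levels k ws u -> u \in E'.
  move=> [w' ww' w'u]; rewrite mem_cat; apply/orP; right; apply/flattenP.
  by exists (ball T k.+1 w'); [apply/mapP; exists w'|exact: ball_cover].
have lws u : levels k ws u -> levels k (w :: ws) u.
  by move=> [w' ww' ?]; exists w' => //; rewrite inE ww' orbT.
pose Phi1 y z := Phi (g y z) z.
have dPhi1E y : dep_on [set` E'] (Phi1 y).
  move=> a b ab; rewrite /Phi1 (dE _ a b); last by move=> u /= uE; apply: ab;
    rewrite /= mem_cat uE.
  apply: d1 => u [w']; rewrite inE => /orP[/eqP -> /level_set_subtree wu|ww' w'u].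
    by rewrite /g !glue_in.
  have lu : levels k ws u by exists w'.
  by rewrite /g !glue_out; [apply: ab; exact: lE'|exact: (siblings_levels sw lu)..].
have dPhi1w y : dep_on (~` subtree T w) (Phi1 y).
  move=> a b ab; rewrite /Phi1 (d2 _ w _ a b)// ?inE ?eqxx//.
  congr (Phi _ b); apply/funext => u; rewrite /g.
  by have [wu|wu] := pselect (subtree T w u);
    [rewrite !glue_in|rewrite !glue_out//; exact: ab].
have -> : Ex P (fun eta => Phi eta eta) = Ex P (fun eta => Phi1 eta eta).
  apply: eq_Ex => eta; rewrite /Phi1; congr (Phi _ eta); apply/funext => u; rewrite /g.
  by have [wu|wu] := pselect (subtree T w u); [rewrite glue_in|rewrite glue_out].
rewrite (IHk w E'); first last.
- by move=> y; apply: dep_onS (dPhi1w y) => u h /strict_subtree_sub.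
- exact: dPhi1E.
- move=> z a b ab; apply: d1 => u [w']; rewrite inE => /orP[/eqP -> wu|ww' w'u].
    by rewrite /g !glue_in; [exact: ab|exact: level_set_subtree wu..].
  by rewrite /g !glue_out//; apply: (siblings_levels sw (k := k)); exists w'.
rewrite /= big_allpairs_dep big_seq [RHS]big_seq; apply: eq_bigr => -[q y] yl /=.
have cPhi1 : cylfun (Phi1 y) by exact: fset_cylfun (dPhi1E y).
rewrite markov_linear// pw.
set x := th w * magn k w y.
pose Phi2 z zeta := Phi (g y z) zeta * (1 + sp zeta v * x).
have -> : Ex P (fun zeta => Phi1 y zeta * (1 + sp zeta v * x)) = Ex P (fun eta
  => Phi2 eta eta) by [].
rewrite (IH sws (v :: E) Phi2); first last.
- move=> z w' ww' a b ab; rewrite /Phi2 (d2 _ w' _ a b)// ?inE ?ww' ?orbT//.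
  rewrite (ab v)//; have [_ h] := sws; have [w'o <-] := h _ ww'.
  exact: parent_not_subtree.
- move=> z a b ab; rewrite /Phi2 (dE _ a b); last by move=> u /= uE; apply: ab;
  rewrite /= inE uE orbT.
  by rewrite (ab v)//= inE eqxx.
- move=> zeta a b ab; rewrite /Phi2; congr (_ * _); apply: d1 => u [w'].
  rewrite inE => /orP[/eqP -> /level_set_subtree wu|ww' w'u].
    by rewrite /g !glue_in.
  have lu : levels k ws u by exists w'.
  by rewrite /g !glue_out; [exact: ab|exact: (siblings_levels sw lu)..].
rewrite mulr_sumr big_seq [RHS]big_seq; apply: eq_bigr => -[q' z] zl /=.
rewrite glue_level_in (glue_level_out _ _ _ sw) -/x.
set b := magn_list (magn k) ws z.
have b1 : `|b| <= 1.
  have [h _ _] := symmetric_magn_law_list (symmetric_magn_law k) sws.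
  by have [] := h (q', b) (map_f _ zl).
have y1 : `|x| < 1.
  have [h _ _] := symmetric_magn_law k w; have /andP[t0 t1] := th_range w.
  have [_ /= h1] := h (q, magn k w y) (map_f _ yl).
  by rewrite normrM ger0_norm//; apply: le_lt_trans t1; rewrite ler_piMr.
have xb := mcomb_denom y1 b1.
rewrite -[RHS]mulrA -[RHS]mulrA; congr (q * (q' * _)).
rewrite -ExZ; last by apply: bm_linear_spin; exact: fset_cylfun (dE _).
apply: eq_Ex => zeta; rewrite /Phi2 /mcomb.
have ss := spin_sqr R (zeta v).
have -> : (1 + x * b) * (Phi (g y z) zeta * (1 + sp zeta v * ((x + b) / (1 + x * b)))) =
  Phi (g y z) zeta * (1 + x * b + sp zeta v * (x + b)) by field; rewrite gt_eqF.
have -> : Phi (g y z) zeta * (1 + sp zeta v * x) * (1 + sp zeta v * b) =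
  Phi (g y z) zeta * (1 + (sp zeta v * sp zeta v) * (x * b) + sp zeta v * (x +
    b)) by ring.
by rewrite ss mul1r.
Qed.

Lemma law_identityP k v : law_identity k v.
Proof.
elim: k v => [|k IH] v E Phi d1 dE d2.
  rewrite /= !big_cons big_nil addr0 /=.
  have bm y a : bmfun (fun zeta : g_sigma_algebraType (@spin_events V setT) =>
    Phi y zeta * (1 + sp zeta v * a)).
    by apply: bm_linear_spin; exact: fset_cylfun (dE y).
  rewrite -!ExZ// -ExD; [|apply: bmfunM (bmfun_cst _ _) (bm _ _)..].
  apply: eq_Ex => eta.
  have e b : eta v = b -> Phi eta eta = Phi (fun=> b) eta.
    by move=> ev; apply: d1 => u; rewrite level_set0 => ->.
  by case ev : (eta v); rewrite (e _ ev) /spin; field.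
rewrite (law_identity_list IH (siblings_chl v) (E := E))//.
- by move=> z; rewrite levels_chl.
- move=> y w /(chlP lf) cw; apply: dep_onS (d2 y) => u h.
  by move=> /= wu; apply: h; exact: child_strict_subtree wu.
Qed.

End Magnetization.

(** * Flows and capacity *)

Section Paths.
Variables (V : choiceType) (T : rooted_tree V).
Local Notation o := (tree_root T).
Local Notation p := (parent T).
Hypothesis has_child : forall v, children T v !=set0.

Lemma boundary_through v : exists2 y, tree_boundary T y & y (depth T v) = v.
Proof.
have [s hs] : exists s : V -> V, forall u, children T u (s u).
  by exists (fun u => projT1 (cid (has_child u))) => u;
    exact: (projT2 (cid (has_child u))).
pose d := depth T v.
exists (fun n => if (n <= d)%N then iter (d - n) p v else iter (n - d) s v);
  last by rewrite leqnn subnn.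
split; first by rewrite leq0n subn0 iter_depth.
move=> n; have [nd|dn] := ltnP n d.
  rewrite (ltnW nd); split; last by rewrite -iterS; congr (iter _ p v); lia.
  apply/eqP => e; have : (depth T v <= d - n.+1)%N by apply: depth_le.
  by rewrite -/d; lia.
have -> : (if (n <= d)%N then iter (d - n) p v else iter (n - d) s v) = iter (n
  - d) s v.
  case: ifP => // nd; have -> : n = d by lia.
  by rewrite subnn.
by rewrite subSn //=; exact: hs.
Qed.

End Paths.

Section Flows.
Variables (R : realType) (V : choiceType) (T : rooted_tree V).
Hypothesis lf : locally_finite T.
Hypothesis has_child : forall v, children T v !=set0.
Local Notation o := (tree_root T).
Local Notation p := (parent T).
Variable res : V -> R.
Hypothesis res_gt0 : forall v, 0 < res v.
Implicit Types (f : V -> R) (y : nat -> V).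

Lemma children_sumE f v : \sum_(y \in children T v) f y = \sum_(y <- chl T v) f y.
Proof. by rewrite fsbig_finite//; exact: lf. Qed.

Lemma flow_ge0 f : is_flow T f -> forall w, w != o -> 0 <= f w.
Proof. by case. Qed.

Lemma path_potentialE f y : is_flow T f -> tree_boundary T y ->
  path_potential 2 res f y = (\sum_(0 <= n <oo) (f (y n.+1) * res (y n.+1))%:E)%E.
Proof.
move=> [f0 _] [_ cy]; apply: eq_eseriesr => n _.
have -> : 2 - 1 = 1 :> R by ring.
by rewrite powRr1// mulr_ge0 ?(ltW (res_gt0 _))// f0//; case: (cy n).
Qed.

Lemma path_term_ge0 f y n : is_flow T f -> tree_boundary T y ->
  (0 <= (f (y n.+1) * res (y n.+1))%:E)%E.
Proof.
move=> [f0 _] [_ cy]; rewrite lee_fin mulr_ge0 ?(ltW (res_gt0 _))// f0//.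
by case: (cy n).
Qed.

Lemma path_sum_le_potential f y N : is_flow T f -> tree_boundary T y ->
  ((\sum_(0 <= n < N) f (y n.+1) * res (y n.+1))%:E <= potential T 2 res f)%E.
Proof.
move=> ff ty; apply: (@le_trans _ _ (path_potential 2 res f y)); last first.
  by apply: ereal_sup_ubound; exists y.
rewrite path_potentialE// -sumEFin.
by apply: nneseries_lim_ge => n _ _; exact: path_term_ge0.
Qed.

Lemma capacity_neq0_flow : capacity T 2 res <> 0%E ->
  exists2 f, is_flow T f /\ potential T 2 res f = 1%E & 0 < flow_strength T f.
Proof.
rewrite /capacity; case: ifPn => // /set0P ne0 sup0.
apply: contrapT => H; apply: sup0.
have all0 : unit_flow_strengths T 2 res `<=` [set 0%E].
  move=> _ [g [fg pg] <-] /=; congr (_%:E); apply/eqP; rewrite eq_le.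
  apply/andP; split; last first.
    rewrite /flow_strength children_sumE big_seq;
      apply: sumr_ge0 => w /(chlP lf) [wo _].
    exact: flow_ge0.
  by rewrite leNgt; apply/negP => g0; apply: H; exists g.
have -> : unit_flow_strengths T 2 res = [set 0%E].
  apply/seteqP; split => // x ->; have [z hz] := ne0.
  by rewrite -(all0 _ hz).
by rewrite ereal_sup1.
Qed.

(** The flow is divided by its potential. That is finite by the bound [B], and positive because some
    edge at the root carries flow and lies on an infinite path. *)
Lemma capacity_neq0 f (B : R) : is_flow T f -> 0 < flow_strength T f ->
  (forall y, tree_boundary T y -> forall N,
    \sum_(0 <= n < N) f (y n.+1) * res (y n.+1) <= B) ->
  capacity T 2 res <> 0%E.
Proof.
move=> ff f0 fB.
have potB : (potential T 2 res f <= B%:E)%E.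
  apply: ge_ereal_sup => _ [y ty <-]; rewrite path_potentialE//.
  apply: lime_le; first by apply: is_cvg_nneseries => n _ _; exact: path_term_ge0.
  by near=> n; rewrite sumEFin lee_fin; exact: fB.
have [w cw fw] : exists2 w, children T o w & 0 < f w.
  apply: contrapT => H; move: f0; rewrite /flow_strength children_sumE.
  rewrite big1_seq ?ltxx// => w /andP[_ /(chlP lf) cw].
  apply/eqP; rewrite eq_le flow_ge0//; last by case: cw.
  by rewrite andbT leNgt; apply/negP => fw; apply: H; exists w.
have pot0 : (0 < potential T 2 res f)%E.
  have [y ty yw] := boundary_through has_child w.
  have dw : depth T w = 1%N by rewrite (depth_child cw) depth_root.
  apply: lt_le_trans (path_sum_le_potential 1 ff ty).
  by rewrite lte_fin big_nat1 -dw yw mulr_gt0.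
have /fineK potE : potential T 2 res f \is a fin_num.
  by rewrite ge0_fin_numE ?(ltW pot0)// (le_lt_trans potB)// ltry.
set W := fine _ in potE; have W0 : 0 < W by rewrite -lte_fin potE.
pose g v := W^-1 * f v.
have fg : is_flow T g.
  split => [v vo|v vo cv]; first by rewrite /g mulr_ge0 ?invr_ge0 ?(ltW W0)// flow_ge0.
  by rewrite /g (ff.2 v)// !children_sumE mulr_sumr.
have pg : potential T 2 res g = 1%E.
  have -> : potential T 2 res g = (W^-1%:E * potential T 2 res f)%E.
    rewrite -ereal_sup_pZl ?invr_gt0//; congr ereal_sup; apply/seteqP; split.
      move=> _ [y ty <-]; exists (path_potential 2 res f y); first by exists y.
      rewrite !path_potentialE// -nneseriesZl; last by move=> n _; exact: path_term_ge0.
      by apply: eq_eseriesr => n _; rewrite -EFinM mulrA.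
    move=> _ [_ [y ty <-] <-]; exists y => //.
    rewrite !path_potentialE// -nneseriesZl; last by move=> n _; exact: path_term_ge0.
    by apply: eq_eseriesr => n _; rewrite -EFinM mulrA.
  by rewrite -potE -EFinM mulVf// gt_eqF.
have sg : flow_strength T g = W^-1 * flow_strength T f.
  by rewrite /flow_strength !children_sumE mulr_sumr.
have mem : unit_flow_strengths T 2 res (flow_strength T g)%:E by exists g.
rewrite /capacity ifF; last by apply/negbTE/set0P; exists (flow_strength T g)%:E.
apply/eqP; rewrite gt_eqF//; apply: lt_le_trans (ereal_sup_ubound mem).
by rewrite lte_fin sg mulr_gt0// invr_gt0.
Unshelve. all: by end_near. Qed.

End Flows.

Section Resistance.
Variables (R : realType) (V : choiceType) (T : rooted_tree V).
Variables (beta : R) (J : V -> R).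
Local Notation o := (tree_root T).
Local Notation p := (parent T).
Local Notation th := (theta T beta J).

Let anc w : set V := [set y | tree_lt T o y /\ tree_le T y w].

Let anc_root : anc o = set0.
Proof.
rewrite -subset0 => y [[_ yo] /tree_leP[yo'|[]]]; first by apply: yo.
by rewrite eqxx.
Qed.

Let anc_child w : w != o -> anc w = [set w] `|` anc (p w).
Proof.
move=> wo; apply/seteqP; split => [y [oy /tree_leP[->|[_ yw]]]|y [->|[oy yw]]].
- by left.
- by right.
- by split; [split; [exact: tree_le_root|move=> e;
  rewrite -e eqxx in wo]|exact: tree_le_refl].
- by split => //; exact: tree_le_trans yw (tree_le_parent T w).
Qed.

Lemma finite_anc w : finite_set (anc w).
Proof.
elim: (depth T w) {-2}w (erefl (depth T w)) => {w} [|n IH] w dw.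
  have -> : w = o by have := iter_depth T w; rewrite dw.
  by rewrite anc_root.
have [->|wo] := eqVneq w o; first by rewrite anc_root.
by rewrite anc_child// finite_setU; split; [exact: finite_set1|apply: IH;
  move: dw; rewrite depth_parent// => -[]].
Qed.

Lemma resistance_root : resistance T beta J o = 1.
Proof. by rewrite /resistance -/(anc o) anc_root fsbig_set0. Qed.

Lemma resistance_child w : w != o ->
  resistance T beta J w = (th w) ^- 2 * resistance T beta J (p w).
Proof.
move=> wo; rewrite /resistance -/(anc w) -/(anc (p w)) anc_child// fsbigU0.
- by rewrite fsbig_set1 /theta (negbTE wo).
- exact: finite_set1.
- exact: finite_anc.
- move=> _ [-> [_ /tree_le_depth]]; rewrite (depth_parent wo); lia.
Qed.

Lemma resistance_gt0 : (forall w, w != o -> th w != 0) ->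
  forall w, 0 < resistance T beta J w.
Proof.
move=> th0 w; elim: (depth T w) {-2}w (erefl (depth T w)) => {w} [|n IH] w dw.
  have -> : w = o by have := iter_depth T w; rewrite dw.
  by rewrite resistance_root.
have [->|wo] := eqVneq w o; first by rewrite resistance_root.
rewrite resistance_child// mulr_gt0 ?invr_gt0 ?exprn_even_gt0 ?th0//.
by apply: IH; move: dw; rewrite depth_parent// => -[].
Qed.

End Resistance.

(** * Effective conductances and the flow they define *)

Section Conductance.
Variables (R : realType) (V : choiceType) (T : rooted_tree V).
Hypothesis lf : locally_finite T.
Hypothesis has_child : forall v, children T v !=set0.
Local Notation o := (tree_root T).
Local Notation p := (parent T).
Variables (th res : V -> R) (c : R).
Hypothesis th_gt0 : forall w, w != o -> 0 < th w.
Hypothesis res_gt0 : forall v, 0 < res v.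
Hypothesis res_child : forall w, w != o -> res w = th w ^- 2 * res (p w).
Hypothesis c_gt0 : 0 < c.
Local Notation h := (hcond c).

(* Effective conductance from [v] to its descendants in generation [k.+1], all
   resistances being rescaled by [c] and by the resistance of the edge above
   [v]. *)
Fixpoint cond k v : R :=
  if k is k'.+1 then \sum_(w <- chl T v) h (th w) (cond k' w)
  else \sum_(w <- chl T v) th w ^+ 2 / c.

Lemma hcond_denom x : 0 <= x -> 0 < 1 + c * x.
Proof. by move=> x0; rewrite ltr_pwDl// mulr_ge0// ltW. Qed.

Lemma hcond_ge0 t x : 0 <= x -> 0 <= h t x.
Proof.
move=> x0; apply: divr_ge0; last exact/ltW/hcond_denom.
by apply: mulr_ge0 => //; exact: sqr_ge0.
Qed.

Lemma hcond_le t x y : 0 <= x -> x <= y -> h t x <= h t y.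
Proof.
move=> x0 xy; have y0 := le_trans x0 xy.
have hx := hcond_denom x0; have hy := hcond_denom y0.
rewrite /hcond ler_pdivrMr// [leRHS]mulrAC ler_pdivlMr// -subr_ge0.
have -> : t ^+ 2 * y * (1 + c * x) - t ^+ 2 * x * (1 + c * y) = t ^+ 2 * (y -
  x) by ring.
by rewrite mulr_ge0 ?sqr_ge0// subr_ge0.
Qed.

(** The bound is the limit of [hcond] at infinite conductance, and it is the summand in [cond 0];
    this makes [cond] start above all later values. *)
Lemma hcond_bound t x : 0 <= x -> h t x <= t ^+ 2 / c.
Proof.
move=> x0; have hx := hcond_denom x0.
rewrite /hcond ler_pdivrMr// [leRHS]mulrAC ler_pdivlMr// -subr_ge0.
have -> : t ^+ 2 * (1 + c * x) - t ^+ 2 * x * c = t ^+ 2 by ring.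
exact: sqr_ge0.
Qed.

Lemma cond_ge0 k v : 0 <= cond k v.
Proof.
elim: k v => [|k IH] v /=; apply: sumr_ge0 => w _; last exact: hcond_ge0.
by rewrite divr_ge0 ?sqr_ge0// ltW.
Qed.

Lemma cond_decr v : nonincreasing_seq (cond^~ v).
Proof.
apply/nonincreasing_seqP => k; elim: k v => [|k IH] v; apply: ler_sum => w _.
  exact/hcond_bound/(cond_ge0 0).
by apply: hcond_le; [exact: (cond_ge0 k.+1)|exact: IH].
Qed.

Definition cond_lim v : R := limn (cond^~ v).

Lemma cond_cvg v : cond^~ v @ \oo --> cond_lim v.
Proof.
apply: (nonincreasing_is_cvgn (cond_decr v)).
by exists 0 => _ [k _ <-] /=; exact: cond_ge0.
Qed.

Lemma cond_lim_ge0 v : 0 <= cond_lim v.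
Proof.
by apply: limr_ge; [apply: cvgP; exact: cond_cvg|apply: nearW => k; exact: cond_ge0].
Qed.

Lemma cond_lim_rec v : cond_lim v = \sum_(w <- chl T v) h (th w) (cond_lim w).
Proof.
have c1 : (fun k => cond k.+1 v) @ \oo --> cond_lim v.
  by have := @cond_cvg v; rewrite -cvg_shiftS.
suff c2 : (fun k => cond k.+1 v) @ \oo -->
    \sum_(w <- chl T v) h (th w) (cond_lim w).
  exact: (cvg_unique _ c1 c2).
rewrite /=; elim: (chl T v) => [|w ws IH].
  by rewrite big_nil; under eq_fun do rewrite big_nil; exact: cvg_cst.
rewrite big_cons; under eq_fun do rewrite big_cons; apply: cvgD => //.
rewrite /hcond; apply: cvgM.
  by apply: cvgM; [exact: cvg_cst|exact: cond_cvg].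
apply: cvgV; first by rewrite gt_eqF// hcond_denom// cond_lim_ge0.
apply: cvgD; first exact: cvg_cst.
by apply: cvgM; [exact: cvg_cst|exact: cond_cvg].
Qed.

Lemma cond_lim_root v : 0 < cond_lim v -> 0 < cond_lim o.
Proof.
elim: (depth T v) {-2}v (erefl (depth T v)) => {v} [|n IH] v dv.
  by have -> : v = o by have := iter_depth T v; rewrite dv.
have [->//|vo] := eqVneq v o; move=> cv.
apply: (IH (p v)); first by move: dv; rewrite depth_parent// => -[].
have cvw : v \in chl T (p v) by exact/(chlP lf).
rewrite cond_lim_rec (big_rem v cvw)/= ltr_pwDl//.
  rewrite /hcond divr_gt0 ?hcond_denom ?(ltW cv)// mulr_gt0// exprn_gt0//.
  exact: th_gt0.
by apply: sumr_ge0 => w _; apply: hcond_ge0; exact: cond_lim_ge0.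
Qed.

(* Each vertex divides the flow among its children in proportion to their
   limiting conductances. *)
Definition cond_flow v : R := \prod_(i < depth T v)
  (h (th (iter i p v)) (cond_lim (iter i p v)) / cond_lim (iter i.+1 p v)).

Lemma cond_flow_root : cond_flow o = 1.
Proof. by rewrite /cond_flow depth_root big_ord0. Qed.

Lemma cond_flow_child w : w != o ->
  cond_flow w = h (th w) (cond_lim w) / cond_lim (p w) * cond_flow (p w).
Proof.
move=> wo; rewrite /cond_flow depth_parent// big_ord_recl /=; congr (_ * _).
by apply: eq_bigr => i _; rewrite -[iter i p (p w)]iterSr.
Qed.

Lemma cond_flow_ge0 v : 0 <= cond_flow v.
Proof.
apply: prodr_ge0 => i _; rewrite divr_ge0 ?hcond_ge0//; exact: cond_lim_ge0.
Qed.

(** The quotient [cond_lim v / cond_lim v] is 1, or 0 when the conductance vanishes, which covers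
    both cases at once. In the second case the flow into a vertex other than the root is 0 as
    well. *)
Lemma cond_flow_sum v : \sum_(w <- chl T v) cond_flow w =
  cond_lim v / cond_lim v * cond_flow v.
Proof.
rewrite {1}cond_lim_rec !mulr_suml !big_seq; apply: eq_bigr => w /(chlP lf) [wo pw].
by rewrite cond_flow_child// pw.
Qed.

Lemma cond_flow_is_flow : is_flow T cond_flow.
Proof.
split=> [v _|v vo _]; first exact: cond_flow_ge0.
rewrite (children_sumE lf) cond_flow_sum.
have [c0|c0] := eqVneq (cond_lim v) 0; last by rewrite divff// mul1r.
by rewrite c0 mul0r mul0r cond_flow_child// c0 /hcond mulr0 !mul0r.
Qed.

(** Ohm's law: flow times resistance divided by conductance is the voltage at a vertex, and the edge
    above [w] costs [c] times its flow times its resistance. There is equality unless [cond_lim w]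
    is 0, when no flow passes through [w]. Along a path the drops telescope below the voltage of the
    root. *)
Lemma cond_flow_voltage w : w != o ->
  cond_flow w * res w / cond_lim w + c * (cond_flow w * res w) <=
  cond_flow (p w) * res (p w) / cond_lim (p w).
Proof.
move=> wo; have cw0 := cond_lim_ge0 w.
have [cw|cw] := eqVneq (cond_lim w) 0.
  rewrite cond_flow_child// cw /hcond mulr0 !mul0r mulr0 addr0.
  by rewrite divr_ge0 ?mulr_ge0 ?cond_flow_ge0 ?(ltW (res_gt0 _)) ?cond_lim_ge0.
rewrite le_eqVlt; apply/orP; left; apply/eqP.
rewrite cond_flow_child// res_child// /hcond.
set a := cond_flow _; set r := res _; set x := (cond_lim (p w))^-1.
have d0 : 1 + c * cond_lim w != 0 by rewrite gt_eqF// hcond_denom.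
have t0 : th w != 0 by rewrite gt_eqF// th_gt0.
by field; rewrite d0 cw t0.
Qed.

Lemma cond_flow_potential y N : tree_boundary T y ->
  \sum_(0 <= n < N) cond_flow (y n.+1) * res (y n.+1) <=
  res o / cond_lim o / c.
Proof.
move=> [y0 cy]; rewrite ler_pdivlMr// mulrC.
suff : c * (\sum_(0 <= n < N) cond_flow (y n.+1) * res (y n.+1)) +
    cond_flow (y N) * res (y N) / cond_lim (y N) <= res o / cond_lim o.
  apply: le_trans; rewrite lerDl divr_ge0 ?mulr_ge0 ?cond_flow_ge0 ?cond_lim_ge0//.
  exact/ltW.
elim: N => [|N IH]; first by rewrite big_nil mulr0 add0r y0 cond_flow_root mul1r.
apply: le_trans IH; rewrite big_nat_recr//= mulrDr -addrA lerD2l addrC.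
have [yo py] := cy N; have := cond_flow_voltage yo.
by rewrite py.
Qed.

Lemma cond_lim_capacity v : 0 < cond_lim v -> capacity T 2 res <> 0%E.
Proof.
move=> /cond_lim_root co.
apply: (capacity_neq0 lf has_child res_gt0 cond_flow_is_flow (B := res o /
  cond_lim o / c)).
  by rewrite /flow_strength (children_sumE lf) cond_flow_sum divff ?gt_eqF//
    mul1r cond_flow_root.
by move=> y ty N; exact: cond_flow_potential.
Qed.

End Conductance.

(** * Capacity zero *)

Section Extremality.
Variables (R : realType) (V : choiceType) (T : rooted_tree V).
Hypothesis lf : locally_finite T.
Hypothesis has_child : forall v, children T v !=set0.
Local Notation o := (tree_root T).
Local Notation p := (parent T).
Local Notation sp eta v := (spin R (eta v)).
Variables (beta : R) (J : V -> R) (t : R).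
Local Notation th := (theta T beta J).
Hypothesis th_gt0 : forall w, w != o -> 0 < th w.
Hypothesis th_le : forall w, th w <= t.
Hypothesis t_lt1 : t < 1.
Implicit Types (P mu : probability (config V) R) (k : nat) (v : V).

Lemma theta_range v : 0 <= th v < 1.
Proof.
rewrite (le_lt_trans (th_le v) t_lt1) andbT.
by have [->|/th_gt0/ltW//] := eqVneq v o; rewrite theta_root.
Qed.

(** The resistance gained per edge, as [gcond_edge] allows it at every vertex. It is positive
    because [t] is below 1; in the theorem [t] is the tanh of [beta * Jmax]. *)
Let c : R := (1 - t ^+ 2) / 2.

Let t_ge0 : 0 <= t. Proof. by rewrite -(theta_root T beta J). Qed.

Let c_gt0 : 0 < c.
Proof. by rewrite /c divr_gt0// subr_gt0 expr_lt1. Qed.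

Let c_le v : v != o -> 2 * c <= 1 - th v ^+ 2.
Proof.
move=> _; rewrite /c mulrC divfK// lerD2l lerN2 lerXn2r ?nnegrE//.
by case/andP : (theta_range v).
Qed.

Let m01 k v : 0 <= magn_moment T th k v <= 1.
Proof.
have s := symmetric_magn_law lf theta_range k v.
by rewrite second_moment_ge0//= second_moment_le1.
Qed.

Lemma magn_moment_cond k v :
  gcond (magn_moment T th k.+1 v) <= cond T th c k v.
Proof.
elim: k v => [|k IH] v;
  apply: (le_trans (gcond_magn_moment lf theta_range (ltW c_gt0) c_le _ _));
  apply: ler_sum => w _.
  by apply: (hcond_bound c_gt0); exact: gcond_ge0.
by apply: (hcond_le c_gt0); [exact: gcond_ge0|exact: IH].
Qed.

Lemma magn_moment_small : capacity T 2 (resistance T beta J) = 0%E ->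
  forall v e, 0 < e -> exists k, magn_moment T th k.+1 v < e.
Proof.
move=> cap0 v e e0.
have th0 w : w != o -> th w != 0 by move=> /th_gt0; rewrite lt0r => /andP[].
have l0 : cond_lim T th c v = 0.
  apply/eqP; rewrite eq_le cond_lim_ge0// andbT leNgt; apply/negP => lv.
  apply: (cond_lim_capacity lf has_child th_gt0 _ _ c_gt0 lv cap0).
    exact: resistance_gt0.
  exact: resistance_child.
have := @cond_cvg _ _ T th c c_gt0 v; rewrite l0 => /cvgrPdist_lt/(_ _ e0)[k _ /(_ k)].
rewrite /= leqnn => /(_ isT); rewrite sub0r normrN ger0_norm ?cond_ge0// => ck.
exists k; apply: le_lt_trans ck; apply: le_trans (magn_moment_cond k v).
(* A moment [m] is at most [gcond m], because [2 - m] is at most 2. *)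
have /andP[m0 m1] := m01 k.+1 v; rewrite /gcond ler_pdivlMr; last by lra.
by rewrite mulrC ler_wpM2r//; lra.
Qed.

Lemma Ex_norm_le P F (C : R) : bmfun F -> (forall x, `|F x| <= C) -> `|Ex P F| <= C.
Proof.
move=> bF FC; apply: (le_trans (norm_Ex P bF)); rewrite -[leRHS](Ex_cst P).
by apply: le_Ex => //; [exact: bmfun_norm|exact: bmfun_cst].
Qed.

Lemma dep_parent_spin v : dep_on (~` subtree T v) (fun eta => th v * sp eta (p v)).
Proof.
have [->|vo] := eqVneq v o; first by move=> x y _; rewrite theta_root !mul0r.
by move=> x y xy; rewrite (xy (p v))//; exact: parent_not_subtree.
Qed.

Let cpar v : cylfun (fun eta => th v * sp eta (p v)).
Proof. by apply: cylfunM; [exact: cylfun_cst|exact: cylfun_spin]. Qed.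

(** Once generation [k] below [v] is frozen to [y], what remains of [S] depends on the spins off the
    subtree, so its product with the innovation has mean 0 by [markov]. In the Bayes factor 1 + s
    [magn k v y], with s the spin at [v], only the second term contributes, which leaves twice the
    mean of the norm of [magn]; then [law_abs_le] applies. *)
Lemma spin_innovation_le mu v k S e : markov T th mu -> 0 < e -> cylfun S ->
  dep_on (level_set T k v `|` ~` subtree T v) S -> (forall x, `|S x| <= 1) ->
  Ex mu (fun eta => (sp eta v - th v * sp eta (p v)) * S eta) <=
  2 * (e + magn_moment T th k v / e).
Proof.
move=> mP e0 [D dS] dS' S1.
pose Sy y z := S (glue (subtree T v) y z).
pose inn (z : V -> bool) := sp z v - th v * sp z (p v).
have dSy y : dep_on (~` subtree T v) (Sy y).
  move=> a b ab; congr S; apply/funext => u.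
  by have [vu|vu] := pselect (subtree T v u);
    [rewrite !glue_in|rewrite !glue_out//; exact: ab].
have dSyD y : dep_on [set` enum_fset D] (Sy y).
  move=> a b ab; apply: dS => u uD.
  by have [vu|vu] := pselect (subtree T v u);
    [rewrite !glue_in|rewrite !glue_out//; exact: ab].
have cSy y : cylfun (Sy y) by exact: fset_cylfun (dSyD y).
have cinn : cylfun inn by apply: cylfunB; [exact: cylfun_spin|exact: cpar].
have inn2 z : `|inn z| <= 2.
  rewrite /inn (le_trans (ler_normB _ _))// spin_norm normrM spin_norm mulr1.
  have /andP[t0 t1] := theta_range v; rewrite ger0_norm//; lra.
pose Phi y z := Sy y z * inn z.
have -> : Ex mu (fun eta => (sp eta v - th v * sp eta (p v)) * S eta) =
    Ex mu (fun eta => Phi eta eta).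
  apply: eq_Ex => eta; rewrite mulrC /Phi /Sy; congr (S _ * _); apply/funext => u.
  by have [vu|vu] := pselect (subtree T v u); [rewrite glue_in|rewrite glue_out].
rewrite (law_identityP lf theta_range mP (k := k) (v := v) (E := v :: p v ::
  enum_fset D)); first last.
- move=> y a b ab; rewrite /Phi (dSy y a b); last first.
    by move=> u nu; apply: ab => vu; apply: nu; exact: strict_subtree_sub.
  congr (_ * _); rewrite /inn (ab v) /=; last by case=> _; apply.
  have [->|vo] := eqVneq v o; first by rewrite theta_root !mul0r.
  by rewrite (ab (p v))//= => /strict_subtree_sub; exact: parent_not_subtree.
- move=> y a b ab; rewrite /Phi (dSyD y a b); last first.
    by move=> u /= uD; apply: ab; rewrite /= !inE uD !orbT.
  by rewrite /inn !ab//= !inE eqxx ?orbT.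
- move=> z a b ab; congr (_ * _); apply: dS' => u [lu|nu].
    by rewrite !glue_in//; [exact: ab|exact: level_set_subtree lu..].
  by rewrite !glue_out.
have bPhi y : bmfun (fun z : config V => Phi y z).
  by apply: cylfun_bmT; exact: cylfunM.
have bPhi' y : bmfun (fun z : config V => sp z v * Phi y z).
  by apply: cylfun_bmT; apply: cylfunM; [exact: cylfun_spin|exact: cylfunM].
have EPhi0 y : Ex mu (Phi y) = 0.
  rewrite (eq_Ex mu (G := fun z => sp z v * Sy y z - th v * (sp z (p v) * Sy y
    z))); last first.
    by move=> z; rewrite /Phi /inn; ring.
  have cs u : cylfun (fun z => sp z u * Sy y z) by apply: cylfunM => //;
    exact: cylfun_spin.
  rewrite ExB ?ExZ ?(mP _ _ (cSy y) (dSy y)) ?subrr//; try exact: cylfun_bmT.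
  by apply: cylfun_bmT; apply: cylfunM => //; exact: cylfun_cst.
have s := symmetric_magn_law lf theta_range k v.
have := law_abs_le s e0; rewrite -/(magn_moment T th k v) => le.
apply: (@le_trans _ _ (2 * law_sum (magn_law T th k v) (fun x => `|x|))); last first.
  by rewrite ler_wpM2l.
rewrite /law_sum /magn_law big_map mulr_sumr big_seq [leRHS]big_seq.
apply: ler_sum => -[q y] yl /=.
have q0 : 0 <= q by have [h _ _] := s; have [] := h _ (map_f _ yl).
rewrite mulrCA ler_wpM2l//.
rewrite (eq_Ex mu (G := fun z => Phi y z + magn T th k v y * (sp z v * Phi y
  z))); last first.
  by move=> z; ring.
rewrite ExD ?ExZ ?EPhi0 ?add0r//; last by apply: bmfunM; [exact: bmfun_cst|].
apply: le_trans (ler_norm _) _; rewrite normrM mulrC ler_wpM2r//.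
apply: Ex_norm_le => // z; rewrite normrM spin_norm mul1r normrM.
by rewrite -[leRHS]mul1r ler_pM//; exact: S1.
Qed.

Lemma dominated_Ex P mu (C : R) :
  (forall A, @measurable _ (config V) A -> fine (P A) <= C * fine (mu A)) ->
  forall F, cylfun F -> (forall x, 0 <= F x) -> Ex P F <= C * Ex mu F.
Proof.
move=> PC F [D dF] F0.
rewrite !(cylfun_Ex _ (fun=> true) dF) mulr_sumr; apply: ler_sum => tau _.
rewrite mulrCA ler_wpM2l//; apply: PC.
exact: (measurable_cylset tau (@subsetT _ _)).
Qed.

(* Under a Gibbs measure the spin at [v] can be replaced by its conditional mean
   [g] given the spins off the first [k] generations below [v]; by domination, [g]
   is as close in mean to [th v] times the parent spin as under [mu]. *)
Lemma gibbs_dominated_markov P mu (C : R) :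
  capacity T 2 (resistance T beta J) = 0%E ->
  markov T th mu -> is_gibbs T beta J P -> 0 <= C ->
  (forall A, @measurable _ (config V) A -> fine (P A) <= C * fine (mu A)) ->
  markov T th P.
Proof.
move=> cap0 mP gP C0 PC v G cG dG.
have gmu := markov_is_gibbs lf mP.
have csG u : cylfun (fun x => sp x u * G x) by apply: cylfunM => //; exact: cylfun_spin.
have [_ [B bG]] := cylfun_bmT cG.
have B0 : 0 <= B by apply: le_trans (bG (fun=> true)).
pose inn (z : V -> bool) := sp z v - th v * sp z (p v).
have cinn : cylfun inn by apply: cylfunB; [exact: cylfun_spin|exact: cpar].
suff small e : 0 < e -> `|Ex P (fun x => inn x * G x)| <= B * C * 4 * e.
  apply/eqP; rewrite -subr_eq0 -ExZ; last exact: cylfun_bmT.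
  rewrite -ExB; [|exact: cylfun_bmT|]; last first.
    by apply: cylfun_bmT; apply: cylfunM => //; exact: cylfun_cst.
  rewrite -normr_le0 leNgt; apply/negP => d0.
  rewrite (eq_Ex P (G := fun x => inn x * G x)) in d0; last by move=> x;
    rewrite /inn; ring.
  set d := `|_| in d0 small.
  have M0 : 0 <= B * C * 4 by rewrite !mulr_ge0.
  have M1 : 0 < B * C * 4 + 1 by rewrite ltr_wpDl.
  have := small (d / (B * C * 4 + 1)) (divr_gt0 d0 M1).
  rewrite mulrA ler_pdivlMr// [leRHS]mulrC ler_pM2l//; lra.
(* With a moment below [e * e] the bound of [spin_innovation_le] is at most [4 * e], whence the
   constant [B * C * 4]. *)
move=> e0; have [k mk] := magn_moment_small cap0 v (mulr_gt0 e0 e0).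
have [L memL] : exists L : {fset V}, forall u, (u \in L) = (u \in ball T k.+1 v).
  by move: (ball _ _ _) => s; exists [fset u in s]%fset => u; rewrite inE.
have LP u : reflect (subtree T v u /\ (depth T u < depth T v + k.+1)%N) (u \in L).
  by rewrite memL; exact: ballP.
have vL : v \in L by apply/LP; split; [exact: subtree_refl|lia].
have offL : ~` subtree T v `<=` ~` [set` L] by move=> u nu /LP[].
have levL : level_set T k.+1 v `<=` ~` [set` L] by move=> u [_ du] /LP[_];
  rewrite du ltnn.
(* The same function serves [P] and [mu], both being Gibbs; this lets domination transfer the
   estimate. *)
pose g x := \sum_(sigma : {ffun L -> bool})
  sp (splice sigma (fun=> true)) v * gibbs_kernel T beta J sigma x.
have cg : cylfun g.
  by apply: cylfun_sum => s; apply: cylfunM;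
    [exact: cylfun_cst|exact: cylfun_gibbs_kernel].
(* Outside the ball [L], the vertices adjacent to it are the generation [k.+1] below [v] and the
   parent of [v]. *)
have dg : dep_on (level_set T k.+1 v `|` ~` subtree T v) g.
  move=> x y xy; apply: eq_bigr => s _; congr (_ * _).
  apply: (gibbs_kernel_dep beta J lf) => u [/= nuL [w]];
    rewrite mem_edges// => /andP[wo wL] uw.
  apply: xy; have {}nuL : u \notin L by exact/negP.
  case: uw wL => uw; rewrite uw in nuL *; last first.
    rewrite (negbTE nuL) orbF => /LP[vw dw]; right => vpw.
    by case/negP: nuL; apply/LP; split => //; move: dw; rewrite (depth_parent wo); lia.
  rewrite (negbTE nuL)/= => /LP[vpw dpw]; left.
  have vw : subtree T v w by exact: tree_le_trans vpw (tree_le_parent T w).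
  split => //; rewrite (depth_parent wo); move/LP: nuL => nuL.
  have : ~ (depth T w < depth T v + k.+1)%N by move=> h; apply: nuL.
  rewrite (depth_parent wo); lia.
have dgL : dep_on (~` [set` L]) g by apply: dep_onS dg => u [/levL|/offL].
have gE (Q : probability (config V) R) (H : (V -> bool) -> R) : is_gibbs T beta
  J Q -> cylfun H -> dep_on (~` [set` L]) H ->
    Ex Q (fun x => sp x v * H x) = Ex Q (fun x => g x * H x).
  move=> gQ cH dH.
  rewrite (eq_Ex Q (G := fun x => \sum_(sigma : {ffun L -> bool})
     sp (splice sigma (fun=> true)) v * (\1_(cylset sigma) x * H x))); last first.
    move=> x; rewrite (bigD1 (restr L x))//= big1 ?addr0.
      by rewrite indicE cylsetE eqxx mul1r splice_restr.
    by move=> s; rewrite indicE cylsetE eq_sym => /negbTE ->; rewrite mul0r mulr0.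
  rewrite Ex_sum; last first.
    move=> s; apply: cylfun_bmT; apply: cylfunM; first exact: cylfun_cst.
    by apply: cylfunM => //; exact: cylfun_cylset.
  rewrite (eq_Ex Q (F := fun x => g x * H x) (G := fun x => \sum_(sigma : {ffun
    L -> bool})
     sp (splice sigma (fun=> true)) v * (gibbs_kernel T beta J sigma x * H x)));
       last first.
    by move=> x; rewrite /g mulr_suml; apply: eq_bigr => s _; rewrite mulrA.
  rewrite Ex_sum; last first.
    move=> s; apply: cylfun_bmT; apply: cylfunM; first exact: cylfun_cst.
    by apply: cylfunM => //; exact: cylfun_gibbs_kernel.
  apply: eq_bigr => s _; rewrite !ExZ.
  - by rewrite (gibbs_kernel_Ex lf gQ).
  - by apply: cylfun_bmT; apply: cylfunM => //; exact: cylfun_gibbs_kernel.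
  - by apply: cylfun_bmT; apply: cylfunM => //; exact: cylfun_cylset.
pose u x := g x - th v * sp x (p v).
have cu : cylfun u by exact: cylfunB.
have uE (Q : probability (config V) R) (H : (V -> bool) -> R) : is_gibbs T beta
  J Q -> cylfun H -> dep_on (~` [set` L]) H ->
    Ex Q (fun x => inn x * H x) = Ex Q (fun x => u x * H x).
  move=> gQ cH dH.
  have cpH : cylfun (fun x => th v * sp x (p v) * H x) by exact: cylfunM.
  have cg' : cylfun (fun x => g x * H x) by exact: cylfunM.
  have cv : cylfun (fun x => sp x v * H x) by apply: cylfunM => //; exact: cylfun_spin.
  rewrite (eq_Ex Q (G := fun x => sp x v * H x - th v * sp x (p v) * H x));
    last by move=> x; rewrite /inn mulrBl.
  rewrite (eq_Ex Q (F := fun x => u x * H x) (G := fun x => g x * H x - th v *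
    sp x (p v) * H x)); last by move=> x; rewrite /u mulrBl.
  by rewrite !ExB ?gE//; exact: cylfun_bmT.
rewrite uE//; last exact: dep_onS offL dG.
have cnu : cylfun (fun x => `|u x|) by exact: cylfun_comp.
have h1 : `|Ex P (fun x => u x * G x)| <= B * Ex P (fun x => `|u x|).
  have cuG : cylfun (fun x => u x * G x) by exact: cylfunM.
  apply: (le_trans (norm_Ex P (cylfun_bmT cuG))).
  rewrite -ExZ; last exact: cylfun_bmT.
  apply: le_Ex => [||x].
  - by apply: bmfun_norm; exact: cylfun_bmT.
  - by apply: cylfun_bmT; apply: cylfunM => //; exact: cylfun_cst.
  - by rewrite normrM mulrC ler_wpM2r.
apply: (le_trans h1); rewrite -!mulrA ler_wpM2l//.
apply: (le_trans (dominated_Ex PC cnu (fun=> normr_ge0 _))); rewrite ler_wpM2l//.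
(* The norm of [u] is [u] times its sign; under [mu] this turns [u] back into the innovation of the
   spin, tested against a function bounded by 1. *)
have cS : cylfun (fun x => Num.sg (u x)) by exact: cylfun_comp.
have dS : dep_on (level_set T k.+1 v `|` ~` subtree T v) (fun x => Num.sg (u x)).
  apply: dep_on_comp; apply: (dep_on_comp2 (fun a b => a - b)) => //.
  by apply: dep_onS (@dep_parent_spin v) => w nw; right.
rewrite (eq_Ex mu (G := fun x => u x * Num.sg (u x))); last by move=> x;
  rewrite mulrC -normrEsg.
rewrite -uE//; last by apply: dep_onS dS => w [/levL|/offL].
have sg1 x : `|Num.sg (u x)| <= 1 by rewrite normr_sg; case: (_ != _).
apply: (le_trans (spin_innovation_le mP e0 cS dS sg1)).
have : magn_moment T th k.+1 v / e <= e by rewrite ler_pdivrMr// ltW.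
lra.
Qed.

Lemma extremal_of_capacity mu : capacity T 2 (resistance T beta J) = 0%E ->
  markov T th mu -> extremal_gibbs T beta J mu.
Proof.
move=> cap0 mP; split; first exact: markov_is_gibbs.
have key (P1 P2 : probability (config V) R) (s : R) : is_gibbs T beta J P1 -> 0
  < s < 1 ->
    (forall A, measurable A -> mu A = (s%:E * P1 A + (1 - s)%:E * P2 A)%E) ->
    forall A, measurable A -> P1 A = mu A.
  move=> g1 /andP[s0 s1] dec; apply: probability_spin_eq => F cF.
  suff mP1 : markov T th P1 by exact: (markov_unique (theta_root T beta J) mP1 mP cF).
  (* The constant [s^-1] comes from [mu] being at least [s] times [P1]. *)
  apply: (@gibbs_dominated_markov P1 mu s^-1) => //; first by rewrite invr_ge0 ltW.
  move=> A mA; rewrite mulrC ler_pdivlMr// (dec _ mA).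
  rewrite -(fineK (fin_num_measure P1 _ mA)) -(fineK (fin_num_measure P2 _ mA)) /=.
  by rewrite mulrC lerDl mulr_ge0 ?fine_ge0// subr_ge0 ltW.
move=> P1 P2 s g1 g2 s01 dec A mA; split; first exact: key g1 s01 dec _ mA.
have s01' : 0 < 1 - s < 1 by case/andP : s01 => ? ?; apply/andP; split; lra.
apply: (key P2 P1 (1 - s) g2 s01') => // B mB.
by rewrite dec// addeC; congr (_ + _%:E * _)%E; ring.
Qed.

End Extremality.

(** * Positive capacity *)

Section FlowMoment.
Variables (R : realType) (V : choiceType) (T : rooted_tree V).
Hypothesis lf : locally_finite T.
Local Notation o := (tree_root T).
Local Notation p := (parent T).
Local Notation sp eta v := (spin R (eta v)).
Variables (th res f : V -> R).
Hypothesis th_root : th o = 0.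
Hypothesis th_neq0 : forall w, w != o -> th w != 0.
Hypothesis res_gt0 : forall v, 0 < res v.
Hypothesis res_child : forall w, w != o -> res w = th w ^- 2 * res (p w).
Hypothesis f_ge0 : forall v, 0 <= f v.
Hypothesis f_sum : forall v, f v = \sum_(w <- chl T v) f w.
Variable P : probability (config V) R.
Hypothesis mP : markov T th P.
Implicit Types (v w : V) (k : nat) (ws : seq V).

(* Weighted majority: [f u * eta u], divided by the product of [th] along the
   path from [v] to [u], is summed over the [k]-th generation [u] below [v]. *)
Fixpoint flow_spin k v (eta : V -> bool) : R :=
  if k is k'.+1 then \sum_(w <- chl T v) (th w)^-1 * flow_spin k' w eta
  else f v * sp eta v.

Definition flow_spin_list k ws (eta : V -> bool) : R :=
  \sum_(w <- ws) (th w)^-1 * flow_spin k w eta.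

Lemma flow_spin_dep k v : dep_on (level_set T k v) (flow_spin k v).
Proof.
elim: k v => [|k IH] v x y xy /=; first by rewrite (xy v)// level_set0.
rewrite !big_seq; apply: eq_bigr => w /(chlP lf) cw; rewrite (IH w x y)// => u wu.
by apply: xy; exact: level_set_child wu.
Qed.

Lemma flow_spin_cyl k v : cylfun (flow_spin k v).
Proof.
apply: (fset_cylfun (s := ball T k.+1 v)).
by apply: dep_onS (@flow_spin_dep k v); exact: ball_cover.
Qed.

Lemma flow_spin_list_cyl k ws : cylfun (flow_spin_list k ws).
Proof.
by apply: cylfun_sum => w; apply: cylfunM; [exact: cylfun_cst|exact: flow_spin_cyl].
Qed.

Lemma flow_spin_list_dep k ws : dep_on (levels T k ws) (flow_spin_list k ws).
Proof.
move=> x y xy; rewrite /flow_spin_list !big_seq; apply: eq_bigr => w ww.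
by congr (_ * _); apply: flow_spin_dep => u wu; apply: xy; exists w.
Qed.

Let bmM (F G : (V -> bool) -> R) : cylfun F -> cylfun G ->
  bmfun (fun eta : config V => F eta * G eta).
Proof. by move=> cF cG; apply: cylfun_bmT; exact: cylfunM. Qed.

Lemma Ex_flow_spin_list k v ws G : siblings T v ws ->
  (forall w, w \in ws -> Ex P (fun eta => flow_spin k w eta * G eta) =
     f w * Ex P (fun eta => sp eta w * G eta)) ->
  cylfun G -> (forall w, w \in ws -> dep_on (~` subtree T w) G) ->
  Ex P (fun eta => flow_spin_list k ws eta * G eta) =
  (\sum_(w <- ws) f w) * Ex P (fun eta => sp eta v * G eta).
Proof.
move=> [_ sw] Hw cG dG.
have cFG w : cylfun (fun eta => flow_spin k w eta * G eta).
  by apply: cylfunM => //; exact: flow_spin_cyl.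
rewrite (eq_Ex P (G := fun eta => \sum_(w <- ws) (th w)^-1 * (flow_spin k w eta
  * G eta))); last first.
  by move=> eta; rewrite mulr_suml; apply: eq_bigr => w _; rewrite mulrA.
rewrite Ex_sum; last by move=> w; apply: bmM; [exact: cylfun_cst|].
rewrite mulr_suml !big_seq; apply: eq_bigr => w ww.
rewrite ExZ; last exact: cylfun_bmT.
rewrite Hw// mP//; last exact: dG.
by have [wo ->] := sw _ ww; field; exact: th_neq0.
Qed.

(** The division by [th] in [flow_spin] cancels the factor that [markov] yields at each edge, so
    only the total flow through [v] is left. *)
Lemma Ex_flow_spin k v G : cylfun G -> dep_on (~` strict_subtree T v) G ->
  Ex P (fun eta => flow_spin k v eta * G eta) = f v * Ex P (fun eta => sp eta v
    * G eta).
Proof.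
elim: k v G => [|k IH] v G cG dG.
  rewrite -ExZ; last by apply: bmM => //; exact: cylfun_spin.
  by apply: eq_Ex => eta /=; rewrite mulrA.
have dw w : w \in chl T v -> dep_on (~` subtree T w) G.
  by move=> /(chlP lf) cw; apply: dep_onS dG => u nu wu; apply: nu;
    exact: child_strict_subtree wu.
rewrite [in RHS]f_sum; apply: Ex_flow_spin_list => //; first exact: siblings_chl.
move=> w ww; apply: IH => //; apply: dep_onS (dw _ ww) => u nu /strict_subtree_sub.
exact: nu.
Qed.

Definition flow_moment k v : R := Ex P (fun eta => flow_spin k v eta ^+ 2).

(** By [Ex_flow_spin], a cross term between two branches is the product of their flows, as they
    interact only through the spin at [v]. Adding the squares [f w ^+ 2] completes the cross terms
    to the square of the total flow. *)
Lemma flow_moment_list k v ws : siblings T v ws ->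
  Ex P (fun eta => flow_spin_list k ws eta ^+ 2) <=
  (\sum_(w <- ws) f w) ^+ 2 + \sum_(w <- ws) th w ^- 2 * flow_moment k w.
Proof.
elim: ws => [|w ws IH] sw.
  rewrite !big_nil expr0n addr0 (eq_Ex P (G := fun=> 0)) ?Ex_cst// => eta.
  by rewrite /flow_spin_list big_nil expr0n.
have [_ cw sws] := siblings_cons sw; have [wo pw] := cw.
pose A := flow_spin_list k ws; pose a := flow_spin k w.
have cA : cylfun A by exact: flow_spin_list_cyl.
have ca : cylfun a by exact: flow_spin_cyl.
have cAA : cylfun (fun eta => A eta ^+ 2) by exact: (cylfun_comp (fun x => x ^+ 2) cA).
have caa : cylfun (fun eta => a eta ^+ 2) by exact: (cylfun_comp (fun x => x ^+ 2) ca).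
have caA : cylfun (fun eta => a eta * A eta) by exact: cylfunM.
have dA : dep_on (~` subtree T w) A.
  apply: dep_onS (@flow_spin_list_dep k ws) => u lu.
  exact: (siblings_levels sw lu).
have vA : Ex P (fun eta => sp eta v * A eta) = \sum_(w' <- ws) f w'.
  rewrite (eq_Ex P (G := fun eta => A eta * sp eta v)); last by move=> eta;
    rewrite mulrC.
  have dv w' : w' \in ws -> dep_on (~` subtree T w') (fun eta => sp eta v).
    move=> ww'; apply: dep_on_spin; have [_ h] := sws; have [wo' <-] := h _ ww'.
    exact: parent_not_subtree.
  rewrite (Ex_flow_spin_list sws)//; last exact: cylfun_spin.
    rewrite (eq_Ex P (G := fun=> 1)) ?Ex_cst ?mulr1// => eta; exact: spin_sqr.
  move=> w' ww'; apply: Ex_flow_spin; first exact: cylfun_spin.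
  by apply: dep_onS (dv _ ww') => u nu /strict_subtree_sub.
have aA : Ex P (fun eta => a eta * A eta) = f w * (th w * \sum_(w' <- ws) f w').
  rewrite Ex_flow_spin//; last by apply: dep_onS dA => u nu /strict_subtree_sub.
  by rewrite mP// pw vA.
rewrite (eq_Ex P (G := fun eta => th w ^- 2 * a eta ^+ 2 +
    (2 * (th w)^-1 * (a eta * A eta) + A eta ^+ 2))); last first.
  move=> eta; rewrite /flow_spin_list big_cons -/(flow_spin_list k ws eta) -/(A
    eta) -/(a eta).
  by field; exact: th_neq0.
have b1 : bmfun (fun eta : config V => th w ^- 2 * a eta ^+ 2).
  by apply: bmM => //; exact: cylfun_cst.
have b2 : bmfun (fun eta : config V => 2 * (th w)^-1 * (a eta * A eta)).
  by apply: bmM => //; exact: cylfun_cst.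
have b3 : bmfun (fun eta : config V => A eta ^+ 2) by exact: cylfun_bmT.
rewrite ExD//; last exact: bmfunD.
rewrite ExD// !ExZ; [|exact: cylfun_bmT..].
rewrite aA !big_cons -/(flow_moment k w).
have {}IH := IH sws; rewrite -/A in IH.
set F := \sum_(w' <- ws) f w' in IH *; set Q := \sum_(w' <- ws) _ in IH *.
have -> : 2 / th w * (f w * (th w * F)) = 2 * f w * F by field; exact: th_neq0.
have := sqr_ge0 (f w); rewrite sqrrD.
lra.
Qed.

(** In the application, the potential gathered along the path from the root to a vertex. *)
Variable A : V -> R.
Hypothesis A_child : forall w, w != o -> A w = A (p w) + f w * res w.
Hypothesis A_le1 : forall v, A v <= 1.

(** [1 - A v] is the potential still available below [v]. By [A_child] the bound at a child [w] of
    [v] is exactly [f w * (1 - A v)], and these add up to [f v * (1 - A v)]. *)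
Lemma flow_moment_le k v :
  res v * flow_moment k v <= f v * (1 - A v) + f v ^+ 2 * res v.
Proof.
elim: k v => [|k IH] v.
  rewrite /flow_moment (eq_Ex P (G := fun=> f v ^+ 2)); last first.
    by move=> eta /=; rewrite exprMn [sp eta v ^+ 2]expr2 spin_sqr mulr1.
  by rewrite Ex_cst mulrC lerDr mulr_ge0// subr_ge0.
have := flow_moment_list k (siblings_chl lf v).
rewrite -f_sum -/(flow_moment k.+1 v) => le.
apply: (le_trans (ler_wpM2l (ltW (res_gt0 v)) le)).
rewrite mulrDr mulrC addrC lerD2r mulr_sumr [in leRHS]f_sum mulr_suml.
rewrite big_seq [leRHS]big_seq; apply: ler_sum => w /(chlP lf) [wo pw].
have -> : res v * (th w ^- 2 * flow_moment k w) = res w * flow_moment k w.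
  by rewrite (res_child wo) pw; ring.
apply: (le_trans (IH w)); rewrite (A_child wo) pw.
by rewrite le_eqVlt; apply/orP; left; apply/eqP; ring.
Qed.

End FlowMoment.

(** * Limits of bounded densities along an ultrafilter *)

Section UltraLimit.
Context d (X : measurableType d) (R : realType).
Variable U : set_system nat.
Hypothesis U_ultra : UltraFilter U.

Lemma ultra_fmap Y (u : nat -> Y) : UltraFilter (u @ U).
Proof.
split; first exact: fmap_proper_filter.
move=> G GF sub; apply/seteqP; split; last exact: sub.
move=> A GA; have [//|UnA] := in_ultra_setVsetC (u @^-1` A) U_ultra.
exfalso; apply: (@filter_not_empty _ G); rewrite -(setICr A).
by apply: filterI => //; exact: (sub (~` A) UnA).
Qed.

Lemma ultralim_ex (u : nat -> R) (a b : R) : (forall n, a <= u n <= b) ->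
  exists l : R, u @ U --> l.
Proof.
move=> ab; have := @segment_compact R a b; rewrite compact_ultra.
move=> /(_ (u @ U) (ultra_fmap u)) [|l [_ ul]]; last by exists l.
by apply: (@filterE _ U) => n /=; rewrite in_itv /=; exact: ab.
Qed.

Variables (mu : probability X R) (psi : nat -> X -> R).
Hypothesis bpsi : forall n, bmfun (psi n).
Hypothesis psi02 : forall n x, 0 <= psi n x <= 2.
Hypothesis psi1 : forall n, Ex mu (psi n) = 1.

Let wt n (A : set X) : R := Ex mu (fun x => psi n x * \1_A x).

Let bm n A : measurable A -> bmfun (fun x => psi n x * \1_A x).
Proof. by move=> mA; apply: bmfunM => //; exact: bmfun_indic. Qed.

Let wt_ge0 n A : 0 <= wt n A.
Proof.
apply: Ex_ge0 => x; have /andP[p0 _] := psi02 n x.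
by rewrite mulr_ge0// indicE.
Qed.

Let wt_le n A : measurable A -> wt n A <= 2 * fine (mu A).
Proof.
move=> mA; rewrite -Ex_indic// -ExZ; last exact: bmfun_indic.
apply: le_Ex => [||x]; [exact: bm|by apply: bmfunM;
  [exact: bmfun_cst|exact: bmfun_indic]|].
by rewrite ler_wpM2r ?indicE//; case/andP : (psi02 n x).
Qed.

Let lim_ex (A : set X) : exists l : R, measurable A -> wt^~ A @ U --> l.
Proof.
have [mA|nmA] := pselect (measurable A); last by exists 0.
have [|l ul] := @ultralim_ex (wt^~ A) 0 (2 * fine (mu A)); last by exists l.
by move=> n; rewrite wt_ge0 wt_le.
Qed.

Let l (A : set X) : R := if pselect (measurable A) then projT1 (cid (lim_ex A)) else 0.

Let lP A : measurable A -> wt^~ A @ U --> l A.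
Proof.
by move=> mA; rewrite /l; case: pselect => // mA'; exact: (projT2 (cid (lim_ex A)) mA).
Qed.

Let l_ge0 A : 0 <= l A.
Proof.
have [mA|nmA] := pselect (measurable A); last by rewrite /l; case: pselect.
by apply: (cvgr_to_ge (lP mA)); apply: nearW => n; exact: wt_ge0.
Qed.

Let l_le A : measurable A -> l A <= 2 * fine (mu A).
Proof.
by move=> mA; apply: (cvgr_to_le (lP mA)); apply: nearW => n; exact: wt_le.
Qed.

Let lU A B : measurable A -> measurable B -> [disjoint A & B] ->
  l (A `|` B) = l A + l B.
Proof.
move=> mA mB AB.
suff h : wt^~ (A `|` B) @ U --> l A + l B.
  exact: (cvg_unique _ (lP (measurableU _ _ mA mB)) h).
have -> : wt^~ (A `|` B) = (fun n => wt n A + wt n B); last exact: cvgD (lP mA) (lP mB).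
apply/funext => n; rewrite /wt -ExD; [|exact: bm..].
apply: eq_Ex => x; rewrite -mulrDr; congr (_ * _).
rewrite !indicE in_setU; have := AB; rewrite disj_set2E => /eqP AB0.
have [xA|xA] := boolP (x \in A); have [xB|xB] := boolP (x \in B);
  rewrite ?addr0 ?add0r//.
by exfalso; move: xA xB; rewrite !inE => xA xB; have : (A `&` B) x by []; rewrite AB0.
Qed.

Let l0 : l set0 = 0.
Proof.
apply/eqP; rewrite eq_le l_ge0 andbT; have := @l_le set0 measurable0.
by rewrite measure0/= mulr0.
Qed.

Let lT : l setT = 1.
Proof.
suff h : wt^~ setT @ U --> (1 : R) by exact: (cvg_unique _ (lP measurableT) h).
have -> : wt^~ setT = fun=> 1; last exact: cvg_cst.
by apply/funext => n; rewrite -(psi1 n); apply: eq_Ex => x; rewrite indicT mulr1.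
Qed.

Let l_bigsetU (F : (set X)^nat) n : (forall i, measurable (F i)) -> trivIset setT F ->
  l (\big[setU/set0]_(i < n) F i) = \sum_(0 <= i < n) l (F i).
Proof.
move=> mF tF; elim: n => [|n IH]; first by rewrite big_ord0 big_nil l0.
rewrite big_ord_recr/= big_nat_recr//= -IH lU//; first exact: bigsetU_measurable.
apply/disj_set2P; apply: (@trivIset_bigsetUI _ predT) => //.
by rewrite /predT /= trueE.
Qed.

Definition ultra_measure (A : set X) : \bar R := (l A)%:E.

Let um0 : ultra_measure set0 = 0%E. Proof. by rewrite /ultra_measure l0. Qed.

Let um_ge0 A : (0 <= ultra_measure A)%E. Proof. by rewrite lee_fin l_ge0. Qed.

Let um_sigma : semi_sigma_additive ultra_measure.
Proof.
move=> F mF tF mUF; rewrite /ultra_measure.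
have -> : (fun n => (\sum_(0 <= i < n) (l (F i))%:E)%E) =
    EFin \o (fun n => \sum_(0 <= i < n) l (F i)).
  by apply/funext => n; rewrite /= sumEFin.
apply: cvg_EFin; first exact: nearW.
have mB n : measurable (\big[setU/set0]_(i < n) F i) by exact: bigsetU_measurable.
have sB n : \big[setU/set0]_(i < n) F i `<=` \bigcup_i F i.
  by rewrite -bigcup_mkord; apply: bigcup_subset => i _.
have muF : (fun n => \sum_(0 <= i < n) fine (mu (F i))) @ \oo -->
    fine (mu (\bigcup_i F i)).
  have h : (fun n => \sum_(0 <= i < n) mu (F i))%E @ \oo -->
      (fine (mu (\bigcup_i F i)))%:E.
    by rewrite fineK ?fin_num_measure//; exact: measure_semi_sigma_additive.
  suff <- : fine \o (fun n => \sum_(0 <= i < n) mu (F i))%E =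
      (fun n => \sum_(0 <= i < n) fine (mu (F i))) by exact: fine_cvg h.
  apply/funext => n /=.
  by rewrite sum_fine// => i _; exact: fin_num_measure.
have mD n : measurable (\bigcup_i F i `\` \big[setU/set0]_(i < n) F i).
  exact: measurableD.
have lE n : \sum_(0 <= i < n) l (F i) =
    l (\bigcup_i F i) - l (\bigcup_i F i `\` \big[setU/set0]_(i < n) F i).
  rewrite -l_bigsetU// -[in X in _ = X - _](setDUK (sB n)) lU//; first by rewrite addrK.
  by apply/disj_set2P; rewrite setDE setICA setICr setI0.
have muE n : fine (mu (\bigcup_i F i `\` \big[setU/set0]_(i < n) F i)) =
    fine (mu (\bigcup_i F i)) - \sum_(0 <= i < n) fine (mu (F i)).
  rewrite measureD//; last by rewrite -ge0_fin_numE// fin_num_measure.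
  rewrite setIidr// fineB ?fin_num_measure//; congr (_ - _).
  rewrite measure_bigsetU// big_mkord.
  by rewrite sum_fine// => i _; exact: fin_num_measure.
(* By finite additivity the partial sums miss the limit by the value of [l] on the tail, which is at
   most twice its [mu]-measure and so tends to 0. *)
apply: (@squeeze_cvgr _ _ _ R (fun n => l (\bigcup_i F i) -
   2 * (fine (mu (\bigcup_i F i)) - \sum_(0 <= i < n) fine (mu (F i))))
   (fun=> l (\bigcup_i F i))).
- apply: nearW => n /=; rewrite lE lerD2l lerN2 gerDl oppr_le0 l_ge0 andbT -muE.
  exact: l_le.
- rewrite -[X in _ --> X]subr0; apply: cvgB; first exact: cvg_cst.
  rewrite -[X in _ --> X](mulr0 2); apply: cvgM; first exact: cvg_cst.
  rewrite -[X in _ --> X](subrr (fine (mu (\bigcup_i F i)))).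
  by apply: cvgB; [exact: cvg_cst|exact: muF].
- exact: cvg_cst.
Qed.

HB.instance Definition _ := isMeasure.Build _ _ _ ultra_measure um0 um_ge0 um_sigma.

Let um_setT : ultra_measure setT = 1%E.
Proof. by rewrite /ultra_measure lT. Qed.

HB.instance Definition _ := Measure_isProbability.Build _ _ _ ultra_measure um_setT.

Lemma ultralimit_probability : exists Q : probability X R,
  forall A, measurable A ->
  Ex mu (fun x => psi n x * \1_A x) @[n --> U] --> fine (Q A).
Proof. by exists ultra_measure => A mA; exact: lP. Qed.

End UltraLimit.

(** * Tilting the free measure into two Gibbs measures *)

Section NonExtremality.
Variables (R : realType) (V : choiceType) (T : rooted_tree V).
Hypothesis lf : locally_finite T.
Hypothesis has_child : forall v, children T v !=set0.
Local Notation o := (tree_root T).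
Local Notation p := (parent T).
Local Notation sp eta v := (spin R (eta v)).
Variables (beta : R) (J : V -> R).
Local Notation th := (theta T beta J).
Local Notation res := (resistance T beta J).
Variable mu : probability (config V) R.
Hypothesis mP : markov T th mu.

Section UltraGibbs.
Variable U : set_system nat.
Hypothesis U_ultra : UltraFilter U.
Hypothesis U_infty : \oo `<=` U.
Variables (psi : nat -> (V -> bool) -> R) (Q : probability (config V) R).
Hypothesis cpsi : forall n, cylfun (psi n).
Hypothesis dpsi : forall n, dep_on (level_set T n.+1 o) (psi n).
Hypothesis psiQ : forall A, @measurable _ (config V) A ->
  Ex mu (fun x => psi n x * \1_A x) @[n --> U] --> fine (Q A).

Lemma ultralimit_Ex F : cylfun F ->
  Ex mu (fun x => psi n x * F x) @[n --> U] --> Ex Q F.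
Proof.
move=> [D dF]; rewrite (cylfun_Ex Q (fun=> true) dF).
pose c (tau : {ffun D -> bool}) := F (splice tau (fun=> true)).
have -> : (fun n => Ex mu (fun x => psi n x * F x)) = (fun n =>
    \sum_(tau : {ffun D -> bool}) c tau * Ex mu (fun x => psi n x * \1_(cylset tau) x)).
  apply/funext => n.
  have ct (tau : {ffun D -> bool}) : cylfun (fun x => psi n x * \1_(cylset tau) x).
    by apply: cylfunM => //; exact: cylfun_cylset.
  rewrite [RHS](eq_bigr (fun tau : {ffun D -> bool} =>
      Ex mu (fun x => c tau * (psi n x * \1_(cylset tau) x)))); last first.
    by move=> tau _; rewrite ExZ//; exact: cylfun_bmT.
  rewrite -Ex_sum; last first.
    by move=> tau; apply: cylfun_bmT; apply: cylfunM => //; exact: cylfun_cst.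
  apply: eq_Ex => x; rewrite [in LHS](cyl_decomp (fun=> true) dF x) mulr_sumr.
  by apply: eq_bigr => tau _; rewrite mulrCA.
elim: (index_enum _) => [|tau s IH].
  by rewrite big_nil; under eq_fun do rewrite big_nil; exact: cvg_cst.
rewrite big_cons; under eq_fun do rewrite big_cons; apply: cvgD => //.
apply: cvgM; first exact: cvg_cst.
by apply: psiQ; exact: (measurable_cylset tau (@subsetT _ _)).
Qed.

(** Beyond the depths of [L] the density [psi n] depends on no spin of [L], so it may join the test
    function in the Gibbs identity for [mu]; [U_infty] discards the other values of [n]. *)
Lemma ultralimit_gibbs : is_gibbs T beta J Q.
Proof.
apply: (is_gibbs_cylfun lf) => L sigma G cG dG.
have c1 : cylfun (fun x => \1_(cylset sigma) x * G x).
  by apply: cylfunM => //; exact: cylfun_cylset.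
have c2 : cylfun (fun x => gibbs_kernel T beta J sigma x * G x).
  by apply: cylfunM => //; exact: (cylfun_gibbs_kernel beta J lf sigma).
have gmu := markov_is_gibbs lf mP.
suff h : Ex mu (fun x => psi n x * (\1_(cylset sigma) x * G x)) @[n --> U] -->
    Ex Q (fun x => gibbs_kernel T beta J sigma x * G x).
  exact: (cvg_unique _ (ultralimit_Ex c1) h).
apply: cvg_trans (ultralimit_Ex c2); apply: near_eq_cvg; apply: U_infty.
exists (\max_(u <- enum_fset L) depth T u)%N => // n /= Ln.
have dn : dep_on (~` [set` L]) (psi n).
  apply: dep_onS (@dpsi n) => u [_ du] uL.
  have := leq_trans (@leq_bigmax_seq _ (enum_fset L) xpredT (depth T) u uL isT) Ln.
  by rewrite du depth_root add0n ltnn.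
have cpG : cylfun (fun x => psi n x * G x) by exact: cylfunM.
have dpG : dep_on (~` [set` L]) (fun x => psi n x * G x) by exact: dep_on_comp2.
have := gibbs_kernel_Ex lf gmu sigma cpG dpG.
rewrite (eq_Ex mu (F := fun x => \1_(cylset sigma) x * (psi n x * G x))
  (G := fun x => psi n x * (\1_(cylset sigma) x * G x))); last by move=> x;
    rewrite mulrCA.
by move=> ->; apply: eq_Ex => x; rewrite mulrCA.
Qed.

End UltraGibbs.

(* [(1 + phi n) mu] and [(1 - phi n) mu] have mean [mu] and are Gibbs off the
   generation on which [phi n] depends. *)
Lemma non_extremal (phi : nat -> (V -> bool) -> R) (delta : R) :
  (forall n, cylfun (phi n)) -> (forall n, dep_on (level_set T n.+1 o) (phi n)) ->
  (forall n x, `|phi n x| <= 1) -> (forall n, Ex mu (phi n) = 0) ->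
  0 < delta -> (forall n, delta <= Ex mu (fun x => phi n x * sp x o)) ->
  ~ extremal_gibbs T beta J mu.
Proof.
move=> cphi dphi phi1 phi0 delta0 phid [_ ext].
(* Limits are needed on all measurable sets at once, whereas a diagonal subsequence would only
   handle countably many. *)
have [U [UU Uoo]] := @ultraFilterLemma _ \oo _.
have lim (s : R) : `|s| <= 1 -> exists Q : probability (config V) R,
    [/\ is_gibbs T beta J Q,
      forall A, @measurable _ (config V) A ->
        Ex mu (fun x => (1 + s * phi n x) * \1_A x) @[n --> U] --> fine (Q A) &
      Ex mu (fun x => (1 + s * phi n x) * sp x o) @[n --> U] -->
        Ex Q (fun x => sp x o)].
  move=> s1; have cpsi n : cylfun (fun x => 1 + s * phi n x).
    by apply: cylfunD; [exact: cylfun_cst|apply: cylfunM => //; exact: cylfun_cst].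
  have psi02 n x : 0 <= 1 + s * phi n x <= 2.
    have : `|s * phi n x| <= 1 by rewrite normrM mulr_ile1.
    rewrite ler_norml => /andP[h1 h2]; apply/andP; split; lra.
  have psi1 n : Ex mu (fun x => 1 + s * phi n x) = 1.
    rewrite ExD ?ExZ ?Ex_cst ?phi0 ?mulr0 ?addr0//; try exact: cylfun_bmT.
      exact: bmfun_cst.
    by apply: bmfunM; [exact: bmfun_cst|exact: cylfun_bmT].
  have [Q QP] := ultralimit_probability UU (fun n => cylfun_bmT (cpsi n)) psi02 psi1.
  exists Q; split => //.
    apply: (ultralimit_gibbs UU Uoo cpsi _ QP) => n x y xy.
    by rewrite (dphi n x y xy).
  by apply: (ultralimit_Ex UU cpsi QP); exact: cylfun_spin.
have [|Q1 [g1 l1 s1]] := lim 1; first by rewrite normr1.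
have [|Q2 [g2 l2 _]] := lim (-1); first by rewrite normrN1.
have half : 0 < (2^-1 : R) < 1 by apply/andP; split; lra.
have dec A : @measurable _ (config V) A ->
    mu A = ((2^-1)%:E * Q1 A + (1 - 2^-1)%:E * Q2 A)%E.
  move=> mA; rewrite -(fineK (fin_num_measure Q1 _ mA)) -(fineK
    (fin_num_measure Q2 _ mA)).
  rewrite -(fineK (fin_num_measure mu _ mA)) -!EFinM -EFinD; congr (_%:E).
  have h : (fun n => Ex mu (fun x => (1 + 1 * phi n x) * \1_A x) +
      Ex mu (fun x => (1 + (-1) * phi n x) * \1_A x)) @ U -->
      fine (Q1 A) + fine (Q2 A) by exact: cvgD (l1 _ mA) (l2 _ mA).
  have e : (fun n => Ex mu (fun x => (1 + 1 * phi n x) * \1_A x) +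
      Ex mu (fun x => (1 + (-1) * phi n x) * \1_A x)) = fun=> 2 * fine (mu A).
    apply/funext => n.
    have bphi : bmfun (phi n : config V -> R) by exact: cylfun_bmT.
    have bA := bmfun_indic R mA.
    have b (s : R) : bmfun (fun x : config V => (1 + s * phi n x) * \1_A x).
      apply: bmfunM => //; apply: bmfunD; first exact: bmfun_cst.
      by apply: bmfunM => //; exact: bmfun_cst.
    by rewrite -ExD// -Ex_indic// -ExZ//; apply: eq_Ex => x; ring.
  rewrite e in h.
  have {}E : fine (Q1 A) + fine (Q2 A) = 2 * fine (mu A) by exact: (cvg_unique
    _ h (cvg_cst _)).
  lra.
have Q1mu A : @measurable _ (config V) A -> Q1 A = mu A.
  by move=> mA; have [] := ext Q1 Q2 2^-1 g1 g2 half dec A mA.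
(* Extremality has forced [Q1] to be [mu], under which the spin at the root has mean 0; the tilt
   makes that mean at least [delta]. *)
have E0 : Ex Q1 (fun x => sp x o) = 0.
  rewrite -(Ex_spin (theta_root T beta J) mP o).
  have [D dD] := cylfun_spin R o.
  rewrite !(cylfun_Ex _ (fun=> true) dD); apply: eq_bigr => tau _.
  by rewrite Q1mu//; exact: (measurable_cylset tau (@subsetT _ _)).
have : delta <= Ex Q1 (fun x => sp x o).
  apply: (cvgr_to_ge s1); apply: nearW => n.
  rewrite (eq_Ex mu (G := fun x => sp x o + phi n x * sp x o)); last by move=> x; ring.
  have cs : cylfun (fun x => sp x o) by exact: cylfun_spin.
  rewrite ExD; [|exact: cylfun_bmT|by apply: cylfun_bmT; exact: cylfunM].
  by rewrite (Ex_spin (theta_root T beta J) mP) add0r.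
by rewrite E0 leNgt delta0.
Qed.

Definition clip (x : R) : R := Num.max (-1) (Num.min x 1).

Lemma clip_norm x : `|clip x| <= 1.
Proof.
have n1 : (-1 : R) <= 1 by lra.
rewrite /clip ler_norml; have [x1|x1] := leP x 1; last by rewrite max_r ?n1 ?lexx.
by have [x2|x2] := leP (-1) x; rewrite ?x2 ?x1 ?n1 ?lexx.
Qed.

(** When |x| > 1 this reads |x| - 1 <= x^2 / 4, that is (|x| - 2)^2 >= 0. *)
Lemma clip_dist x : `|x - clip x| <= x ^+ 2 / 4.
Proof.
have h := sqr_ge0 x; have hp : 0 <= (x + 2) * (x + 2) by rewrite -expr2 sqr_ge0.
have hm : 0 <= (x - 2) * (x - 2) by rewrite -expr2 sqr_ge0.
rewrite !expr2 in h *; rewrite /clip; have [x1|x1] := leP x 1.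
  have [x2|x2] := leP (-1) x; first by rewrite subrr normr0; lra.
  by rewrite ler0_norm; lra.
have [x2|x2] := leP (-1) 1; last by lra.
by rewrite ger0_norm; lra.
Qed.

Hypothesis th_gt0 : forall w, w != o -> 0 < th w.

Lemma not_extremal_of_capacity : capacity T 2 res <> 0%E ->
  ~ extremal_gibbs T beta J mu.
Proof.
move=> /(capacity_neq0_flow lf) [f [ff pf] a0]; set a := flow_strength T f in a0.
have th_neq0 w : w != o -> th w != 0 by move=> /th_gt0; rewrite lt0r => /andP[].
have res0 := resistance_gt0 th_neq0.
(* The strength [a] is placed at the root as the flow entering there, so that conservation holds at
   the root too. *)
pose fl v := if v == o then a else f v.
have fl_ge0 v : 0 <= fl v.
  by rewrite /fl; case: ifPn => [_|/(flow_ge0 ff)//]; exact: ltW.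
have chE (v : V) : \sum_(w <- chl T v) fl w = \sum_(w <- chl T v) f w.
  rewrite !big_seq; apply: eq_bigr => w /(chlP lf) [wo _].
  by rewrite /fl (negbTE wo).
have fl_sum v : fl v = \sum_(w <- chl T v) fl w.
  rewrite chE -(children_sumE lf) /fl; case: eqVneq => [->//|vo].
  exact: ff.2.
pose A v := \sum_(i < depth T v) fl (iter i p v) * res (iter i p v).
have A_root : A o = 0 by rewrite /A depth_root big_ord0.
have A_child w : w != o -> A w = A (p w) + fl w * res w.
  move=> wo; rewrite /A depth_parent// big_ord_recl /= addrC; congr (_ + _).
  by apply: eq_bigr => i _; rewrite -[iter i p (p w)]iterSr.
(* Every vertex lies on an infinite path, along which the partial sums are bounded by the potential
   1. *)
have A_le1 v : A v <= 1.
  have [y ty <-] := boundary_through has_child v.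
  have AE N : A (y N) = \sum_(0 <= n < N) f (y n.+1) * res (y n.+1).
    elim: N => [|N IH]; first by rewrite ty.1 A_root big_nil.
    have [yo py] := ty.2 N.
    by rewrite A_child// py IH big_nat_recr//= /fl (negbTE yo).
  by rewrite AE -lee_fin -pf; exact: (path_sum_le_potential res0 _ ff ty).
pose S n := flow_spin T th fl n.+1 o.
have cS n : cylfun (S n) by exact: flow_spin_cyl.
have dS n : dep_on (level_set T n.+1 o) (S n) by exact: flow_spin_dep.
have S2 n : Ex mu (fun x => S n x ^+ 2) <= a + a ^+ 2.
  have := flow_moment_le lf th_neq0 res0 (resistance_child beta J) fl_ge0
    fl_sum mP A_child A_le1 n.+1 o.
  by rewrite resistance_root mul1r mulr1 A_root subr0 mulr1 /fl eqxx.
have So n : Ex mu (fun x => S n x * sp x o) = a.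
  rewrite (Ex_flow_spin lf th_neq0 fl_sum mP); last 2 first.
  - exact: cylfun_spin.
  - by apply: dep_on_spin => -[].
  by rewrite (eq_Ex mu (G := fun=> 1)) ?Ex_cst ?mulr1 /fl ?eqxx// => x; exact: spin_sqr.
(* [S n] has second moment at most [a * (1 + a)] and correlation [a] with the root spin. After
   division by [1 + a], clipping costs at most a quarter of the second moment, that is
   [a / (4 * (1 + a))], out of a correlation [a / (1 + a)]. *)
have K0 : 0 < 1 + a by lra.
pose cl n x := clip (S n x / (1 + a)).
have ccl n : cylfun (cl n) by exact: (cylfun_comp (fun s => clip (s / (1 + a))) (cS n)).
pose m n := Ex mu (cl n).
have m1 n : `|m n| <= 1 by apply: Ex_norm_le => [|x];
  [exact: cylfun_bmT|exact: clip_norm].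
pose phi n x := (cl n x - m n) / 2.
have cphi n : cylfun (phi n) by exact: (cylfun_comp (fun s => (s - m n) / 2) (ccl n)).
(* Three quarters of [a / (1 + a)] survive the clipping; the halving in [phi], which keeps the
   centered variable within norm 1, leaves this [delta]. *)
apply: (@non_extremal phi (3 * a / (8 * (1 + a)))) => //.
- by move=> n x y xy; rewrite /phi /cl (dS n x y xy).
- move=> n x; rewrite /phi normrM normfV [X in _ / X]gtr0_norm// ler_pdivrMr// mul1r.
  by apply: (le_trans (ler_normB _ _)); rewrite (_ : 2 = 1 + 1)// lerD ?clip_norm.
- move=> n; rewrite (eq_Ex mu (G := fun x => 2^-1 * (cl n x - m n)));
  last by move=> x; rewrite mulrC.
  have bc : bmfun (cl n : config V -> R) by exact: cylfun_bmT.
  rewrite ExZ; last by apply: cylfun_bmT; apply: cylfunB => //; exact: cylfun_cst.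
  by rewrite ExB ?Ex_cst ?subrr ?mulr0//; exact: bmfun_cst.
- by rewrite divr_gt0// mulr_gt0.
move=> n.
have cs : cylfun (fun x => sp x o) by exact: cylfun_spin.
pose D x := (S n x / (1 + a) - cl n x) * sp x o.
have cD : cylfun D.
  by apply: cylfunM => //; apply: cylfunB => //; apply: cylfunM => //;
    exact: cylfun_cst.
have cSo : cylfun (fun x => S n x * sp x o) by exact: cylfunM.
have D1 : Ex mu D <= a / (4 * (1 + a)).
  have cS2 : cylfun (fun x => S n x ^+ 2) by exact: (cylfun_comp (fun s => s ^+
    2) (cS n)).
  apply: (@le_trans _ _ (Ex mu (fun x => (4 * (1 + a) ^+ 2)^-1 * S n x ^+ 2))).
    apply: le_Ex => [||x]; [exact: cylfun_bmT|by apply: cylfun_bmT;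
      apply: cylfunM => //; exact: cylfun_cst|].
    apply: (le_trans (ler_norm _)); rewrite normrM spin_norm mulr1.
    apply: (le_trans (clip_dist _)).
    rewrite le_eqVlt; apply/orP; left; apply/eqP; field.
    by rewrite gt_eqF.
  rewrite ExZ; last exact: cylfun_bmT.
  apply: (@le_trans _ _ ((4 * (1 + a) ^+ 2)^-1 * (a + a ^+ 2))).
    by rewrite ler_wpM2l// invr_ge0 mulr_ge0// sqr_ge0.
  rewrite le_eqVlt; apply/orP; left; apply/eqP; field.
  by rewrite gt_eqF.
rewrite (eq_Ex mu (G := fun x => (2 * (1 + a))^-1 * (S n x * sp x o) -
   (2^-1 * D x + m n / 2 * sp x o))); last first.
  by move=> x; rewrite /phi /D; field; rewrite gt_eqF.
have b1 : bmfun (fun x : config V => (2 * (1 + a))^-1 * (S n x * sp x o)).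
  by apply: cylfun_bmT; apply: cylfunM => //; exact: cylfun_cst.
have b2 : bmfun (fun x : config V => 2^-1 * D x).
  by apply: cylfun_bmT; apply: cylfunM => //; exact: cylfun_cst.
have b3 : bmfun (fun x : config V => m n / 2 * sp x o).
  by apply: cylfun_bmT; apply: cylfunM => //; exact: cylfun_cst.
rewrite ExB//; last exact: bmfunD.
rewrite ExD// !ExZ; [|exact: cylfun_bmT..].
rewrite So (Ex_spin (theta_root T beta J) mP) mulr0 addr0.
have -> : 3 * a / (8 * (1 + a)) = (2 * (1 + a))^-1 * a - 2^-1 * (a / (4 * (1 + a))).
  by field; rewrite gt_eqF.
by rewrite lerD2l lerN2 ler_wpM2l.
Qed.

End NonExtremality.

(** * Bounds on the hyperbolic tangent *)

Section Tanh.
Variable R : realType.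
Implicit Types x y : R.

Let denom_gt0 x : 0 < expR x + expR (- x).
Proof. by rewrite addr_gt0// expR_gt0. Qed.

Lemma tanh_lt1 x : tanh x < 1.
Proof.
by rewrite /tanh ltr_pdivrMr// mul1r; have := expR_gt0 (- x); lra.
Qed.

Lemma tanh_le x y : x <= y -> tanh x <= tanh y.
Proof.
move=> xy; rewrite /tanh ler_pdivrMr// mulrAC ler_pdivlMr//.
have : expR x * expR (- y) <= expR y * expR (- x).
  by apply: ler_pM; rewrite ?expR_ge0// ler_expR ?lerN2.
by rewrite !mulrDr !mulrBl; lra.
Qed.

Lemma tanh_gt0 x : 0 < x -> 0 < tanh x.
Proof.
move=> x0; rewrite /tanh divr_gt0// subr_gt0 ltr_expR; lra.
Qed.

End Tanh.

Theorem theorem2p1 (R : realType) (V : choiceType) (T : rooted_tree V)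
    (V_infinite : infinite_set [set: V])
    (T_locally_finite : locally_finite T)
    (T_no_leaves : no_leaves_except_root T)
    (J : V -> R) (Jmin Jmax : R) (Jmin_gt0 : 0 < Jmin)
    (J_bounds : forall v : V, v != tree_root T -> Jmin <= J v <= Jmax)
    (beta : R) (beta_gt0 : 0 < beta)
    (mu : probability (config V) R)
    (mu_free : is_free_boundary_gibbs T beta J mu) :
  extremal_gibbs T beta J mu <->
  capacity T 2 (resistance T beta J) = 0%E.
Proof.
(* A vertex other than the root exists by infiniteness; it lies below some child of the root, so the
   root has a child as well. *)
have [v0 v0o] : exists v, v != tree_root T.
  apply: contrapT => h; apply: V_infinite.
  apply: (@sub_finite_set _ _ [set tree_root T]); last exact: finite_set1.
  by move=> v _; apply: contrapT => /eqP vo; apply: h; exists v.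
have has_child v : children T v !=set0.
  have [->|vo] := eqVneq v (tree_root T); last exact: T_no_leaves.
  by have [w [cw _]] := subtree_child (tree_le_root T v0) v0o; exists w.
have th_gt0 w : w != tree_root T -> 0 < theta T beta J w.
  move=> wo; rewrite /theta (negbTE wo) tanh_gt0// mulr_gt0//.
  by have /andP[Jw _] := J_bounds w wo; exact: lt_le_trans Jw.
have th_le w : theta T beta J w <= tanh (beta * Jmax).
  have le u : u != tree_root T -> theta T beta J u <= tanh (beta * Jmax).
    move=> uo; rewrite /theta (negbTE uo) tanh_le// ler_pM2l//.
    by case/andP : (J_bounds u uo).
  have [->|] := eqVneq w (tree_root T); last exact: le.
  by rewrite theta_root (le_trans (ltW (th_gt0 _ v0o)) (le _ v0o)).
have mP := free_markov mu_free.
split => [ext|cap0].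
  by apply: contrapT => /(not_extremal_of_capacity T_locally_finite has_child
    mP th_gt0).
exact: (extremal_of_capacity T_locally_finite has_child th_gt0 th_le (tanh_lt1
  _) cap0 mP).
Qed.
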